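(* Let $M$ be a compact oriented 3-manifold with nonempty boundary consisting of tori, and let $\mathcal T$ be a 1-efficient ideal triangulation of $M$. Then for all elements $(m,e)\in H_1(\partial M,\mathbb Z)$ we have $$I^{\mathrm{FKB}}_{\mathcal T}(m,e)(q)=I_{\mathcal T}(m,e)(q),$$ where $I^{\mathrm{FKB}}_{\mathcal T}$ is the Frohman–Kania-Bartoszynska (FKB) invariant and $I_{\mathcal T}$ is the 3D-index of Dimofte–Gaiotto–Gukov.
   Context: **1-efficient.** An ideal triangulation is 1-efficient if it contains no embedded normal 2-spheres, projective planes or Klein bottles and its only embedded normal tori are the vertex-linking (boundary-parallel) ones. Let $\mathcal T$ have $t$ tetrahedra; since $\partial M$ consists of tori it has $t$ ideal edges $e_1,\dots,e_t$. **$q$-series.** $(q)_n=(q;q)_n=\prod_{j=1}^n(1-q^j)$ for $n\ge 0$, $(q)_\infty=\prod_{j\ge1}(1-q^j)$, and $1/(q)_n=0$ for $n<0$. The tetrahedron index is $$I_\Delta(m,e)(q)=\sum_{n\ge\max\{0,-e\}}(-1)^n\frac{q^{\frac12 n(n+1)-(n+\frac12 e)m}}{(q)_n(q)_{n+e}},\qquad m,e\in\mathbb Z,$$ and for $a,b,c\in\mathbb Z$ $$J_\Delta(a,b,c)=(-q^{1/2})^{-b}I_\Delta(b-c,a-b),$$ which is symmetric in $a,b,c$ and satisfies $J_\Delta(a,b,c)=(-q^{1/2})^sJ_\Delta(a+s,b+s,c+s)$. Also $$J^{\mathrm{FKB}}_\Delta(a,b,c)=(q)_\infty\sum_{n\in\mathbb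 Z}(-1)^n\frac{q^{\frac12n(3n+1)+n(a+b+c)+\frac12(ab+bc+ca)}}{(q)_{n+a}(q)_{n+b}(q)_{n+c}}.$$ **Quad vectors.** Each tetrahedron has three quadrilateral types, in bijection with the pairs of opposite edges (a quad type ''faces'' the pair of opposite edges it is disjoint from). Vectors in $\mathbb Z^{3t}$, written $(a_1,b_1,c_1,\dots,a_t,b_t,c_t)$, have one coordinate per tetrahedron and quad type. - $T_j$ is the vector with $(1,1,1)$ at the $j$-th tetrahedron and $0$ elsewhere; $\mathbb T$ is the $\mathbb Z$-span of $T_1,\dots,T_t$. - $E_i$ is the vector whose coordinate at a quad type $Q$ of the $j$-th tetrahedron is the number of edges of that tetrahedron which are identified to $e_i$ and faced by $Q$; $\mathbb E$ is the $\mathbb Z$-span of $E_1,\dots,E_t$. - For $\gamma\in H_1(\partial M,\mathbb Z)$ represent $\gamma$ by an oriented essential simple closed multicurve in normal position with respect to the triangulation of $\partial M$ by vertex links. Each of its arcs cuts off one corner of a triangle, and that corner lies at some edge of a tetrahedron. The vector $w_\gamma\in\mathbb Z^{3t}$ is the sum over all arcs of $\pm1$ times the basis vector of the quad type facing that edge, with sign $+$ (respectively $-$) if the corner lies to the left (respectively right) of $\gamma$ as viewed from the cusp. - $\chi$ is the formal Euler characteristic, linear with $\chi(E_i)=-2$, $\chi(T_j)=-1$, $\chi(w_\gamma)=0$. **3D-index.** For $S=(a_1,b_1,c_1,\dots,a_t,b_t,c_t)\in w_\gamma+\mathbb E+\mathbb T$ set $I(S)=(-q^{1/2})^{-\chi(S)}\prod_{j=1}^tJ_\Delta(a_j,b_j,c_j)$;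 this depends only on the class of $S$ modulo $\mathbb T$. For $\gamma=(m,e)\in H_1(\partial M,\mathbb Z)$, $$I_{\mathcal T}(m,e)(q)=\sum_{[S]\in(w_\gamma+\mathbb E+\mathbb T)/\mathbb T}I(S).$$ **FKB invariant, $\gamma=0$.** Let $X$ be the spine dual to $\mathcal T$ (the dual 2-skeleton), with vertices $V(X)$ (dual to tetrahedra), edges $E(X)$ (dual to triangular faces) and faces $F(X)$ (dual to ideal edges). A triple of natural numbers is admissible if its sum is even and it satisfies the triangle inequalities. A (closed) spinal surface $\Sigma$ is encoded by an admissible coloring: an assignment of a natural number $u_f$ to each $f\in F(X)$ such that at every edge of $X$ the three colors $(a_e,b_e,c_e)$ form an admissible triple. At a vertex $v$ denote the six colors by $a,b,c,d,e,f$, where $\{a,d\},\{b,c\},\{e,f\}$ are the pairs of opposite edges of the tetrahedron and $(a,b,e),(a,c,f),(c,d,e),(b,d,f)$ are the triples at its four faces, and put $$S_1=\tfrac12(a+d+b+c),\quad S_2=\tfrac12(a+d+e+f),\quad S_3=\tfrac12(b+c+e+f),\quad S^*=\min\{S_1,S_2,S_3\},\quad S_i^*=S_i-S^*.$$ The quad coordinates of $\Sigma$ at this tetrahedron are $(a_j,b_j,c_j)=(S_1^*,S_2^*,S_3^* )$, for the quad types facing $\{e,f\}$, $\{b,c\}$, $\{a,d\}$ respectively. The Euler characteristic is $\chi(\Sigma)=\sum_{f\in F(X)}u_f-\sum_{e\in E(X)}\frac{a_e+b_e+c_e}{2}+\sum_{v\in V(X)}S^*_v$. The boundary torus at a given cusp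 is the spinal surface whose color on the face dual to an ideal edge is the number of ends of that edge at that cusp. $\Sigma$ is unpeelable if it cannot be written as the sum (of colorings) of a spinal surface and a boundary torus. The weight of $\Sigma$ is $E_\infty(\Sigma)=(-q^{1/2})^{-\chi(\Sigma)}\prod_{j=1}^tJ^{\mathrm{FKB}}_\Delta(a_j,b_j,c_j)$, and $$I^{\mathrm{FKB}}_{\mathcal T}(0,0)(q)=\sum_{\Sigma\ \text{closed unpeelable}}E_\infty(\Sigma).$$ (This invariant was introduced by FKB as $\lim_{N\to\infty}\frac2N\mathrm{TV}_X^{(N)}(q)$, where $\mathrm{TV}^{(N)}_X(q)$ is the Turaev–Viro state sum over admissible colorings with all colors at most $N$ and $|q|<1$; its equality with the generating series above is a theorem of FKB.) **FKB invariant, general $\gamma$.** For $\gamma=(m,e)\in H_1(\partial M,\mathbb Z)$, $I^{\mathrm{FKB}}_{\mathcal T}(m,e)(q)$ is the generating series $\sum_\Sigma E_\infty(\Sigma)$ of unpeelable surfaces $\Sigma$ with boundary $\gamma$. For $\gamma\ne0$ these are encoded by their quad coordinate vectors, namely the vectors $(a_1,b_1,c_1,\dots,a_t,b_t,c_t)\in\mathbb N^{3t}\cap(w_\gamma+\mathbb E+\mathbb T)$ with $\min\{a_j,b_j,c_j\}=0$ for all $j$, and $E_\infty(\Sigma)=(-q^{1/2})^{-\chi(\Sigma)}\prod_{j=1}^tJ^{\mathrm{FKB}}_\Delta(a_j,b_j,c_j)$ with $\chi$ the formal Euler characteristic above.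
   Formalization: For γ=0 the FKB sum is taken only over closed unpeelable surfaces whose quad vector lies in E+T; without this restriction the equality fails when H^1(M;Z/2)→H^1(∂M;Z/2) is not injective (a 3-tetrahedron one-cusped example has an extra term -q^{1/2}). *)

(* Defs.v *)
From mathcomp Require Import all_boot all_order all_algebra.
From mathcomp Require Import perm.
From mathcomp Require Import mathcomp_extra boolp classical_sets functions.
From mathcomp Require Import cardinality fsbigop.

Set Implicit Arguments.
Unset Strict Implicit.
Unset Printing Implicit Defensive.

Import Order.TTheory GRing.Theory Num.Theory.

Local Open Scope ring_scope.

(** * Formal Laurent series in q^(1/2) *)

(* [f k] is the coefficient of q^(k/2).  The series below are all bounded
   below, so the sums defining [qmul] have finite support ([\sum_(i \in A)]
   of fsbigop is 0 on infinite supports). *)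
Definition qseries := int -> int.

Definition qmon (c k : int) : qseries := fun n => if n == k then c else 0.

Definition qone : qseries := qmon 1 0.

Definition qmul (f g : qseries) : qseries :=
  fun n => \sum_(i \in [set: int]%classic) f i * g (n - i).

(* Convergence in Z((q^(1/2))): all but finitely many of the terms lie in
   q^(N/2) Z[[q^(1/2)]], for every N.  Coefficients are then finite sums. *)
Definition qsummable (I : choiceType) (A : set I) (F : I -> qseries) : Prop :=
  forall N : int,
    finite_set [set i | A i /\ exists k, k <= N /\ F i k != 0]%classic.

Definition qsum (I : choiceType) (A : set I) (F : I -> qseries) : qseries :=
  fun k => \sum_(i \in A) F i k.

(* (- q^(1/2))^k *)
Definition negsqrtq (k : int) : qseries := qmon ((-1) ^ k) k.

(* (q)_n *)
Definition qpoch (n : nat) : qseries :=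
  \big[qmul/qone]_(1 <= j < n.+1)
    (fun k => qmon 1 0 k - qmon 1 (2 * j%:Z) k).

(* (q)_oo: the factors 1 - q^j with j > |k| do not affect the coefficient of
   q^(k/2). *)
Definition qpoch_inf : qseries := fun k => qpoch `|k|%N k.

(* 1 / (1 - q^j) = 1 + q^j + q^(2j) + ..., for j > 0 *)
Definition qgeom (j : nat) : qseries :=
  fun k => if (0 <= k) && (2 * j%:Z %| k)%Z then 1 else 0.

(* 1 / (q)_n, which is 0 for n < 0 *)
Definition qpoch_inv (n : int) : qseries :=
  match n with
  | Posz m => \big[qmul/qone]_(1 <= j < m.+1) qgeom j
  | Negz _ => fun=> 0
  end.

Definition I_Delta (m e : int) : qseries :=
  qsum [set n : int | 0 <= n /\ - e <= n]%classic (fun n : int =>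
    qmul (qmon ((-1) ^ n) (n * (n + 1) - (2 * n + e) * m))
         (qmul (qpoch_inv n) (qpoch_inv (n + e)))).

Definition J_Delta (a b c : int) : qseries :=
  qmul (negsqrtq (- b)) (I_Delta (b - c) (a - b)).

Definition J_FKB (a b c : int) : qseries :=
  qmul qpoch_inf (qsum [set: int]%classic (fun n : int =>
    qmul (qmon ((-1) ^ n)
            (n * (3 * n + 1) + 2 * n * (a + b + c) + (a * b + b * c + c * a)))
         (qmul (qpoch_inv (n + a))
               (qmul (qpoch_inv (n + b)) (qpoch_inv (n + c)))))).

(** * Oriented ideal triangulations *)

(* Tetrahedron j has vertices 0..3 and is oriented by their order; face f is
   opposite to vertex f.  Face f of j is glued to a face of [nbr j f] by the
   restriction of the permutation [glue j f], which sends f to the number of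
   that face.  Permutations are odd, so that gluings reverse the orientations
   of the faces and the quotient is oriented. *)
Record triangulation (t : nat) := Triangulation {
  nbr : 'I_t -> 'I_4 -> 'I_t;
  glue : 'I_t -> 'I_4 -> 'S_4;
  nbrK : forall j f, nbr (nbr j f) (glue j f f) = j;
  glueK : forall j f, glue (nbr j f) (glue j f f) = (glue j f)^-1%g;
  glue_free : forall j f, (nbr j f, glue j f f) <> (j, f);
  glue_odd : forall j f, odd_perm (glue j f)
}.

(* A quad type Q is the partition of the vertices into {0, Q+1} and its
   complement: the pair of opposite edges that it faces. *)
Definition quad_edge (Q : 'I_3) : {set 'I_4} := [set ord0; lift ord0 Q].

Definition faces (Q : 'I_3) (A : {set 'I_4}) : bool :=
  (A == quad_edge Q) || (A == ~: quad_edge Q).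

Section Cells.
Variables (t : nat) (T : triangulation t).

(* A face of tetrahedron j, given by its set of vertices. *)
Definition cell : finType := ('I_t * {set 'I_4})%type.

Definition cell_glued (x y : cell) : bool :=
  [exists f, (f \notin x.2)
    && (y == (nbr T x.1 f, [set glue T x.1 f a | a in x.2]))].

(* Cells of the quotient, with d vertices. *)
Definition cell_classes (d : nat) : {set {set cell}} :=
  equivalence_partition (connect cell_glued) [set x : cell | #|x.2| == d].

Definition ideal_vertex := {v : {set cell} | v \in cell_classes 1}.
Definition ideal_edge := {e : {set cell} | e \in cell_classes 2}.

(** * Embedded normal surfaces *)

(* Normal coordinates: numbers of triangles cutting off each vertex and of
   quads of each type. *)
Record normal_coord := NormalCoord {
  ntri : 'I_t -> 'I_4 -> nat;
  nquad : 'I_t -> 'I_3 -> nat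
}.

Section Surface.
Variable N : normal_coord.

(* The quads facing the edge {v, w} of j. *)
Definition nquad_at (j : 'I_t) (v w : 'I_4) : nat :=
  (\sum_(Q | faces Q [set v; w]) nquad N j Q)%N.

(* Arcs in face f of j cutting off its vertex v: they come from the triangles
   at v and from the quads which separate {v, f} from the other vertices. *)
Definition narcs (j : 'I_t) (f v : 'I_4) : nat :=
  (ntri N j v + nquad_at j f v)%N.

Definition embedded_normal : Prop :=
  (forall j Q Q', Q != Q' -> nquad N j Q = 0%N \/ nquad N j Q' = 0%N) /\
  (forall j f v, v != f ->
     narcs (nbr T j f) (glue T j f f) (glue T j f v) = narcs j f v).

(* Flags (disc, side of the disc, endpoint of the side) of the cellulation of
   the surface by its normal discs: (j, f, v, x, k) stands for the k-th arc,
   counted from v, among the arcs in face f of j which cut off v, with its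
   endpoint on the edge {v, x}; the disc is the one inside j. *)
Definition flag : finType :=
  ('I_t * 'I_4 * 'I_4 * 'I_4 *
   'I_(\max_(j < t) \max_(f < 4) \max_(v < 4) narcs j f v)%N)%type.

Definition flags : {set flag} :=
  [set a : flag | let: (j, f, v, x, k) := a in
     uniq [:: f; v; x] && (k < narcs j f v)%N].

(* Same disc and side, other endpoint. *)
Definition flag0 (a b : flag) : bool :=
  let: (j, f, v, x, k) := a in
  [exists y, uniq [:: f; v; x; y] && (b == (j, f, v, y, k))].

(* Same disc and endpoint, other side.  The first [ntri N j v] arcs around v
   belong to triangles, the next ones to quads; the order of the latter is
   reversed when they are counted from x instead of v. *)
Definition flag1 (a b : flag) : bool :=
  let: (j, f, v, x, k) := a in
  [exists y, uniq [:: f; v; x; y] &&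
    if (k < ntri N j v)%N then b == (j, y, v, x, k)
    else (b.1 == (j, y, x, v)) &&
         (b.2 == ntri N j x + (nquad_at j f v - (k - ntri N j v)).-1 :> nat)%N].

(* Same side and endpoint, other disc. *)
Definition flag2 (a b : flag) : bool :=
  let: (j, f, v, x, k) := a in
  let p := glue T j f in b == (nbr T j f, p f, p v, p x, k).

Definition flag_orbits (r : rel flag) : nat :=
  #|equivalence_partition (connect r) flags|.

Definition surface_euler : int :=
  (flag_orbits (relU flag1 flag2))%:Z - (flag_orbits (relU flag0 flag2))%:Z
  + (flag_orbits (relU flag0 flag1))%:Z.

Definition surface_connected : bool :=
  flag_orbits (relU flag0 (relU flag1 flag2)) == 1%N.

Definition surface_orientable : Prop :=
  exists s : flag -> bool, forall a b, a \in flags -> b \in flags ->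
    flag0 a b || flag1 a b || flag2 a b -> s a != s b.

(* Connected closed surfaces are recognized by orientability and Euler
   characteristic. *)
Definition is_sphere : Prop :=
  surface_connected /\ surface_orientable /\ surface_euler = 2.
Definition is_projective_plane : Prop :=
  surface_connected /\ ~ surface_orientable /\ surface_euler = 1.
Definition is_torus : Prop :=
  surface_connected /\ surface_orientable /\ surface_euler = 0.
Definition is_klein_bottle : Prop :=
  surface_connected /\ ~ surface_orientable /\ surface_euler = 0.

Definition is_vertex_linking : Prop :=
  exists v : ideal_vertex,
    (forall j a, ntri N j a = ((j, [set a]) \in val v)) /\
    (forall j Q, nquad N j Q = 0%N).

End Surface.

Definition vertex_link (v : ideal_vertex) : normal_coord :=
  NormalCoord (fun j a => ((j, [set a]) \in val v) : nat) (fun _ _ => 0%N).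

(* The compact manifold obtained by truncating the ideal vertices is bounded
   by the vertex links. *)
Definition torus_boundary : Prop :=
  forall v : ideal_vertex, is_torus (vertex_link v).

Definition one_efficient : Prop :=
  forall N : normal_coord, embedded_normal N ->
    [/\ ~ is_sphere N, ~ is_projective_plane N, ~ is_klein_bottle N
      & is_torus N -> is_vertex_linking N].

(** * Homology of the boundary *)

(* The link triangle (j, v) of the boundary has a corner (j, v, a) on the edge
   {v, a} for each a <> v, and a side in each face f <> v of j, joining the
   corners a, b such that {v, f, a, b} is everything.

   H_1(boundary, Z) is computed with the cellulation dual to the triangulation
   by vertex links: a 1-chain z gives the number z j v a b of crossings of the
   side of (j, v) between the corners a and b, counted positively with a on
   the left of the curve, as viewed from the cusp. *)
Definition chain := 'I_t -> 'I_4 -> 'I_4 -> 'I_4 -> int.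

Definition is_cycle (z : chain) : Prop :=
  [/\ forall j v a b, uniq [:: v; a; b] -> z j v b a = - z j v a b,
      forall j v a b f, uniq [:: v; a; b; f] ->
        let p := glue T j f in z (nbr T j f) (p v) (p a) (p b) = z j v a b
    & forall j v a b c, uniq [:: v; a; b; c] ->
        z j v a b + z j v b c + z j v c a = 0].

(* h is a 2-chain: it gives the multiplicity of the dual 2-cell at each vertex
   of the boundary triangulation. *)
Definition null_homologous (z : chain) : Prop :=
  exists h : 'I_t -> 'I_4 -> 'I_4 -> int,
    (forall j v a f, uniq [:: v; a; f] ->
       let p := glue T j f in h (nbr T j f) (p v) (p a) = h j v a) /\
    (forall j v a b, uniq [:: v; a; b] -> z j v a b = h j v a - h j v b).

Definition homologous (z z' : chain) : Prop :=
  null_homologous (fun j v a b => z j v a b - z' j v a b).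

(** * Oriented normal multicurves on the boundary *)

(* [ncorner j v a] arcs cut off the corner a of the link triangle (j, v); they
   are numbered starting from the corner, and [corner_left j v a k] tells whether the
   corner lies on the left of the k-th one, as viewed from the cusp (on the
   right otherwise).  Since the boundary is oriented, this amounts to an
   orientation of the arcs. *)
Record multicurve := Multicurve {
  ncorner : 'I_t -> 'I_4 -> 'I_4 -> nat;
  corner_left : 'I_t -> 'I_4 -> 'I_4 -> nat -> bool
}.

Section Multicurves.
Variable c : multicurve.

Definition curve_arc : finType :=
  ('I_t * 'I_4 * 'I_4 *
   'I_(\max_(j < t) \max_(v < 4) \max_(a < 4) ncorner c j v a)%N)%type.

Definition arcs : {set curve_arc} :=
  [set x : curve_arc | let: (j, v, a, k) := x in
     (v != a) && (k < ncorner c j v a)%N].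

(* Arc x crosses the side of (j, v) in face f at its k-th point counted from
   the corner a, where k is the number of x.  On the other side, that point
   belongs to an arc around the corner a again (glued_same) or, if k is too
   large, to an arc around the other end b of the side (glued_other). *)
Definition glued_same (x y : curve_arc) : bool :=
  let: (j, v, a, k) := x in
  [exists f, uniq [:: v; a; f] &&
    (let p := glue T j f in
     (k < ncorner c (nbr T j f) (p v) (p a))%N
     && (y == (nbr T j f, p v, p a, k)))].

Definition glued_other (x y : curve_arc) : bool :=
  let: (j, v, a, k) := x in
  [exists f, [exists b, uniq [:: v; a; b; f] &&
    (let p := glue T j f in
     let n := ncorner c (nbr T j f) (p v) in
     [&& (n (p a) <= k)%N, y.1 == (nbr T j f, p v, p b)
       & (y.2 == (n (p a) + n (p b) - k).-1 :> nat)%N])]].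

Definition arc_left (x : curve_arc) : bool :=
  let: (j, v, a, k) := x in corner_left c j v a k.

(* Normal position, and coherent orientation: two successive arcs around the
   ends a and b of a side have opposite corners on their left. *)
Definition oriented_normal : Prop :=
  [/\ forall j v a b f, uniq [:: v; a; b; f] ->
        let p := glue T j f in let n := ncorner c (nbr T j f) (p v) in
        (n (p a) + n (p b) = ncorner c j v a + ncorner c j v b)%N,
      forall x y, x \in arcs -> y \in arcs -> glued_same x y ->
        arc_left y = arc_left x
    & forall x y, x \in arcs -> y \in arcs -> glued_other x y ->
        arc_left y = ~~ arc_left x].

(* Signed count of the arcs of X around the corner a of (j, v). *)
Definition corner_sign (X : {set curve_arc}) (j : 'I_t) (v a : 'I_4) : int :=
  \sum_(x in X | x.1 == (j, v, a)) if arc_left x then 1 else -1.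

Definition arcs_chain (X : {set curve_arc}) : chain :=
  fun j v a b => corner_sign X j v a - corner_sign X j v b.

Definition component (x : curve_arc) : {set curve_arc} :=
  [set y in arcs | connect (relU glued_same glued_other) x y].

(* A simple closed curve on a torus bounds a disc if and only if it is
   null-homologous. *)
Definition essential : Prop :=
  forall x, x \in arcs -> ~ null_homologous (arcs_chain (component x)).

(* The zero class is represented by the empty multicurve. *)
Definition represents (g : chain) : Prop :=
  [/\ oriented_normal, essential, homologous (arcs_chain arcs) g
    & null_homologous g -> arcs = finset.set0].

End Multicurves.

(** * Quad vectors *)

(* Rows are indexed by tetrahedra, columns by quad types. *)
Definition quad_vector := 'M[int]_(t, 3).

Definition T_vec (j : 'I_t) : quad_vector := \matrix_(i, Q) (i == j)%:R.

Definition E_vec (e : ideal_edge) : quad_vector :=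
  \matrix_(j, Q) #|[set A | ((j, A) \in val e) && faces Q A]|%:Z.

Definition w_vec (c : multicurve) : quad_vector :=
  \matrix_(j, Q) \sum_(v < 4) \sum_(a < 4 | faces Q [set v; a])
    corner_sign (arcs c) j v a.

Definition E_span (x : ideal_edge -> int) : quad_vector :=
  \sum_e x e *: E_vec e.
Definition T_span (y : 'I_t -> int) : quad_vector :=
  \sum_j y j *: T_vec j.

(* w + EE + TT *)
Definition coset (w : quad_vector) : set quad_vector :=
  [set S | exists x y, S = w + E_span x + T_span y]%classic.

(* The formal Euler characteristic on w + EE + TT, linear with value -2 on
   E_vec, -1 on T_vec and 0 on w. *)
Definition formal_euler (w S : quad_vector) : int :=
  xget 0 [set k | exists x y, S = w + E_span x + T_span y /\
    k = - 2 * (\sum_e x e) - \sum_j y j]%classic.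

(* (- q^(1/2))^(-chi) prod_j J(a_j, b_j, c_j) *)
Definition weight (J : int -> int -> int -> qseries) (chi : int)
    (S : quad_vector) : qseries :=
  qmul (negsqrtq (- chi)) (\big[qmul/qone]_(j < t) J (S j 0) (S j 1) (S j 2)).

(** * The 3D-index *)

Definition class_mod_T (S : quad_vector) : set quad_vector :=
  [set S' | exists y, S' = S + T_span y]%classic.

Definition index_classes (c : multicurve) : set (set quad_vector) :=
  [set class_mod_T S | S in coset (w_vec c)]%classic.

(* I(S), for a representative S of the class C *)
Definition index_term (c : multicurve) (C : set quad_vector) : qseries :=
  let S := xget 0 C in weight J_Delta (formal_euler (w_vec c) S) S.

Definition index3D (c : multicurve) : qseries :=
  qsum (index_classes c) (index_term c).

Definition index3D_converges (c : multicurve) : Prop :=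
  qsummable (index_classes c) (index_term c).

(** * Closed spinal surfaces *)

Definition coloring := {ffun ideal_edge -> nat}.

Section Coloring.
Variable u : coloring.

(* The color of the edge A of tetrahedron j (when #|A| = 2, the sum has a
   single term). *)
Definition color (j : 'I_t) (A : {set 'I_4}) : nat :=
  (\sum_(e : ideal_edge | (j, A) \in val e) u e)%N.

Definition admissible (a b c : nat) : bool :=
  [&& ~~ odd (a + b + c), (a <= b + c)%N, (b <= a + c)%N & (c <= a + b)%N].

Definition spinal : Prop :=
  forall j f x y z, uniq [:: f; x; y; z] ->
    admissible (color j [set x; y]) (color j [set y; z]) (color j [set x; z]).

(* Half the sum of the colors of the four edges not faced by Q *)
Definition half_sum (j : 'I_t) (Q : 'I_3) : nat :=
  (\sum_(A : {set 'I_4} | (#|A| == 2) && ~~ faces Q A) color j A)%N./2.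

Definition min_half_sum (j : 'I_t) : nat :=
  minn (half_sum j 0) (minn (half_sum j 1) (half_sum j 2)).

Definition spinal_quads : quad_vector :=
  \matrix_(j, Q) ((half_sum j Q)%:Z - (min_half_sum j)%:Z).

(* Half the sum of the colors of the edges of face f of j *)
Definition face_half_sum (j : 'I_t) (f : 'I_4) : nat :=
  (\sum_(A : {set 'I_4} | (#|A| == 2) && (f \notin A)) color j A)%N./2.

(* Each triangle of the triangulation is a face (j, f) of tetrahedra in
   exactly two ways, hence the outer half in the second term. *)
Definition spinal_euler : int :=
  (\sum_e u e)%N%:Z - (\sum_(j < t) \sum_(f < 4) face_half_sum j f)%N./2%:Z
  + (\sum_(j < t) min_half_sum j)%N%:Z.

End Coloring.

(* The color of an edge is its number of ends at v. *)
Definition is_boundary_torus (v : ideal_vertex) (b : coloring) : Prop :=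
  forall (e : ideal_edge) j A, (j, A) \in val e ->
    b e = #|[set a in A | (j, [set a]) \in val v]|.

Definition unpeelable (u : coloring) : Prop :=
  ~ exists (v : ideal_vertex) (b u' : coloring),
      [/\ is_boundary_torus v b, spinal u' & forall e, u e = (u' e + b e)%N].

(** * The FKB invariant *)

(* The surfaces with boundary g have their quad vectors in w + EE + TT; here
   w = 0.  For a spinal surface this holds exactly when its colors mod 2 are a
   sum of boundary tori mod 2, hence always if H^1(M; Z/2) injects into
   H^1(boundary; Z/2).  Other spinal surfaces have no counterpart in the
   3D-index, which only sums over EE + TT. *)
Definition closed_surfaces : set coloring :=
  [set u | [/\ spinal u, unpeelable u & coset 0 (spinal_quads u)]]%classic.

Definition closed_term (u : coloring) : qseries :=
  weight J_FKB (spinal_euler u) (spinal_quads u).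

Definition bounded_surfaces (c : multicurve) : set quad_vector :=
  [set S | coset (w_vec c) S /\
     forall j : 'I_t, (forall Q, 0 <= S j Q) /\ (exists Q, S j Q = 0)]%classic.

Definition bounded_term (c : multicurve) (S : quad_vector) : qseries :=
  weight J_FKB (formal_euler (w_vec c) S) S.

Definition FKB (g : chain) (c : multicurve) : qseries :=
  if `[< null_homologous g >] then qsum closed_surfaces closed_term
  else qsum (bounded_surfaces c) (bounded_term c).

Definition FKB_converges (g : chain) (c : multicurve) : Prop :=
  if `[< null_homologous g >] then qsummable closed_surfaces closed_term
  else qsummable (bounded_surfaces c) (bounded_term c).

End Cells.

(* Main.v *)
(* The two tetrahedron weights are equal: Euler's identity for
   (q)_oo / (q)_(n+c), followed by a q-Vandermonde summation over n, turns J_FKB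
   into J_Delta.  Shifting the three arguments by the same integer therefore
   multiplies the weight by a monomial, and each class modulo TT can be
   represented by its normal form, the vector with minimum 0 at each
   tetrahedron.  When the boundary class is not 0, these are the surfaces of the
   FKB sum.  When it is 0, two spinal surfaces with the same quads differ by an
   integral combination of boundary tori, so that there is exactly one
   unpeelable surface for each normal form.

   For convergence, a nonnegative vector of EE + TT with at most one quad type
   in each tetrahedron consists of the quads of an embedded normal surface, and
   its formal Euler characteristic is that of the surface.  A connected surface
   of positive Euler characteristic is a sphere or a projective plane, and one of
   Euler characteristic 0 is a torus or a Klein bottle; hence 1-efficiency makes
   it at most 0, with equality only for vertex links, which have no quads.  In general, the leading degree of the weight of S is at least
   -chi(S) plus a quadratic term, which vanishes exactly when there is at most
   one quad type in each tetrahedron; on a finite set of generators (Dickson's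
   lemma) this degree grows at least linearly. *)

Require Import Defs.
From HB Require Import structures.
From mathcomp Require Import all_boot all_order all_algebra.
From mathcomp Require Import perm zify ring lra.
From mathcomp Require Import mathcomp_extra boolp classical_sets functions.
From mathcomp Require Import cardinality fsbigop.
Import Defs.

Set Implicit Arguments.
Unset Strict Implicit.
Unset Printing Implicit Defensive.

Import Order.TTheory GRing.Theory Num.Theory.

Local Open Scope ring_scope.

(** The surface theory is built combinatorially. A normal surface is a set of flags with three fixed
    point free involutions, its cells being the orbits of pairs of them. When it is connected, ranks
    in a rational chain complex bound its Euler characteristic: the 2-cycles have dimension at most
    1, and 0 without an orientation. Signs of permutations give the parity in the orientable case.
    This meets 1-efficiency, which is phrased through orientability and Euler characteristic.

    Counting cells in normal coordinates gives a formula linear in the coordinates; it serves both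
    to split off components and to reach the formal Euler characteristic. Counting the vertices
    takes a consistent direction on each ideal edge, which exists because the manifold is oriented.
    The torus boundary enters as 2V = F on each link: the formal Euler characteristic is then well
    defined, and vertex links can be added freely to make triangle coordinates nonnegative.

    For closed surfaces the obstacle is parity: colors give explicit coefficients in EE + TT only
    for twice the quad vector. *)

(** * Finitely supported sums over the integers *)

Lemma fsbig_int_range (V : nmodType) (a : int) (N : nat) (f : int -> V) :
  (forall n : int, n < a \/ a + N%:Z <= n -> f n = 0) ->
  \sum_(n \in [set: int]%classic) f n = \sum_(i < N) f (a + i%:Z).
Proof.
move=> f0; rewrite -(big_mkord xpredT (fun i : nat => f (a + i%:Z))).
rewrite /index_iota subn0 -(big_map (fun i : nat => a + i%:Z) xpredT f).
rewrite [RHS]fsbig_seq; last by rewrite map_inj_uniq ?iota_uniq // => i j; lia.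
apply/esym/fsbig_widen => // n [_ /= nr]; apply: f0.
have [na|an] := ltP n a; [by left | right].
rewrite leNgt; apply/negP => na; apply: nr; apply/mapP; exists `|n - a|%N; last by lia.
by rewrite mem_iota; lia.
Qed.

(** A sum over an infinite support is 0 by convention, so the exchange is made inside a finite box
    that contains the support. *)
Lemma exchange_fsbig_box (V : nmodType) (B : nat) (F : int -> int -> V) :
  (forall i j, F i j != 0 -> (`|i| <= B)%N && (`|j| <= B)%N) ->
  \sum_(i \in [set: int]%classic) \sum_(j \in [set: int]%classic) F i j =
  \sum_(j \in [set: int]%classic) \sum_(i \in [set: int]%classic) F i j.
Proof.
move=> FB.
have out i j : (B < `|i|)%N \/ (B < `|j|)%N -> F i j = 0.
  by move=> ij; apply/eqP/negPn/negP => /FB; lia.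
have ri i : \sum_(j \in [set: int]%classic) F i j
    = \sum_(j < (2 * B).+1) F i (- B%:Z + j%:Z).
  by apply: fsbig_int_range => n n_out; apply: out; right; lia.
have rj j : \sum_(i \in [set: int]%classic) F i j
    = \sum_(i < (2 * B).+1) F (- B%:Z + i%:Z) j.
  by apply: fsbig_int_range => n n_out; apply: out; left; lia.
rewrite (eq_fsbigr (fun i => \sum_(j < (2 * B).+1) F i (- B%:Z + j%:Z)));
  last by move=> i _; exact: ri.
rewrite [RHS](eq_fsbigr (fun j => \sum_(i < (2 * B).+1) F (- B%:Z + i%:Z) j));
  last by move=> j _; exact: rj.
rewrite !(@fsbig_int_range _ (- B%:Z) (2 * B).+1).
- exact: exchange_big.
- by move=> n n_out; rewrite big1 // => i _; apply: out; right; lia.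
- by move=> n n_out; rewrite big1 // => i _; apply: out; left; lia.
Qed.

(** * The ring of Laurent series in q^(1/2) *)

Definition qlbound (a : int) (f : qseries) := forall k, k < a -> f k = 0.

Lemma qlboundW a b f : a <= b -> qlbound b f -> qlbound a f.
Proof. by move=> ab fb k ka; apply: fb; apply: lt_le_trans ab. Qed.

Definition series_poly (a : int) (N : nat) (f : qseries) : {poly int} :=
  \poly_(i < N) f (a + i%:Z).

(** A coefficient of a product only sees truncations of the factors; the ring laws below are thus
    transported from polynomials. *)
Lemma qmul_coef a b N n f g : qlbound a f -> qlbound b g -> (n < N)%N ->
  qmul f g (a + b + n%:Z) = (series_poly a N f * series_poly b N g)`_n.
Proof.
move=> fa gb nN; rewrite /qmul coefM (@fsbig_int_range _ a n.+1) => [|k].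
  apply: eq_bigr => i _; rewrite !coef_poly.
  have -> : (i < N)%N by have := ltn_ord i; lia.
  have -> : (n - i < N)%N by lia.
  by congr (_ * g _); have := ltn_ord i; lia.
by case=> ka; [rewrite fa ?mul0r | rewrite gb ?mulr0 //; lia].
Qed.

Lemma qlbound_qmul a b f g : qlbound a f -> qlbound b g -> qlbound (a + b) (qmul f g).
Proof.
move=> fa gb k kab; apply: fsbig1 => i _.
by have [/fa->|ai] := ltP i a; rewrite ?mul0r // gb ?mulr0 //; lia.
Qed.

Lemma qlbound_ext a f g : qlbound a f -> qlbound a g ->
  (forall n : nat, f (a + n%:Z) = g (a + n%:Z)) -> f = g.
Proof.
move=> fa ga fg; apply/funext => k.
have [ka|ak] := ltP k a; first by rewrite fa // ga.
by have -> : k = a + `|k - a|%N%:Z by lia.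
Qed.

Lemma qmulC_qlbound a b f g : qlbound a f -> qlbound b g -> qmul f g = qmul g f.
Proof.
move=> fa gb; apply: (@qlbound_ext (a + b)); first exact: qlbound_qmul.
  by rewrite addrC; apply: qlbound_qmul.
move=> n; rewrite (qmul_coef fa gb (ltnSn n)) (addrC a b).
by rewrite (qmul_coef gb fa (ltnSn n)) mulrC.
Qed.

Lemma series_poly_qmul a b N f g : qlbound a f -> qlbound b g ->
  forall i, (i < N)%N -> (series_poly (a + b) N (qmul f g))`_i =
    (series_poly a N f * series_poly b N g)`_i.
Proof. by move=> fa gb i iN; rewrite coef_poly iN (qmul_coef fa gb iN). Qed.

Lemma qmulA_qlbound a b c f g h : qlbound a f -> qlbound b g -> qlbound c h ->
  qmul f (qmul g h) = qmul (qmul f g) h.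
Proof.
move=> fa gb hc; have fg := qlbound_qmul fa gb; have gh := qlbound_qmul gb hc.
apply: (@qlbound_ext (a + b + c)); last 1 first.
- move=> n; rewrite (qmul_coef fg hc (ltnSn n)) -(addrA a b c).
  rewrite (qmul_coef fa gh (ltnSn n)) !coefM.
  transitivity (series_poly a n.+1 f * (series_poly b n.+1 g * series_poly c n.+1 h))`_n.
    rewrite coefM; apply: eq_bigr => i _; congr (_ * _).
    by rewrite (series_poly_qmul gb hc) //; lia.
  rewrite mulrA coefM; apply: eq_bigr => i _; congr (_ * _).
  by rewrite (series_poly_qmul fa gb).
- by rewrite -addrA; apply: qlbound_qmul.
- exact: qlbound_qmul.
Qed.

Lemma qmulDl_qlbound a f g h : qlbound a f -> qlbound a g -> qlbound a h ->
  qmul (fun k => f k + g k) h = fun k => qmul f h k + qmul g h k.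
Proof.
move=> fa ga ha; have fga : qlbound a (fun k => f k + g k).
  by move=> k ka; rewrite fa // ga.
apply: (@qlbound_ext (a + a)); first exact: qlbound_qmul.
  by move=> k kaa; rewrite (qlbound_qmul fa ha) // (qlbound_qmul ga ha).
move=> n; rewrite (qmul_coef fga ha (ltnSn n)) (qmul_coef fa ha (ltnSn n)).
rewrite (qmul_coef ga ha (ltnSn n)) -coefD -mulrDl; congr ((_ * _ : {poly int})`_n).
by apply/polyP => i; rewrite coefD !coef_poly; case: ifP; rewrite ?addr0.
Qed.

Lemma qmul_mon c k f n : qmul (qmon c k) f n = c * f (n - k).
Proof.
rewrite /qmul (@fsbig_int_range _ k 1) => [|i ik].
  by rewrite big_ord_recl big_ord0 /= addr0 addr0 /qmon eqxx.
by rewrite /qmon; case: eqVneq => [ik'|]; rewrite ?mul0r //; lia.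
Qed.

Lemma qlbound_qmon c k : qlbound k (qmon c k).
Proof. by move=> i ik; rewrite /qmon; case: eqVneq => // ik'; lia. Qed.

Lemma qmul1f f : qmul qone f = f.
Proof. by apply/funext => n; rewrite qmul_mon mul1r subr0. Qed.

(** [qmul] behaves as a product on series bounded below, where its sums are finite. On this subtype
    the ring laws hold, which gives access to [ring] and to big operators. *)
Definition is_laurent (f : qseries) : bool := `[< exists a, qlbound a f >].
Definition laurent := {f : qseries | is_laurent f}.
HB.instance Definition _ := SubType.on laurent.
HB.instance Definition _ := gen_eqMixin laurent.
HB.instance Definition _ := gen_choiceMixin laurent.

Lemma laurentP (f : laurent) : exists a, qlbound a (val f).
Proof. exact/asboolP/(valP f). Qed.

Lemma laurent2P (f g : laurent) : exists a, qlbound a (val f) /\ qlbound a (val g).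
Proof.
have [a fa] := laurentP f; have [b gb] := laurentP g.
by exists (Num.min a b); split; [apply: qlboundW fa | apply: qlboundW gb];
  rewrite ge_min lexx ?orbT.
Qed.

Definition mk_laurent (f : qseries) (a : int) (fa : qlbound a f) : laurent :=
  exist is_laurent f (asboolT (ex_intro _ a fa)).

Fact laurent0_key : qlbound 0 (fun=> 0). Proof. by []. Qed.
Definition laurent0 := mk_laurent laurent0_key.

Fact laurentD_key (f g : laurent) : is_laurent (fun k => val f k + val g k).
Proof.
apply/asboolP; have [a [fa ga]] := laurent2P f g.
by exists a => k ka; rewrite fa // ga.
Qed.
Definition laurentD f g : laurent := exist is_laurent _ (laurentD_key f g).

Fact laurentN_key (f : laurent) : is_laurent (fun k => - val f k).
Proof.
by apply/asboolP; have [a fa] := laurentP f; exists a => k ka; rewrite fa ?oppr0.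
Qed.
Definition laurentN f : laurent := exist is_laurent _ (laurentN_key f).

Fact laurentM_key (f g : laurent) : is_laurent (qmul (val f) (val g)).
Proof.
apply/asboolP; have [a fa] := laurentP f; have [b gb] := laurentP g.
by exists (a + b); apply: qlbound_qmul.
Qed.
Definition laurentM f g : laurent := exist is_laurent _ (laurentM_key f g).

Definition laurent1 := mk_laurent (@qlbound_qmon 1 0).

Lemma laurent_inj (f g : laurent) : val f = val g -> f = g.
Proof. exact: val_inj. Qed.

Fact laurent_addA : associative laurentD.
Proof. by move=> f g h; apply/laurent_inj/funext => k /=; rewrite addrA. Qed.
Fact laurent_addC : commutative laurentD.
Proof. by move=> f g; apply/laurent_inj/funext => k /=; rewrite addrC. Qed.
Fact laurent_add0 : left_id laurent0 laurentD.
Proof. by move=> f; apply/laurent_inj/funext => k /=; rewrite add0r. Qed.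
Fact laurent_addN : left_inverse laurent0 laurentN laurentD.
Proof. by move=> f; apply/laurent_inj/funext => k /=; rewrite addNr. Qed.
HB.instance Definition _ :=
  GRing.isZmodule.Build laurent laurent_addA laurent_addC laurent_add0 laurent_addN.

Fact laurent_mulA : associative laurentM.
Proof.
move=> f g h; apply: laurent_inj => /=.
have [a fa] := laurentP f; have [b gb] := laurentP g; have [c hc] := laurentP h.
exact: (qmulA_qlbound fa gb hc).
Qed.
Fact laurent_mulC : commutative laurentM.
Proof.
move=> f g; apply: laurent_inj => /=.
have [a fa] := laurentP f; have [b gb] := laurentP g.
exact: (qmulC_qlbound fa gb).
Qed.
Fact laurent_mul1 : left_id laurent1 laurentM.
Proof. by move=> f; apply: laurent_inj; apply: qmul1f. Qed.
Fact laurent_mulD : left_distributive laurentM laurentD.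
Proof.
move=> f g h; apply: laurent_inj => /=.
have [a [fa ga]] := laurent2P f g; have [b hb] := laurentP h.
by apply: (@qmulDl_qlbound (Num.min a b)); [apply: qlboundW fa | apply: qlboundW ga
  | apply: qlboundW hb]; rewrite ge_min lexx ?orbT.
Qed.
Fact laurent_1neq0 : laurent1 != 0.
Proof. by apply/eqP => /(congr1 val) /(congr1 (fun f : qseries => f 0)). Qed.
HB.instance Definition _ := GRing.Zmodule_isComNzRing.Build laurent
  laurent_mulA laurent_mulC laurent_mul1 laurent_mulD laurent_1neq0.

Lemma laurent_valM (f g : laurent) : val (f * g) = qmul (val f) (val g).
Proof. by []. Qed.
Lemma laurent_valD (f g : laurent) k : val (f + g) k = val f k + val g k.
Proof. by []. Qed.
Lemma laurent_valN (f : laurent) k : val (- f) k = - val f k.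
Proof. by []. Qed.
Lemma laurent_val_sum (I : Type) (r : seq I) (P : pred I) (F : I -> laurent) k :
  val (\sum_(i <- r | P i) F i) k = \sum_(i <- r | P i) val (F i) k.
Proof. exact: (big_morph (fun f : laurent => val f k)). Qed.
Lemma laurent_val_prod (I : Type) (r : seq I) (P : pred I) (F : I -> laurent) :
  val (\prod_(i <- r | P i) F i) = \big[qmul/qone]_(i <- r | P i) val (F i).
Proof. exact: (big_morph val). Qed.

Lemma qlboundM a b (f g : laurent) : qlbound a (val f) -> qlbound b (val g) ->
  qlbound (a + b) (val (f * g)).
Proof. exact: qlbound_qmul. Qed.

Lemma qlboundB a (f g : laurent) : qlbound a (val f) -> qlbound a (val g) ->
  qlbound a (val (f - g)).
Proof. by move=> fa ga k ka; rewrite laurent_valD laurent_valN fa // ga. Qed.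

(** * Infinite sums of Laurent series *)

(** Convergence in the sense of [qsummable], for families indexed by the integers, with the finite
    exceptional sets enclosed in intervals. *)
Definition summable_int (F : int -> laurent) :=
  forall K : int, exists B : nat, forall n, (B < `|n|)%N -> qlbound K (val (F n)).

Definition sums_to (F : int -> laurent) (L : laurent) :=
  summable_int F /\ val L = qsum [set: int]%classic (fun n => val (F n)).

Lemma summable_qlbound F : summable_int F -> exists a, forall n, qlbound a (val (F n)).
Proof.
move=> /(_ 0)[B FB].
have [a aF] : exists a, forall n, (`|n| <= B)%N -> qlbound a (val (F n)).
  elim: B {FB} => [|B [a aF]].
    by have [a aF] := laurentP (F 0); exists a => n; rewrite leqn0 absz_eq0 => /eqP->.
  have [b [bF b'F]] := laurent2P (F B.+1%:Z) (F (- B.+1%:Z)).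
  exists (Num.min a b) => n; rewrite leq_eqVlt ltnS => /orP[/eqP nB|/aF]; last first.
    by apply: qlboundW; rewrite ge_min lexx.
  have [->|->] : n = B.+1%:Z \/ n = - B.+1%:Z by lia.
    by apply: qlboundW bF; rewrite ge_min lexx orbT.
  by apply: qlboundW b'F; rewrite ge_min lexx orbT.
exists (Num.min a 0) => n; have [/aF|/FB] := leqP `|n| B; apply: qlboundW;
  by rewrite ge_min lexx ?orbT.
Qed.

Lemma summable_ex F : summable_int F -> exists L, sums_to F L.
Proof.
move=> sF; have [a aF] := summable_qlbound sF.
suff La : qlbound a (qsum [set: int]%classic (fun n => val (F n))).
  by exists (mk_laurent La).
by move=> k ka; apply: fsbig1 => n _; apply: aF.
Qed.

Lemma sums_uniq F L M : sums_to F L -> sums_to F M -> L = M.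
Proof. by move=> [_ LF] [_ MF]; apply: laurent_inj; rewrite LF MF. Qed.

Lemma eq_sums F G L : F =1 G -> sums_to F L -> sums_to G L.
Proof. by move=> /funext->. Qed.

Lemma sumsM (g : laurent) F L : sums_to F L -> sums_to (fun n => g * F n) (g * L).
Proof.
move=> [sF LF]; have [a aF] := summable_qlbound sF; have [b gb] := laurentP g.
split=> [K|].
  have [B FB] := sF (K - b); exists B => n /FB FnK.
  by rewrite (_ : K = b + (K - b)); [exact: qlboundM | lia].
rewrite laurent_valM; apply/funext => K; rewrite /qsum LF /qmul /qsum.
(* Terms [F n] of order above [K - b] do not contribute to the coefficient [K] of [g * F n];
   [qlbound] is strict, whence the [+ 1]. *)
have [B FB] := sF (K - b + 1).
under eq_fsbigr do rewrite mulr_fsumr.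
apply: (@exchange_fsbig_box _ (B + `|a| + `|b| + `|K|)) => i n nz.
have [ib|bi] := ltP i b; first by move: nz; rewrite gb ?mul0r.
have [Ki|Ki] := ltP (K - i) a; first by move: nz; rewrite aF ?mulr0.
have [nB|nB] := ltnP B `|n|%N; first by move: nz; rewrite (FB n) ?mulr0 //; lia.
by lia.
Qed.

Lemma sumsB F G L M : sums_to F L -> sums_to G M ->
  sums_to (fun n => F n - G n) (L - M).
Proof.
move=> [sF LF] [sG MG]; split=> [K|].
  have [B FB] := sF K; have [C GC] := sG K; exists (B + C)%N => n nBC.
  by apply: qlboundB; [apply: FB | apply: GC]; lia.
apply/funext => K; rewrite laurent_valD laurent_valN LF MG /qsum.
have [B FB] := sF (K + 1); have [C GC] := sG (K + 1).
rewrite !(@fsbig_int_range _ (- (B + C)%:Z) (2 * (B + C)).+1) => [|n nn|n nn|n nn].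
- by rewrite -sumrB; apply: eq_bigr => i _; rewrite laurent_valD laurent_valN.
- by rewrite laurent_valD laurent_valN (FB n) ?(GC n) //; lia.
- by rewrite (GC n) //; lia.
- by rewrite (FB n) //; lia.
Qed.

Lemma sums_shift (s : int) F L : sums_to F L -> sums_to (fun n => F (n + s)) L.
Proof.
move=> [sF LF]; split=> [K|].
  by have [B FB] := sF K; exists (B + `|s|)%N => n nB; apply: FB; lia.
apply/funext => K; rewrite LF /qsum (reindex_fsbigT (fun n : int => n + s)) //.
by exists (fun n => n - s) => n; lia.
Qed.

Lemma sums_range (a : int) (N : nat) F :
  (forall n : int, n < a \/ a + N%:Z <= n -> F n = 0) ->
  sums_to F (\sum_(i < N) F (a + i%:Z)).
Proof.
move=> F0; split=> [K|].
  by exists (`|a| + N)%N => n nN; rewrite F0 //; lia.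
apply/funext => K; rewrite laurent_val_sum /qsum.
by rewrite (@fsbig_int_range _ a N) // => n /F0->.
Qed.

(** The order of [G n m] tends to infinity in both indices jointly, so a given coefficient involves
    a finite box only. *)
Lemma sums_exchange (G : int -> int -> laurent) F H L :
  (forall K : int, exists B : nat, forall n m,
     (B < `|n|)%N || (B < `|m|)%N -> qlbound K (val (G n m))) ->
  (forall n, sums_to (G n) (F n)) -> (forall m, sums_to (G^~ m) (H m)) ->
  sums_to F L -> sums_to H L.
Proof.
move=> GB GF GH [_ LF]; split=> [K|].
  have [B BG] := GB K; exists B => m mB k kK.
  have [_ ->] := GH m; apply: fsbig1 => n _.
  by apply: (BG n m) => //; rewrite mB orbT.
apply/funext => K; rewrite LF /qsum.
have [B BG] := GB (K + 1).
under eq_fsbigr => n _ do rewrite (GF n).2.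
under [RHS]eq_fsbigr => n _ do rewrite (GH n).2.
apply: (@exchange_fsbig_box _ B) => n m.
by apply: contraNT; rewrite negb_and -!ltnNge => /BG->//; lia.
Qed.

Lemma square_growth (al be K : int) :
  exists B : nat, forall n : int, (B < `|n|)%N -> K <= n * n + al * n + be.
Proof.
exists (`|al| + `|be| + `|K|)%N => n nB.
have n0 : 0 <= `|n| by [].
have n1 : `|n| * (1 + `|be| + `|K|) <= `|n| * (`|n| - `|al|) by apply: ler_wpM2l => //; lia.
have n2 : 1 * (1 + `|be| + `|K|) <= `|n| * (1 + `|be| + `|K|) by apply: ler_wpM2r; lia.
have n3 : `|n| * `|n| = n * n by rewrite -normrM ger0_norm // -expr2 sqr_ge0.
have n4 : - (`|n| * `|al|) <= al * n by rewrite -normrM lerNl mulrC -normrN ler_norm.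
lia.
Qed.

Lemma square_lower (al be : int) (n : int) : be - al * al <= n * n + al * n + be.
Proof. by nia. Qed.

(** * q-Pochhammer symbols *)

(** The exponent counts half powers: q^j is [mon 1 (2 * j)]. *)
Definition mon (c k : int) : laurent := mk_laurent (@qlbound_qmon c k).

Lemma mon_mulE c k (f : laurent) n : val (mon c k * f) n = c * val f (n - k).
Proof. exact: qmul_mon. Qed.

Lemma monM c d k l : mon c k * mon d l = mon (c * d) (k + l).
Proof.
apply/laurent_inj/funext => n; rewrite mon_mulE /= /qmon.
have -> : (n - k == l) = (n == k + l) by lia.
by case: ifP; rewrite ?mulr0.
Qed.

(* Stated for [apply], because [congr] tries to convert Laurent series. *)
Lemma eq_mul (f f' g g' : laurent) : f = f' -> g = g' -> f * g = f' * g'.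
Proof. by move=> -> ->. Qed.

Lemma eq_mon c c' k k' : c = c' -> k = k' -> mon c k = mon c' k'.
Proof. by move=> -> ->. Qed.

Lemma mon1 : mon 1 0 = 1. Proof. by apply: laurent_inj. Qed.

Lemma monN c k : mon (- c) k = - mon c k.
Proof.
by apply/laurent_inj/funext => n; rewrite laurent_valN /= /qmon; case: ifP; rewrite ?oppr0.
Qed.

Lemma signD (m n : int) : (-1) ^ (m + n) = (-1) ^ m * (-1) ^ n :> int.
Proof. by rewrite exprzDr // unitrN1. Qed.

Lemma qlbound_monM c k (f : laurent) : qlbound 0 (val f) -> qlbound k (val (mon c k * f)).
Proof.
by move=> f0; have := @qlboundM k 0 (mon c k) f (@qlbound_qmon c k) f0; rewrite addr0.
Qed.

Lemma qlbound_qgeom j : qlbound 0 (qgeom j).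
Proof. by move=> k k0; rewrite /qgeom leNgt k0. Qed.
Definition geom (j : nat) : laurent := mk_laurent (@qlbound_qgeom j).

Lemma geomK j : (0 < j)%N -> geom j * (1 - mon 1 (2 * j%:Z)) = 1.
Proof.
move=> j0; rewrite mulrBr mulr1 mulrC; apply/laurent_inj/funext => n.
rewrite laurent_valD laurent_valN mon_mulE mul1r /= /qgeom /qone /qmon.
have -> : (2 * j%:Z %| n - 2 * j%:Z)%Z = (2 * j%:Z %| n)%Z.
  by rewrite rpredBr // dvdzz.
have [->|n0] := eqVneq n 0; first by rewrite dvdz0 lexx /= ifF ?subr0 //; lia.
case dn: (2 * j%:Z %| n)%Z; last by rewrite !andbF subrr.
rewrite !andbT; have [z nz] := dvdzP dn.
have [nn|nn] := ltP n 0; first by rewrite ifF ?subr0 //; lia.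
move/eqP in n0; have z1 : 1 <= z by nia.
by rewrite ifT ?subrr //; nia.
Qed.

Definition pinv (n : int) : laurent :=
  if n is Posz m then \prod_(1 <= j < m.+1) geom j else 0.

Lemma val_pinv n : val (pinv n) = qpoch_inv n.
Proof. by case: n => n //=; rewrite laurent_val_prod. Qed.

Lemma pinv_lt0 n : n < 0 -> pinv n = 0.
Proof. by case: n. Qed.

Lemma pinv0 : pinv 0 = 1.
Proof. by rewrite /= big_geq. Qed.

(** The recurrence holds at every integer: at [n = 0] the factor 1 - q^0 vanishes, in agreement with
    1/(q)_n = 0 for n < 0. Identities derived from it hold for negative indices as well. *)
Lemma pinvP n : pinv (n - 1) = (1 - mon 1 (2 * n)) * pinv n.
Proof.
have [n0|n0] := ltP n 0; first by rewrite !pinv_lt0 ?mulr0 //; lia.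
case: n n0 => // -[|n] _; first by rewrite mulr0 mon1 subrr mul0r pinv_lt0.
have -> : n.+1%:Z - 1 = n%:Z by lia.
rewrite [pinv n.+1]/= big_nat_recr //= mulrCA (mulrC (1 - _)) geomK ?mulr1 //.
Qed.

Lemma qlbound_prod (I : Type) (r : seq I) (P : pred I) (F : I -> laurent) :
  (forall i, P i -> qlbound 0 (val (F i))) -> qlbound 0 (val (\prod_(i <- r | P i) F i)).
Proof.
move=> F0; elim/big_rec: _ => [|i f Pi f0]; first exact: qlbound_qmon.
by apply: (@qlboundM 0 0) => //; apply: F0.
Qed.

Lemma qlbound_pinv n : qlbound 0 (val (pinv n)).
Proof. by case: n => // n; apply: qlbound_prod => j _; apply: qlbound_qgeom. Qed.

Lemma qlboundM0 (f g : laurent) : qlbound 0 (val f) -> qlbound 0 (val g) ->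
  qlbound 0 (val (f * g)).
Proof. exact: (@qlboundM 0 0). Qed.

Definition poch (m : nat) : laurent := \prod_(1 <= j < m.+1) (1 - mon 1 (2 * j%:Z)).

Lemma val_poch m : val (poch m) = qpoch m.
Proof. by rewrite laurent_val_prod. Qed.

Lemma poch_pinv m : poch m * pinv m = 1.
Proof.
rewrite /poch /= -big_split big_nat big1 //= => j /andP[j0 _].
by rewrite mulrC geomK.
Qed.

Lemma qlbound_poch m : qlbound 0 (val (poch m)).
Proof.
apply: qlbound_prod => j _; apply: qlboundB; first exact: qlbound_qmon.
by apply: qlboundW (@qlbound_qmon _ _).
Qed.

Lemma qlbound_poch_inf : qlbound 0 qpoch_inf.
Proof. by move=> k k0; rewrite /qpoch_inf -val_poch qlbound_poch. Qed.
Definition poch_inf : laurent := mk_laurent qlbound_poch_inf.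

(** * Euler's identity for (q)_oo / (q)_m *)

(** The terms of Euler's expansion of (x; q)_oo at x = q^(m+1), with exponents doubled. *)
Definition euler_term (m k : int) : laurent :=
  mon ((-1) ^ k) (k * (k + 1) + 2 * k * m) * pinv k.

Lemma summable_mon (c e : int -> int) (f : int -> laurent) :
  (forall K : int, exists B : nat, forall n : int, (B < `|n|)%N -> K <= e n) ->
  (forall n, qlbound 0 (val (f n))) ->
  summable_int (fun n => mon (c n) (e n) * f n).
Proof.
move=> eK f0 K; have [B eB] := eK K; exists B => n /eB Ke.
exact/(qlboundW Ke)/qlbound_monM.
Qed.

Lemma summable_euler m : summable_int (euler_term m).
Proof.
apply: summable_mon => [K|n]; last exact: qlbound_pinv.
have [B KB] := square_growth (1 + 2 * m) 0 K; exists B => n /KB; lia.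
Qed.

Lemma euler_term0 m : euler_term m 0 = 1.
Proof. by rewrite /euler_term pinv0 mulr1 expr0z mul0r mulr0 mul0r addr0 mon1. Qed.

(** The sums [E k] satisfy E (k - 1) = (1 - q^k) E k and tend to 1, so that E 0 = (q)_k E k tends to
    (q)_oo; the recurrence then gives every [E m]. *)
Lemma euler_identity m : sums_to (euler_term m) (poch_inf * pinv m).
Proof.
have [E sE] := choice (fun k => summable_ex (@summable_euler k)).
have EP k : E (k - 1) = (1 - mon 1 (2 * k)) * E k.
  suff -> : E (k - 1) = E k - mon 1 (2 * k) * E k by rewrite mulrBl mul1r.
  suff -> : mon 1 (2 * k) * E k = E k - E (k - 1) by rewrite subKr.
  apply: (sums_uniq (F := fun n => mon 1 (2 * k) * euler_term k (n + (- 1)))).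
    by apply: sumsM; apply: (@sums_shift (- 1) (euler_term k)).
  apply: eq_sums (sumsB (sE k) (sE (k - 1))) => n.
  rewrite /euler_term pinvP mulrA monM mul1r.
  have -> : n * (n + 1) + 2 * n * (k - 1) = n * (n + 1) + 2 * n * k - 2 * n by lia.
  rewrite mulrA mulrBr mulr1 monM mulr1.
  have -> : 2 * k + ((n - 1) * (n - 1 + 1) + 2 * (n - 1) * k)
    = n * (n + 1) + 2 * n * k - 2 * n by lia.
  have -> : (-1) ^ (n - 1) = - (-1) ^ n :> int by rewrite signD mulrN1.
  rewrite !monN -mulrBl.
  have -> : n * (n + 1) + 2 * n * k - 2 * n + 2 * n = n * (n + 1) + 2 * n * k by lia.
  by apply: eq_mul; first ring.
have E0 (k : nat) : E 0 = poch k * E k%:Z.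
  elim: k => [|k ->]; first by rewrite /poch big_geq ?mul1r.
  rewrite /poch (big_nat_recr k.+1) //= -mulrA; apply: eq_mul => //.
  by rewrite -EP; congr E; lia.
(* The term [n = 0] is 1, and for n >= 1 the exponent n (n + 1) + 2 n k is at least 2 (k + 1). *)
have E1 (k : nat) : qlbound (2 * k.+1%:Z) (val (E k%:Z - 1)).
  have [_ Ek] := sE k%:Z.
  move=> i ik; rewrite laurent_valD laurent_valN Ek /qsum.
  rewrite (@fsbig_int_range _ 0 1) => [|n n0].
    by rewrite big_ord_recl big_ord0 !addr0 euler_term0 subrr.
  case: n0 => n0; first by rewrite /euler_term pinv_lt0 ?mulr0.
  have : qlbound (2 * k.+1%:Z) (val (euler_term k%:Z n)).
      rewrite /euler_term; apply: qlboundW; last exact/qlbound_monM/qlbound_pinv.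
      have n1 : 1 <= n by lia.
      have h1 : 0 <= (n - 1) * k%:Z by rewrite mulr_ge0 //; lia.
      have h2 : 0 <= (n - 1) * n by rewrite mulr_ge0 //; lia.
      by lia.
  by apply.
(* The coefficient [K] is compared in E 0 = (q)_k E k with k = |K|, where E k - 1 has order above
   [K]. *)
have Einf : E 0 = poch_inf.
  apply/laurent_inj/funext => K /=; rewrite /qpoch_inf -val_poch.
  have : qlbound (0 + 2 * `|K|%N.+1%:Z) (val (poch `|K|%N * (E `|K|%N%:Z - 1))).
    by apply: qlboundM; [exact: qlbound_poch | exact: E1].
  move=> /(_ K); rewrite mulrBr -E0 mulr1 laurent_valD laurent_valN => EK.
  by apply/eqP; rewrite -subr_eq0; apply/eqP/EK; lia.
suff -> : poch_inf * pinv m = E m by [].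
(* For negative [m], the recurrence at 0 gives E (-1) = (1 - q^0) E 0 = 0, and the value stays 0
   below. *)
case: m => m; first by rewrite -Einf (E0 m) mulrAC poch_pinv mul1r.
rewrite pinv_lt0 // mulr0; elim: m => [|m IH].
  by rewrite (_ : Negz 0 = 0 - 1) // EP mulr0 mon1 subrr mul0r.
by rewrite (_ : Negz m.+1 = Negz m - 1) ?EP -?IH ?mulr0 //; lia.
Qed.

(** * The q-Vandermonde identity *)

Definition vandermonde_term (P : nat) (R : int) (i : nat) : laurent :=
  mon 1 (2 * i%:Z * (i%:Z + R - P%:Z))
  * (pinv i * pinv (i%:Z + R - P%:Z) * pinv (P%:Z - i%:Z)).

(** Multiplied by (q)_P, this is the limit for m -> oo of the q-Vandermonde expansion of the
    Gaussian binomial coefficient of m + P over R. The induction on [P] uses R - 1, hence the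
    statement for all integers [R]. *)
Lemma vandermonde (P : nat) (R : int) :
  \sum_(i < P.+1) vandermonde_term P R i = pinv P * pinv R.
Proof.
elim: P R => [|P IH] R.
  rewrite big_ord_recl big_ord0 addr0 /vandermonde_term /= !mulr0 mul0r mon1.
  by rewrite subr0 add0r big_geq // mul1r mulr1.
(* The splitting is 1 - q^(P+1) = (1 - q^(P+1-i)) + q^(P+1-i) (1 - q^i); each part lowers one of the
   indices in the denominator and gives a sum for [P]. *)
have rec : (1 - mon 1 (2 * P.+1%:Z)) * (\sum_(i < P.+2) vandermonde_term P.+1 R i) =
    pinv P * pinv (R - 1) + mon 1 (2 * R) * (pinv P * pinv R).
  rewrite -!IH !mulr_sumr.
  pose u (i : nat) : laurent := mon 1 (2 * i%:Z * (i%:Z + R - P.+1%:Z))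
    * (pinv i * pinv (i%:Z + R - P.+1%:Z) * pinv (P%:Z - i%:Z)).
  pose v (i : nat) : laurent := mon 1 (2 * i%:Z * (i%:Z + R - P.+1%:Z)
    + 2 * (P.+1%:Z - i%:Z))
    * (pinv (i%:Z - 1) * pinv (i%:Z + R - P.+1%:Z) * pinv (P.+1%:Z - i%:Z)).
  rewrite (eq_bigr (fun i : 'I_P.+2 => u i + v i)); last first.
    move=> i _; rewrite /u /v /vandermonde_term pinvP.
    have -> : P%:Z - i%:Z = P.+1%:Z - i%:Z - 1 by lia.
    rewrite pinvP.
    have -> : mon 1 (2 * P.+1%:Z) = mon 1 (2 * (P.+1%:Z - i%:Z)) * mon 1 (2 * i%:Z).
      by rewrite monM mulr1; congr mon; lia.
    rewrite -[mon 1 (_ + 2 * (P.+1%:Z - i%:Z))]/(mon (1 * 1) _) -monM.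
    by ring.
  rewrite big_split /=; congr (_ + _).
    rewrite big_ord_recr /= {2}/u (@pinv_lt0 (P%:Z - P.+1%:Z)); last by lia.
    rewrite !mulr0 addr0; apply: eq_bigr => i _; rewrite /u /vandermonde_term.
    by have -> : i%:Z + (R - 1) - P%:Z = i%:Z + R - P.+1%:Z by lia.
  rewrite big_ord_recl /= {1}/v (@pinv_lt0 (0%:Z - 1)) // !mul0r mulr0 add0r.
  apply: eq_bigr => i _; rewrite /v /vandermonde_term [RHS]mulrA monM mulr1.
  have -> : (bump 0 i)%:Z = i%:Z + 1 by rewrite /bump; lia.
  have -> : i%:Z + 1 - 1 = i%:Z by lia.
  have -> : i%:Z + 1 + R - P.+1%:Z = i%:Z + R - P%:Z by lia.
  have -> : P.+1%:Z - (i%:Z + 1) = P%:Z - i%:Z by lia.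
  by apply: eq_mul => //; apply: eq_mon => //; lia.
have PP : P.+1%:Z - 1 = P%:Z by lia.
have geomE : geom P.+1 * (1 - mon 1 (2 * P.+1%:Z)) = 1 by apply: geomK.
rewrite -[LHS]mul1r -geomE -mulrA rec.
have -> : pinv P = (1 - mon 1 (2 * P.+1%:Z)) * pinv P.+1 by rewrite -pinvP PP.
rewrite pinvP; transitivity (geom P.+1 * (1 - mon 1 (2 * P.+1%:Z)) * (pinv P.+1 * pinv R)).
  by ring.
by rewrite geomE mul1r.
Qed.

(** * The two expressions for the tetrahedron index *)

(** The terms of [J_Delta] after the substitution n -> n + b in its summation index, which makes the
    roles of [a] and [b] symmetric. *)
Definition J_term (a b c n : int) : laurent :=
  mon ((-1) ^ n) (n * (n + 1) + 2 * n * c + (a * c + b * c - a * b))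
  * (pinv (n + a) * pinv (n + b)).

Lemma summable_J_term a b c : summable_int (J_term a b c).
Proof.
apply: summable_mon => [K|n]; last by apply: qlboundM0; apply: qlbound_pinv.
have [B KB] := square_growth (1 + 2 * c) (a * c + b * c - a * b) K.
by exists B => n /KB; lia.
Qed.

Lemma J_DeltaE a b c (L : laurent) : sums_to (J_term a b c) L -> J_Delta a b c = val L.
Proof.
move=> JL.
pose F (n : int) : laurent :=
  mon ((-1) ^ n) (n * (n + 1) - (2 * n + (a - b)) * (b - c)) * (pinv n * pinv (n + (a - b))).
have sF : summable_int F.
  apply: summable_mon => [K|n]; last by apply: qlboundM0; apply: qlbound_pinv.
  have [B KB] := square_growth (1 - 2 * (b - c)) (- (a - b) * (b - c)) K.
  by exists B => n /KB; lia.
have [M FM] := summable_ex sF.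
have -> : J_Delta a b c = val (mon ((-1) ^ (- b)) (- b) * M).
  rewrite laurent_valM /J_Delta; congr qmul; rewrite FM.2 /I_Delta; apply/funext => k.
  rewrite /qsum [RHS](_ : _ = \sum_(n \in [set n : int | 0 <= n /\ - (a - b) <= n]%classic)
    val (F n) k); last first.
    apply/esym/fsbig_widen => // n [_ nn]; suff Fn0 : F n = 0 by rewrite /preimage /mkset Fn0.
    rewrite /F; have [n0|n0] := ltP n 0; first by rewrite (@pinv_lt0 n) // mul0r mulr0.
    have [n1|n1] := ltP (n + (a - b)) 0; first by rewrite (@pinv_lt0 (n + _)) // !mulr0.
    by exfalso; apply: nn; split=> //; lia.
  by apply: eq_fsbigr => n _; rewrite /F !laurent_valM !val_pinv.
congr val; apply: sums_uniq JL.
apply: eq_sums (sumsM (mon ((-1) ^ (- b)) (- b)) (sums_shift b FM)) => n.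
rewrite /F /J_term mulrA monM -signD (mulrC (pinv (n + a))).
apply: eq_mul; first by apply: eq_mon; [congr (_ ^ _) |]; lia.
by apply: eq_mul => //; congr pinv; lia.
Qed.

Definition FKB_term (a b c n : int) : laurent :=
  mon ((-1) ^ n)
    (n * (3 * n + 1) + 2 * n * (a + b + c) + (a * b + b * c + c * a))
  * (pinv (n + a) * (pinv (n + b) * pinv (n + c))).

Lemma summable_FKB_term a b c : summable_int (FKB_term a b c).
Proof.
apply: summable_mon => [K|n].
  have [B KB] := square_growth (1 + 2 * (a + b + c)) (a * b + b * c + c * a) K.
  by exists B => n /KB; nia.
by do !apply: qlboundM0; apply: qlbound_pinv.
Qed.

Lemma J_FKBE a b c L : sums_to (FKB_term a b c) L -> J_FKB a b c = val (poch_inf * L).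
Proof.
move=> [_ FL]; rewrite laurent_valM FL /J_FKB; congr qmul; apply/funext => k.
by apply: eq_fsbigr => n _; rewrite !laurent_valM !val_pinv.
Qed.

(** [vandermonde] with i = n + a, P = N + a and R = N + b; all other terms vanish, and so does
    everything when N + a < 0. *)
Lemma vandermonde_sums (N a b : int) :
  sums_to (fun n => mon 1 (2 * (n + a) * (n + b)) *
     (pinv (n + a) * pinv (n + b) * pinv (N - n))) (pinv (N + a) * pinv (N + b)).
Proof.
have [Na|Na] := ltP (N + a) 0.
  rewrite (@pinv_lt0 (N + a)) // mul0r.
  have := @sums_range 0 0 (fun=> 0) (fun _ _ => erefl); rewrite big_ord0.
  apply: eq_sums => n; have [n0|n0] := ltP (n + a) 0.
    by rewrite pinv_lt0 // !mul0r mulr0.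
  by rewrite (@pinv_lt0 (N - n)) ?mulr0 //; lia.
have NP : N + a = `|(N + a)%R|%N by lia.
have := @sums_range (- a) `|(N + a)%R|%N.+1 (fun n => mon 1 (2 * (n + a) * (n + b)) *
     (pinv (n + a) * pinv (n + b) * pinv (N - n))).
rewrite (eq_bigr (fun i : 'I__ => vandermonde_term `|(N + a)%R|%N (N + b) i)).
  rewrite vandermonde -NP; apply => n [n0|n1].
    by rewrite (@pinv_lt0 (n + a)) ?mul0r ?mulr0 //; lia.
  by rewrite (@pinv_lt0 (N - n)) ?mulr0 //; lia.
move=> i _; rewrite /vandermonde_term -NP.
apply: eq_mul; first by apply: eq_mon => //; lia.
by apply: eq_mul; [apply: eq_mul|]; congr pinv; lia.
Qed.

(** Euler's identity expands (q)_oo / (q)_(n+c) with summation index N - n. The cross terms in n and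
    N then cancel in the exponent, which becomes a quadratic in N plus a quadratic in n; hence the
    double series converges. For fixed N the sum over n is a q-Vandermonde sum and leaves
    [J_term a b c N]. *)
Lemma J_FKB_Delta a b c : J_FKB a b c = J_Delta a b c.
Proof.
have [L FL] := summable_ex (@summable_FKB_term a b c).
rewrite (J_FKBE FL); apply/esym/J_DeltaE.
pose t n := mon ((-1) ^ n) (n * (3 * n + 1) + 2 * n * (a + b + c)
  + (a * b + b * c + c * a)) * (pinv (n + a) * pinv (n + b)).
pose u (n N : int) := mon ((-1) ^ N) (N * (N + 1) + 2 * N * c
  + (a * c + b * c - a * b) + 2 * (n + a) * (n + b))
  * (pinv (n + a) * pinv (n + b) * pinv (N - n)).
apply: (@sums_exchange u _ _ _ _ _ _ (sumsM poch_inf FL)) => [K|n|N].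
- have [B1 KB1] := square_growth (1 + 2 * c) (a * c + b * c - a * b)
    (K - 2 * (a * b - (a + b) * (a + b))).
  have [B2 KB2] := square_growth (a + b) (a * b)
    (`|K| + `|a * c + b * c - a * b - (1 + 2 * c) * (1 + 2 * c)|).
  have low1 := square_lower (1 + 2 * c) (a * c + b * c - a * b).
  have low2 := square_lower (a + b) (a * b).
  exists (B1 + B2)%N => n m nm; rewrite /u; apply: qlboundW; last first.
    by apply: qlbound_monM; do !apply: qlboundM0; apply: qlbound_pinv.
  have := low1 m; have := low2 n.
  by case/orP: nm => [nB|mB]; [have := KB2 n | have := KB1 m]; lia.
- rewrite [X in sums_to _ X](_ : _ = t n * (poch_inf * pinv (n + c))); last first.
    by rewrite /FKB_term /t; ring.
  apply: eq_sums (sumsM (t n) (sums_shift (- n) (euler_identity (n + c)))) => N.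
  rewrite /t /u /euler_term mulrACA monM -signD.
  by apply: eq_mul => //; apply: eq_mon; [congr (_ ^ _) |]; lia.
- rewrite /J_term.
  apply: eq_sums (sumsM _ (vandermonde_sums N a b)) => n.
  by rewrite /u mulrA monM mulr1.
Qed.

Lemma J_FKB_ex a b c : exists L : laurent, val L = J_FKB a b c.
Proof.
by have [L FL] := summable_ex (@summable_FKB_term a b c); exists (poch_inf * L);
  rewrite (J_FKBE FL).
Qed.

Definition J_laurent a b c : laurent := sval (cid (J_FKB_ex a b c)).

Lemma val_J_laurent a b c : val (J_laurent a b c) = J_FKB a b c.
Proof. exact: (svalP (cid (J_FKB_ex a b c))). Qed.

Lemma J_laurent_shift a b c s :
  J_laurent (a + s) (b + s) (c + s) = mon ((-1) ^ (- s)) (- s) * J_laurent a b c.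
Proof.
apply: laurent_inj; rewrite val_J_laurent laurent_valM val_J_laurent !J_FKB_Delta.
have [L JL] := summable_ex (@summable_J_term a b c).
rewrite (J_DeltaE JL) -laurent_valM; apply: J_DeltaE.
apply: eq_sums (sumsM (mon ((-1) ^ (- s)) (- s)) (sums_shift s JL)) => n.
rewrite /J_term mulrA monM -signD.
apply: eq_mul; first by apply: eq_mon; [congr (_ ^ _) |]; lia.
by apply: eq_mul; congr pinv; lia.
Qed.

(** Since one argument is 0, a factor 1/(q)_n kills the terms with n < 0; the term n = 0 starts at
    the given order and the later ones start no lower. *)
Lemma qlbound_J_laurent a b c : 0 <= a -> 0 <= b -> 0 <= c ->
  a = 0 \/ b = 0 \/ c = 0 -> qlbound (a * b + b * c + c * a) (val (J_laurent a b c)).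
Proof.
move=> a0 b0 c0 abc.
have [L FL] := summable_ex (@summable_FKB_term a b c).
rewrite val_J_laurent (J_FKBE FL) -(add0r (_ + c * a)).
apply: qlboundM; first exact: qlbound_poch_inf.
move=> k kabc; rewrite FL.2 /qsum; apply: fsbig1 => n _.
have [n0|n0] := ltP n 0.
  suff p0 : pinv (n + a) * (pinv (n + b) * pinv (n + c)) = 0 by rewrite /FKB_term p0 mulr0.
  case: abc => [->|[->|->]]; rewrite (@pinv_lt0 (n + 0)) ?addr0 //.
  - by rewrite mul0r.
  - by rewrite mul0r mulr0.
  - by rewrite !mulr0.
suff : qlbound (a * b + b * c + c * a) (val (FKB_term a b c n)) by move=> lb; apply: lb; exact: kabc.
apply: qlboundW; last by apply: qlbound_monM; do !apply: qlboundM0; apply: qlbound_pinv.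
have n1 : 0 <= n * (a + b + c) by rewrite mulr_ge0 // !addr_ge0.
have n2 : 0 <= n * (3 * n + 1) by rewrite mulr_ge0 //; lia.
by lia.
Qed.

(** * Orbit counts *)

Lemma card_imset_kernel (T U W : finType) (f : T -> U) (g : T -> W) (D : {set T}) :
  {in D &, forall x y, (f x == f y) = (g x == g y)} -> #|f @: D| = #|g @: D|.
Proof.
move=> fg; pose h (u : U) : {set T} := [set y in D | f y == u].
pose k (w : W) : {set T} := [set y in D | g y == w].
have fE : h @: (f @: D) = k @: (g @: D).
  rewrite -!imset_comp; apply: eq_in_imset => x xD; apply/setP => y; rewrite !inE /=.
  by case yD: (y \in D) => //=; apply: fg.
rewrite -(card_in_imset (f := h) (D := f @: D)); last first.
  move=> _ _ /imsetP[x xD ->] /imsetP[y yD ->] /setP/(_ x).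
  by rewrite !inE xD eqxx /= => /esym/eqP.
rewrite fE card_in_imset // => _ _ /imsetP[x xD ->] /imsetP[y yD ->] /setP/(_ x).
by rewrite !inE xD eqxx /= => /esym/eqP.
Qed.

Lemma card_equivalence_partition (T U : finType) (R : rel T) (D : {set T}) (f : T -> U) :
  {in D &, forall x y, R x y = (f x == f y)} ->
  #|equivalence_partition R D| = #|f @: D|.
Proof.
move=> Rf; apply: (card_imset_kernel (f := fun x => [set y in D | R x y])) => x y xD yD.
apply/eqP/eqP => [/setP/(_ y)|fxy].
  by rewrite !inE yD /= !Rf // eqxx => /eqP.
by apply/setP => z; rewrite !inE; case zD: (z \in D) => //=; rewrite !Rf // fxy.
Qed.

Section Orbits.
Variable X : finType.

Definition gen2 (a b : X -> X) : rel X := relU (frel a) (frel b).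

Lemma gen2_sym a b : involutive a -> involutive b -> connect_sym (gen2 a b).
Proof.
move=> aK bK; apply: sym_connect_sym => x y.
have fs c : involutive c -> (c x == y) = (c y == x).
  by move=> cK; rewrite (can2_eq cK cK) eq_sym.
by congr (_ || _); apply: fs.
Qed.

Definition norbits (a b : X -> X) : nat := #|[set fingraph.root (gen2 a b) x | x : X]|.

Lemma root_gen2 a b x : involutive a -> involutive b ->
  fingraph.root (gen2 a b) (a x) = fingraph.root (gen2 a b) x /\ fingraph.root (gen2 a b) (b x) = fingraph.root (gen2 a b) x.
Proof.
move=> aK bK; have sym := gen2_sym aK bK.
by split; apply/eqP; rewrite eq_sym root_connect //; apply/connect1/orP;
  [left | right]; apply: eqxx.
Qed.

(** Numbering the orbits lets them index the rows and columns of incidence matrices. *)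
Lemma orbit_index a b : involutive a -> involutive b ->
  exists c : X -> 'I_(norbits a b),
    [/\ forall i, exists x, c x = i, forall x, c (a x) = c x, forall x, c (b x) = c x
      & forall x y, c x = c y -> fingraph.root (gen2 a b) x = fingraph.root (gen2 a b) y].
Proof.
move=> aK bK; set r := fingraph.root (gen2 a b).
have rx x : r x \in [set r y | y : X] by apply: imset_f.
pose c x : 'I_(norbits a b) := enum_rank_in (rx x) (r x).
have cr x y : r x = r y -> c x = c y.
  move=> xy; apply: enum_val_inj; rewrite !enum_rankK_in ?rx //.
exists c; split=> [i|x|x|x y /(congr1 enum_val)].
- have /imsetP[x _ ix] := enum_valP i; exists x; apply: enum_val_inj.
  by rewrite enum_rankK_in ?rx.
- by apply: cr; have [] := root_gen2 x aK bK.
- by apply: cr; have [] := root_gen2 x aK bK.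
- by rewrite !enum_rankK_in ?rx.
Qed.

(* The words of odd length in two fixed point free involutions a and b are
   conjugate to a or b, hence have no fixed points. *)
Lemma alternating_sign (a b : X -> X) : involutive a -> involutive b ->
  (forall x, a x != x) -> (forall x, b x != x) ->
  exists th : X -> bool, (forall x, th (a x) = ~~ th x) /\ (forall x, th (b x) = ~~ th x).
Proof.
move=> aK bK ax bx; pose d := b \o a.
have d_inj : injective d by apply: inj_comp; apply: can_inj; [exact: bK | exact: aK].
have dsym := fconnect_sym d_inj.
have iter_neq k x : iter k d x != a x.
  have [n] := ubnP k; elim: n k x => // n IH [|[|k]] x kn; first by rewrite eq_sym.
    by rewrite /= bx.
  apply: contra_neq (IH k (d x) _) => [eq|]; last by lia.
  have dK z : a (b (d z)) = z by rewrite /d /= bK aK.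
  by rewrite -iterSr -[LHS]dK -iterS eq.
have rootN x : froot d x != froot d (a x).
  apply/negP; rewrite root_connect // => /iter_findex eq.
  by have := iter_neq (findex d x (a x)) x; rewrite eq eqxx.
have rootd x : froot d (d x) = froot d x.
  by apply/eqP; rewrite eq_sym root_connect //; apply: fconnect1.
have flip (y z : X) : y != z -> (enum_rank z < enum_rank y)%N = ~~ (enum_rank y < enum_rank z)%N.
  move=> yz; rewrite -leqNgt [RHS]leq_eqVlt (_ : (_ == _ :> nat) = false) //.
  by apply/negbTE; apply: contra_neq yz => /val_inj/enum_rank_inj.
(* [x] and [a x] lie in different cycles of [d], which both [a] and [b] exchange; the sign compares
   representatives of the two cycles. *)
exists (fun x => (enum_rank (froot d x) < enum_rank (froot d (a x)))%N); split=> x.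
  by rewrite aK flip.
have -> : froot d (b x) = froot d (a x) by rewrite -(rootd (a x)) /d /= aK.
have -> : froot d (a (b x)) = froot d x by rewrite -(rootd (a (b x))) /d /= aK bK.
by rewrite flip.
Qed.

End Orbits.

(** * Euler characteristics of maps on surfaces *)

Section EulerBound.
Variables (X : finType) (s0 s1 s2 : X -> X).
Hypotheses (s0K : involutive s0) (s1K : involutive s1) (s2K : involutive s2).
Hypotheses (s0x : forall x, s0 x != x) (s1x : forall x, s1 x != x) (s2x : forall x, s2 x != x).
Hypotheses (s02 : forall x, s0 (s2 x) = s2 (s0 x)) (s02x : forall x, s0 x != s2 x).
(** Connectedness is stated through invariant functions, the form in which it is applied to cochains
    and to absolute values of cycles. *)
Hypothesis conn : forall (Y : eqType) (f : X -> Y), (forall x, f (s0 x) = f x) ->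
  (forall x, f (s1 x) = f x) -> (forall x, f (s2 x) = f x) -> forall x y, f x = f y.

(** As [s0] and [s2] commute, an edge has at most four flags; [edge_uniq] shows that these are
    distinct. *)
Lemma edge_orbit x y : fingraph.root (gen2 s0 s2) x = fingraph.root (gen2 s0 s2) y ->
  y \in [:: x; s0 x; s2 x; s0 (s2 x)].
Proof.
move=> /eqP; rewrite root_connect; last exact: gen2_sym.
move=> /connectP[p pP ->]; elim: p {y} x pP => [|z p IH] x /=; first by rewrite inE eqxx.
move=> /andP[/orP[] /eqP <- /IH]; rewrite !inE ?s02 ?s0K ?s2K ?s02.
  by rewrite ?s0K; case/or4P => /eqP->; rewrite eqxx ?orbT.
by case/or4P => /eqP->; rewrite eqxx ?orbT.
Qed.

Let nV := norbits s1 s2.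
Let nE := norbits s0 s2.
Let nF := norbits s0 s1.

Lemma edge_uniq x : uniq [:: x; s0 x; s2 x; s0 (s2 x)].
Proof.
have nx : x != s0 (s2 x) by apply: contraNneq (s02x (s2 x)) => <-; rewrite s2K.
have n0 : s0 x != s0 (s2 x) by rewrite (can_eq s0K) eq_sym.
rewrite /= !inE !negb_or nx n0 s02x !(eq_sym x) s0x s2x /= andbT.
by rewrite (eq_sym (s2 x)) s0x.
Qed.

Lemma edge_sum (R : zmodType) (h : X -> R) (ed : X -> 'I_nE) (r : 'I_nE -> X) :
  (forall x, ed (s0 x) = ed x) -> (forall x, ed (s2 x) = ed x) ->
  (forall x y, ed x = ed y -> fingraph.root (gen2 s0 s2) x = fingraph.root (gen2 s0 s2) y) ->
  (forall e, ed (r e) = e) ->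
  \sum_x h x = \sum_e (h (r e) + h (s0 (r e)) + h (s2 (r e)) + h (s0 (s2 (r e)))).
Proof.
move=> e0 e2 eP rK; rewrite (partition_big ed xpredT) //=; apply: eq_bigr => e _.
transitivity (\sum_(x <- [:: r e; s0 (r e); s2 (r e); s0 (s2 (r e))]) h x); last first.
  by rewrite !big_cons big_nil addr0 !addrA.
rewrite big_uniq ?edge_uniq //=; apply: eq_bigl => x.
apply/eqP/idP => [xe|]; first by apply/edge_orbit/eP; rewrite rK.
by rewrite !inE => /or4P[] /eqP->; rewrite ?e0 ?e2 ?rK ?e0 ?e2 ?rK.
Qed.

Lemma card_edges : #|X| = (4 * nE)%N.
Proof.
have [ed [edS e0 e2 eP]] := orbit_index s0K s2K.
have [r rK] := fin_all_exists edS.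
have := edge_sum (fun=> 1%:Z) e0 e2 eP rK.
have -> : \sum_(e < nE) ((1 : int) + 1 + 1 + 1) = (4 * nE)%:R.
  by rewrite sumr_const card_ord (_ : (1 : int) + 1 + 1 + 1 = 4%:R) // -mulrnA.
by rewrite sumr_const => /eqP; rewrite eqr_nat => /eqP.
Qed.

(** [A] and [B] are the boundary matrices of the cellular chain complex over the rationals, with
    faces oriented one by one by [th]. From A B = 0, the ranks add up to at most nE. Connectedness
    gives rank A >= nV - 1, and the last hypothesis bounds by [k] the dimension of the 2-cycles, so
    that rank B >= nF - k. *)
Lemma euler_rank (k : nat) (th : X -> bool) (fc : X -> 'I_nF) :
  (forall i, exists x, fc x = i) -> (forall x, fc (s0 x) = fc x) ->
  (forall x, fc (s1 x) = fc x) ->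
  (forall x, th (s0 x) = ~~ th x) -> (forall x, th (s1 x) = ~~ th x) ->
  (forall m (W : 'M[rat]_(m, nF)), row_free W ->
     (forall i x, (-1) ^+ th (s2 x) * W i (fc (s2 x)) = - ((-1) ^+ th x * W i (fc x))) ->
     (m <= k)%N) ->
  (nV + nF <= nE + 1 + k)%N.
Proof.
move=> fcS fc0 fc1 th0 th1 kerk.
have [vx [vxS v1 v2 vP]] := orbit_index s1K s2K.
have [ed [edS e0 e2 eP]] := orbit_index s0K s2K.
have [r rK] := fin_all_exists edS.
pose sg x : rat := (-1) ^+ th x.
have sg0 x : sg (s0 x) = - sg x by rewrite /sg th0; case: (th x); rewrite ?opprK.
have sg1 x : sg (s1 x) = - sg x by rewrite /sg th1; case: (th x); rewrite ?opprK.
pose A : 'M[rat]_(nV, nE) :=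
  \matrix_(v, e) ((vx (r e) == v)%:R - (vx (s0 (r e)) == v)%:R).
pose B : 'M[rat]_(nE, nF) :=
  \matrix_(e, f) (sg (r e) * (fc (r e) == f)%:R + sg (s2 (r e)) * (fc (s2 (r e)) == f)%:R).
have AB : A *m B = 0.
  apply/matrixP => v f; rewrite !mxE.
  (* The entry of A B is the sum of [h] over all flags, four per edge; [s1] changes the sign of [h],
     so the sum equals its opposite. *)
  pose h x : rat := (vx x == v)%:R * (sg x * (fc x == f)%:R).
  transitivity (\sum_x h x).
    rewrite (edge_sum h e0 e2 eP rK); apply: eq_bigr => e _.
    rewrite !mxE /h !fc0 !v2 !sg0 s02 !v2; ring.
  suff hh : \sum_x h x = - \sum_x h x by lra.
  rewrite [LHS](reindex_inj (can_inj s1K)) /= -sumrN; apply: eq_bigr => x _.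
  by rewrite /h v1 fc1 sg1; ring.
have edge_ind (P : X -> Prop) : (forall x, P x -> P (s0 x)) -> (forall x, P x -> P (s2 x)) ->
    (forall e, P (r e)) -> forall x, P x.
  move=> P0 P2 Pr x; have := edge_orbit (eP (r (ed x)) x (rK _)).
  rewrite !inE => /or4P[] /eqP ->; do ?[apply: P0]; do ?[apply: P2]; exact: Pr.
have pick n (g : 'I_n -> rat) c : \sum_j g j * (c == j)%:R = g c.
  rewrite (bigD1 c) //= eqxx mulr1 big1 ?addr0 // => j /negbTE jc.
  by rewrite eq_sym jc mulr0.
have kerA : (\rank (kermx A) <= 1)%N.
  apply: leq_trans (rank_leq_row (const_mx 1 : 'rV[rat]_nV)); apply: mxrankS.
  apply/rV_subP => u /sub_kermxP uA.
  have u0 x : u 0 (vx (s0 x)) = u 0 (vx x).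
    move: x; apply: edge_ind => [x|x|e]; first by rewrite s0K => ->.
      by rewrite s02 !v2.
    have /matrixP/(_ 0 e) := uA; rewrite !mxE.
    under eq_bigr do rewrite !mxE mulrBr.
    by rewrite sumrB !pick => /eqP; rewrite subr_eq0 => /eqP.
  have uc := conn u0 (fun x => congr1 (u 0) (v1 x)) (fun x => congr1 (u 0) (v2 x)).
  have [nV0|] := posnP nV; last first.
    move=> nV0; have [x _] := vxS (Ordinal nV0).
    apply/sub_rVP; exists (u 0 (vx x)); apply/rowP => i; rewrite !mxE mulr1.
    by have [y <-] := vxS i; apply: uc.
  by rewrite (_ : u = 0) ?sub0mx //; apply/rowP => i; have := leq_ltn_trans (leq0n i) (ltn_ord i); rewrite [X in (_ < X)%N]nV0.
have kerB : (\rank (kermx B^T) <= k)%N.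
  apply: (kerk _ (row_base (kermx B^T))); first exact: row_base_free.
  move=> i; set W := row_base _.
  have WB : W *m B^T = 0 by apply/sub_kermxP; rewrite eq_row_base.
  clearbody W.
  apply: edge_ind => [x|x|e].
  - by rewrite -s02 !fc0 -!/(sg _) !sg0 !mulNr => ->.
  - by rewrite s2K => /esym/eqP; rewrite eqr_oppLR => /eqP.
  have /matrixP/(_ i e) := WB; rewrite !mxE.
  under eq_bigr do rewrite !mxE mulrDr mulrCA [X in _ + X]mulrCA.
  by rewrite big_split /= -!mulr_sumr !pick addrC => /eqP; rewrite addr_eq0 => /eqP.
have := mulmx0_rank_max AB.
rewrite !mxrank_ker mxrank_tr in kerA kerB.
lia.
Qed.

Definition orientation (o : X -> bool) :=
  [/\ forall x, o (s0 x) = ~~ o x, forall x, o (s1 x) = ~~ o x & forall x, o (s2 x) = ~~ o x].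

Lemma signN (b c : bool) : b = ~~ c -> (-1) ^+ b = - (-1) ^+ c :> rat.
Proof. by move=> ->; case: c; rewrite ?opprK. Qed.

(** Written on flags, a 2-cycle changes sign under all three involutions. Its absolute value is
    constant by connectedness, so the sign of a nonzero one would be an orientation; hence
    [k = 0]. *)
Lemma euler_nonorientable : (forall o, ~ orientation o) -> (nV + nF <= nE + 1)%N.
Proof.
move=> no; have [th [th0 th1]] := alternating_sign s0K s1K s0x s1x.
have [fc [fcS fc0 fc1 _]] := orbit_index s0K s1K.
rewrite -[leqRHS]addn0; apply: (euler_rank fcS fc0 fc1 th0 th1) => -[|m] // W freeW W2.
pose psi x : rat := (-1) ^+ th x * W 0 (fc x).
have p0 x : psi (s0 x) = - psi x by rewrite /psi fc0 (signN (th0 x)) mulNr.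
have p1 x : psi (s1 x) = - psi x by rewrite /psi fc1 (signN (th1 x)) mulNr.
have p2 x : psi (s2 x) = - psi x by apply: W2.
have pc x y : `|psi x| = `|psi y|.
  by apply: (conn (f := fun x => `|psi x|)) => z; rewrite ?p0 ?p1 ?p2 normrN.
have /existsP[f Wf] : [exists f, W 0 f != 0].
  apply: contraT => /existsPn W0; have /row_freeP[W' WW'] := freeW.
  have /matrixP/(_ 0 0) := WW'; rewrite !mxE eqxx big1 => [/eqP|f _].
    by rewrite eq_sym oner_eq0.
  by have /negPn/eqP -> := W0 f; rewrite mul0r.
have [x xf] := fcS f.
have psi0 y : psi y != 0.
  by rewrite -normr_eq0 -(pc x) normr_eq0 mulf_neq0 ?signr_eq0 ?xf.
have psiN y : (0 < - psi y) = ~~ (0 < psi y).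
  by rewrite oppr_gt0 -leNgt le_eqVlt (negbTE (psi0 y)).
case: (no (fun y => 0 < psi y)); split=> y; rewrite ?p0 ?p1 ?p2; exact: psiN.
Qed.

(** Multiplied by the orientation, a 2-cycle becomes an invariant function, hence a constant; the
    2-cycles have dimension at most 1. *)
Lemma euler_orientable o : X -> orientation o -> (nV + nF <= nE + 2)%N.
Proof.
move=> x0 [o0 o1 o2]; have [th [th0 th1]] := alternating_sign s0K s1K s0x s1x.
have [fc [fcS fc0 fc1 _]] := orbit_index s0K s1K.
have -> : (nE + 2 = nE + 1 + 1)%N by lia.
apply: (euler_rank fcS fc0 fc1 th0 th1) => m W freeW W2.
pose psi i x : rat := (-1) ^+ o x * ((-1) ^+ th x * W i (fc x)).
have p0 i x : psi i (s0 x) = psi i x.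
  by rewrite /psi fc0 (signN (th0 x)) (signN (o0 x)) !mulNr mulrN opprK.
have p1 i x : psi i (s1 x) = psi i x.
  by rewrite /psi fc1 (signN (th1 x)) (signN (o1 x)) !mulNr mulrN opprK.
have p2 i x : psi i (s2 x) = psi i x.
  by rewrite /psi W2 (signN (o2 x)) mulNr mulrN opprK.
have pc i := conn (p0 i) (p1 i) (p2 i).
have [y yf] := fin_all_exists fcS.
have <- : \rank W = m by apply/eqP.
pose w : 'rV[rat]_nF := \row_f ((-1) ^+ o (y f) * (-1) ^+ th (y f)).
have -> : W = (\col_i psi i x0) *m w.
  apply/matrixP => i f; rewrite !mxE big_ord1 !mxE (pc i x0 (y f)) /psi yf.
  by case: (o _); case: (th _); rewrite ?expr0 ?expr1; ring.
exact: leq_trans (mulmx_max_rank _ _) _.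
Qed.

(* The parity of the Euler characteristic comes from the signs of the
    rotations around vertices, edges and faces, restricted to the positive
    flags: they are three permutations, one of which is the product of the two
    others. *)
Section Parity.
Variable o : X -> bool.
Hypothesis oP : orientation o.

Let Y : finType := {x | o x}.

Section Rotation.
Variables a b : X -> X.
Hypotheses (aK : involutive a) (bK : involutive b).
Hypotheses (oa : forall x, o (a x) = ~~ o x) (ob : forall x, o (b x) = ~~ o x).

Fact rotation_key (y : Y) : o (b (a (val y))).
Proof. by rewrite ob oa negbK (valP y). Qed.
Definition rotation_fun (y : Y) : Y := exist o _ (rotation_key y).
Fact rotation_inj : injective rotation_fun.
Proof. by move=> y z /(congr1 val) /= /(can_inj bK)/(can_inj aK)/val_inj. Qed.
Definition rotation : {perm Y} := perm rotation_inj.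

Lemma rotationE y : val (rotation y) = b (a (val y)).
Proof. by rewrite permE. Qed.

(** Each orbit of [a] and [b] contains positive flags, and these form a single cycle of the rotation
    b a. *)
Lemma card_rotation_orbits : #|porbits rotation| = norbits a b.
Proof.
have -> : norbits a b = #|(fun y : Y => fingraph.root (gen2 a b) (val y)) @: [set: Y]|.
  congr #|pred_of_set _|; apply/setP => r; apply/imsetP/imsetP => -[x _ ->].
    have [ox|ox] := boolP (o x); first by exists (exist o x ox).
    have oax : o (a x) by rewrite oa ox.
    by exists (exist o (a x) oax) => //; case: (root_gen2 x aK bK).
  by exists (val x).
have -> : porbits rotation = porbit rotation @: [set: Y].
  by apply/setP => A; apply/imsetP/imsetP => -[x _ ->]; exists x.
apply: card_imset_kernel => x y _ _.
have sym := gen2_sym aK bK.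
rewrite eq_porbit_mem root_connect //; apply/porbitP/idP => [[i ->]|].
  elim: i => [|i IH]; first by rewrite perm1.
  rewrite sym; move: IH; rewrite sym => IH.
  apply: (connect_trans IH); rewrite expgSr permM rotationE.
  apply: (connect_trans (y := a (val ((rotation ^+ i)%g y)))); apply/connect1/orP;
    [left | right]; exact: eqxx.
rewrite sym => /connectP[p pP yp].
(* [P] moves a negative flag to the positive side by [a], so that membership in the cycle of [y] can
   be carried along a path one involution at a time. *)
pose P z := exists2 w, w \in porbit rotation y & (if o z then z else a z) = val w.
suff : P (val x) by case=> w wy; rewrite (valP x) => /val_inj->; apply/porbitP.
have Pa z : P z -> P (a z).
  by case=> w wy zw; exists w; rewrite // oa; case: (o z) zw; rewrite //= ?aK.
have pS w : porbit rotation (rotation w) = porbit rotation w.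
  by have := porbit_perm rotation 1 w; rewrite expg1.
have pV w : porbit rotation ((rotation^-1)%g w) = porbit rotation w.
  by rewrite -pS permKV.
have Pb z : P z -> P (b z).
  case=> w wy zw; rewrite /P ob; case: (o z) zw => zw /=.
    exists ((rotation^-1)%g w); last first.
      by apply: (can_inj aK); apply: (can_inj bK); rewrite aK bK -rotationE permKV.
    by rewrite -eq_porbit_mem pV eq_porbit_mem.
  exists (rotation w); last by rewrite rotationE -zw aK.
  by rewrite -eq_porbit_mem pS eq_porbit_mem.
have : P (val y) by exists y; rewrite ?porbit_id ?(valP y).
rewrite yp; elim: p (val y) pP {yp} => //= z p IH u /andP[/orP[]/eqP<- /IH zp Pu]; apply: zp.
  exact: Pa.
exact: Pb.
Qed.
End Rotation.

Lemma euler_even : ~~ odd (nV + nE + nF).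
Proof.
have [o0 o1 o2] := oP.
pose r a b aK bK oa ob := @rotation a b aK bK oa ob.
have rr : (r _ _ s0K s2K o0 o2 * r _ _ s2K s1K o2 o1)%g = r _ _ s0K s1K o0 o1.
  by apply/permP => y; apply: val_inj; rewrite permM !rotationE s2K.
have := congr1 (@odd_perm Y) rr.
rewrite odd_permM /odd_perm !card_rotation_orbits.
have -> : norbits s2 s1 = nV.
  congr #|pred_of_set _|; apply/eq_imset => x.
  by apply: eq_root => y z; rewrite /gen2 /= orbC.
(* The sign of a permutation is the parity of the number of points plus the number of cycles; with
   an even number of points only the cycles count. *)
have Yn : #|Y| = (2 * nE)%N.
  have := card_edges; rewrite -(cardC o) card_sig => XE.
  suff Co : #|[predC o]| = #|o|.
    by apply/eqP; rewrite -(eqn_pmul2l (m := 2)) // mulnA -XE Co addnn mul2n.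
  have oE x : (x \in o) = o x by [].
  rewrite -(fintype.card_image (inv_inj s0K) o); apply: eq_card => x; rewrite !inE.
  apply/idP/fintype.imageP => [ox|[y oy ->]]; last by rewrite oE o0 negbK.
  by exists (s0 x); rewrite ?s0K // oE o0.
rewrite Yn mul2n odd_double /= => VEF; rewrite !oddD -VEF.
rewrite -/nF -/nE -/nV; move: VEF; rewrite -/nE -/nF.
by case: (odd nV); case: (odd nE); case: (odd nF).
Qed.
End Parity.
End EulerBound.

(** * Vertices, edges and quad types of a tetrahedron *)

Lemma ord4E (a b : 'I_4) : (a == b) = (a == b :> nat).
Proof. by []. Qed.

Lemma uniq3E (a b c : 'I_4) :
  uniq [:: a; b; c] = [&& a != b :> nat, a != c :> nat & b != c :> nat].
Proof. by rewrite /= !inE !negb_or -!andbA !andbT. Qed.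

Lemma uniq4E (a b c d : 'I_4) : uniq [:: a; b; c; d] =
  [&& a != b :> nat, a != c :> nat, a != d :> nat,
      b != c :> nat, b != d :> nat & c != d :> nat].
Proof. by rewrite /= !inE !negb_or -!andbA !andbT. Qed.

Lemma uniq4_sum (a b c d : 'I_4) : uniq [:: a; b; c; d] -> (a + b + c + d = 6)%N.
Proof.
rewrite uniq4E; have := ltn_ord a; have := ltn_ord b; have := ltn_ord c.
have := ltn_ord d; lia.
Qed.

Ltac uq :=
  repeat (match goal with
    | H : is_true (uniq _) |- _ => revert H
    | H : is_true (_ != _) |- _ => revert H
    | H : is_true (_ == _) |- _ => revert H end);
  rewrite ?uniq4E ?uniq3E ?ord4E; clear; lia.

(** The vertices 0, 1, 2, 3 add up to 6. *)
Definition fourth (a b c : 'I_4) : 'I_4 := inord (6 - a - b - c)%N.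

Lemma fourthE a b c d : uniq [:: a; b; c; d] -> fourth a b c = d.
Proof.
move=> u; have s := uniq4_sum u; apply: val_inj.
by rewrite /= inordK //; have := ltn_ord d; lia.
Qed.

Lemma fourth_uniq a b c : uniq [:: a; b; c] -> uniq [:: a; b; c; fourth a b c].
Proof.
move=> u; suff [d ud] : exists d, uniq [:: a; b; c; d] by rewrite (fourthE ud).
exists (inord (6 - a - b - c)%N); move: u; rewrite uniq3E uniq4E.
have := ltn_ord a; have := ltn_ord b; have := ltn_ord c.
by move=> ? ? ? ?; rewrite inordK; lia.
Qed.

Lemma uniq4_cover (a b c d x : 'I_4) : uniq [:: a; b; c; d] -> [|| x == a, x == b, x == c | x == d].
Proof.
move=> u; have s := uniq4_sum u; have := ltn_ord x; move: u; rewrite uniq4E !ord4E /=.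
have := ltn_ord a; have := ltn_ord b; have := ltn_ord c; have := ltn_ord d; lia.
Qed.

Lemma setC_pair (a b c d : 'I_4) : uniq [:: a; b; c; d] -> ~: [set a; b] = [set c; d].
Proof.
move=> u; apply/setP => x; rewrite !inE; have := uniq4_cover x u; move: u.
rewrite uniq4E !ord4E /=; lia.
Qed.

Lemma faces_compl Q (a b c d : 'I_4) : uniq [:: a; b; c; d] ->
  faces Q [set a; b] = faces Q [set c; d].
Proof.
move=> u; rewrite /faces -(setC_pair u) orbC; congr (_ || _).
  by rewrite -(inj_eq (@finset.setC_inj _)) finset.setCK.
by rewrite (inj_eq (@finset.setC_inj _)).
Qed.

(* Quad type Q faces {0, Q + 1}.  If neither a nor b is 0, the complement of
   {a, b} is {0, 6 - a - b}. *)
Definition quad_type (a b : 'I_4) : nat :=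
  if a == 0 :> nat then b.-1 else if b == 0 :> nat then a.-1 else (5 - a - b)%N.

Lemma eq_pair (T : finType) (a b c d : T) : a != b -> c != d ->
  ([set a; b] == [set c; d]) = ((a == c) && (b == d)) || ((a == d) && (b == c)).
Proof.
move=> ab cd; apply/eqP/idP => [/setP eq|].
  have := eq a; have := eq b; have := eq c; have := eq d; rewrite !inE !eqxx ?orbT.
  move/orP => d'; move/orP => c'; move/esym/orP => b'; move/esym/orP => a'.
  case: a' => /eqP a'; case: b' => /eqP b'; subst; rewrite ?eqxx ?orbT //;
    by rewrite eqxx in ab.
by case/orP => /andP[/eqP-> /eqP->] //; rewrite finset.setUC.
Qed.

Lemma facesE (Q : 'I_3) (a b : 'I_4) : a != b ->
  faces Q [set a; b] = (Q == quad_type a b :> nat).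
Proof.
have key (c : 'I_4) : ord0 != c -> faces Q [set ord0; c] = (Q == c.-1 :> nat).
  move=> c0; rewrite /faces /quad_edge eq_pair // eqxx /=.
  have -> : ([set ord0; c] == ~: [set ord0; lift ord0 Q]) = false.
    by apply/negbTE/eqP => /setP/(_ ord0); rewrite !inE eqxx.
  by move: c0; rewrite !ord4E /= /bump leq0n; lia.
move=> ab; rewrite /quad_type; case: (@eqP _ (a : nat) 0%N) => a0.
  have a0' : a = ord0 by apply: val_inj.
  by rewrite a0' in ab *; apply: key.
case: (@eqP _ (b : nat) 0%N) => b0.
  have b0' : b = ord0 by apply: val_inj.
  by rewrite b0' eq_sym in ab *; rewrite finset.setUC; apply: key.
pose c : 'I_4 := fourth ord0 a b.
have u : uniq [:: ord0; a; b; c].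
  by apply: fourth_uniq; rewrite uniq3E; move: ab; rewrite ord4E /=; lia.
rewrite (@faces_compl Q a b ord0 c); last by uq.
rewrite key; last by uq.
by have := uniq4_sum u; rewrite /=; lia.
Qed.

Lemma quad_type_sym a b : quad_type a b = quad_type b a.
Proof. by rewrite /quad_type; case: eqP => a0; case: eqP => b0; lia. Qed.

Lemma quad_type_lt a b : a != b -> (quad_type a b < 3)%N.
Proof.
rewrite ord4E /quad_type; have := ltn_ord a; have := ltn_ord b.
by case: (@eqP _ (a : nat) 0%N) => ?; case: (@eqP _ (b : nat) 0%N) => ?; lia.
Qed.

Definition quad_facing (a b : 'I_4) : 'I_3 := inord (quad_type a b).

Lemma facesP Q (a b : 'I_4) : a != b -> faces Q [set a; b] = (Q == quad_facing a b).
Proof.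
by move=> ab; rewrite facesE // -{1}(inordK (quad_type_lt ab)).
Qed.

Lemma quad_facing_sym a b : quad_facing a b = quad_facing b a.
Proof. by rewrite /quad_facing quad_type_sym. Qed.

Lemma quad_facing_compl a b c d : uniq [:: a; b; c; d] -> quad_facing a b = quad_facing c d.
Proof.
move=> u; have s := uniq4_sum u; congr inord; rewrite /quad_type; move: u; rewrite uniq4E.
by case: (@eqP _ (a : nat) 0%N) => ?; case: (@eqP _ (b : nat) 0%N) => ?;
  case: (@eqP _ (c : nat) 0%N) => ?; case: (@eqP _ (d : nat) 0%N) => ?; lia.
Qed.

Lemma quad_facing_neq a b c d : uniq [:: a; b; c; d] -> quad_facing a b != quad_facing a c.
Proof.
move=> u; apply/eqP => /(congr1 (@nat_of_ord 3)).
rewrite !inordK; [|apply: quad_type_lt; uq..].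
have s := uniq4_sum u; rewrite /quad_type; move: u; rewrite uniq4E.
have := ltn_ord a; have := ltn_ord b; have := ltn_ord c; have := ltn_ord d.
by case: (@eqP _ (a : nat) 0%N) => ?; case: (@eqP _ (b : nat) 0%N) => ?;
  case: (@eqP _ (c : nat) 0%N) => ?; lia.
Qed.

Lemma quad_facing_lift (Q : 'I_3) : quad_facing ord0 (lift ord0 Q) = Q.
Proof.
by apply: val_inj; rewrite /= inordK // quad_type_lt.
Qed.

(** * Cells *)

Section Cells.
Variables (t : nat) (T : triangulation t).
Notation glued := (cell_glued T).

Lemma glue_inv j f a : glue T (nbr T j f) (glue T j f f) (glue T j f a) = a.
Proof. by rewrite glueK permK. Qed.

Lemma cell_glued_sym : symmetric glued.
Proof.
suff gs x y : glued x y -> glued y x by move=> x y; apply/idP/idP; apply: gs.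
case: x => j A; move=> /existsP[f /andP[/= fA /eqP ->]].
apply/existsP; exists (glue T j f f); rewrite /= mem_imset ?fA /=; last exact: perm_inj.
rewrite nbrK -imset_comp (eq_imset (g := id)) ?imset_id // => a /=.
exact: glue_inv.
Qed.

Lemma connect_glued_sym : connect_sym glued.
Proof. exact/sym_connect_sym/cell_glued_sym. Qed.

Lemma cell_glued_card x y : glued x y -> #|y.2| = #|x.2|.
Proof.
by move=> /existsP[f /andP[_ /eqP ->]] /=; rewrite card_imset //; apply: perm_inj.
Qed.

Lemma connect_glued_card x y : connect glued x y -> #|y.2| = #|x.2|.
Proof.
move=> /connectP[p pP ->]; elim: p x pP => //= z p IH x /andP[/cell_glued_card <-].
exact: IH.
Qed.

Section Classes.
Variable d : nat.
Notation D := [set x : cell t | #|x.2| == d].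

Lemma connect_glued_equiv : {in D & &, equivalence_rel (connect glued)}.
Proof.
move=> x y z _ _ _; split=> [|xy]; first exact: connect0.
exact: (same_connect connect_glued_sym).
Qed.

Let classP := equivalence_partitionP connect_glued_equiv.

Lemma cell_class_ex (x : cell t) : #|x.2| = d ->
  exists C : {e | e \in cell_classes T d}, x \in val C.
Proof.
move=> xd; have : x \in finset.cover (cell_classes T d).
  by rewrite (finset.cover_partition classP) inE xd.
by case/finset.bigcupP => C CP xC; exists (exist _ C CP).
Qed.

Implicit Type C : {e : {set cell t} | e \in cell_classes T d}.
Implicit Types x y : cell t.

Lemma cell_class_uniq C C' x : x \in val C -> x \in val C' -> C = C'.
Proof.
move=> xC xC'; have /and3P[_ tI _] := classP; apply: val_inj.
by rewrite -(finset.def_pblock tI (valP C) xC) (finset.def_pblock tI (valP C') xC').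
Qed.

Lemma cell_classE C : exists2 x : cell t, #|x.2| = d & val C = [set y in D | connect glued x y].
Proof.
by have /imsetP[x xD ->] := valP C; exists x => //; move: xD; rewrite inE => /eqP.
Qed.

Lemma cell_class_card C (x : cell t) : x \in val C -> #|x.2| = d.
Proof. by have [y yd ->] := cell_classE C; rewrite !inE => /andP[/eqP]. Qed.

Lemma cell_class_connect C x y : x \in val C -> y \in val C -> connect glued x y.
Proof.
have [z _ ->] := cell_classE C; rewrite !inE => /andP[_ zx] /andP[_]; apply: connect_trans.
by rewrite connect_glued_sym.
Qed.

Lemma cell_class_closed C x y : connect glued x y -> (x \in val C) = (y \in val C).
Proof.
have [z zd ->] := cell_classE C => xy.
by rewrite !inE (connect_glued_card xy) -(same_connect_r connect_glued_sym xy).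
Qed.

Lemma cell_class_glued C x y : glued x y -> (x \in val C) = (y \in val C).
Proof. by move=> /connect1; apply: cell_class_closed. Qed.

Lemma cell_class_rep C : exists x, x \in val C.
Proof. by have [x xd ->] := cell_classE C; exists x; rewrite !inE xd eqxx connect0. Qed.

Definition class_cell C : cell t := sval (cid (cell_class_rep C)).
Lemma class_cellP C : class_cell C \in val C.
Proof. exact: (svalP (cid (cell_class_rep C))). Qed.

(** A function of cells that is invariant under gluings descends to the cells of the quotient. *)
Lemma cell_function (V : Type) (phi : cell t -> V) :
  (forall x y, #|x.2| = d -> glued x y -> phi y = phi x) ->
  exists u : {e | e \in cell_classes T d} -> V, forall C x, x \in val C -> phi x = u C.
Proof.
move=> phiP; exists (fun C => phi (class_cell C)) => C x xC.
have := cell_class_connect (class_cellP C) xC.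
have := cell_class_card (class_cellP C).
move: (class_cell C) => y yd /connectP[p pP ->]; elim: p y yd pP => //= z p IH y yd.
by case/andP => yz zp; rewrite IH ?(phiP y z) // (cell_glued_card yz).
Qed.

(** The classes are disjoint, so the sum has at most one term. Its form matches [color] and the
    entries of [E_span]. *)
Definition cell_value (V : nmodType) (u : {e | e \in cell_classes T d} -> V) (x : cell t) : V :=
  \sum_(C : {e : {set cell t} | e \in cell_classes T d} | x \in val C) u C.

Lemma cell_valueE (V : nmodType) (u : {e | e \in cell_classes T d} -> V) C x :
  x \in val C -> cell_value u x = u C.
Proof.
move=> xC; rewrite /cell_value (big_pred1 C) // => C'; apply/idP/eqP => [xC'|->] //.
exact: cell_class_uniq xC' xC.
Qed.

Lemma cell_value_glued (V : nmodType) (u : {e | e \in cell_classes T d} -> V) x y :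
  glued x y -> cell_value u y = cell_value u x.
Proof. by move=> xy; apply: eq_bigl => C; rewrite (cell_class_glued C xy). Qed.

End Classes.

Lemma imset_pair (U W : finType) (p : U -> W) a b : p @: [set a; b] = [set p a; p b].
Proof. by rewrite imsetU1 imset_set1. Qed.

Lemma glued_pair j f a b : uniq [:: f; a; b] ->
  glued (j, [set a; b]) (nbr T j f, [set glue T j f a; glue T j f b]).
Proof.
move=> u; apply/existsP; exists f; rewrite !inE /= -imset_pair eqxx andbT.
by rewrite negb_or; move: u; rewrite /= !inE !negb_or => /and3P[/andP[-> ->]].
Qed.

Lemma glued_single j f a : f != a -> glued (j, [set a]) (nbr T j f, [set glue T j f a]).
Proof.
by move=> fa; apply/existsP; exists f; rewrite !inE /= -imset_set1 eqxx andbT.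
Qed.

End Cells.

(** * Directions of the ideal edges *)

Lemma uniq2_complete (v x : 'I_4) : v != x -> exists f y, uniq [:: v; x; f; y].
Proof.
move=> vx; have [f vxf] : exists f, uniq [:: v; x; f].
  suff /existsP[f] : [exists f, uniq [:: v; x; f]] by exists f.
  apply: contraT => /existsPn no.
  have := no ord0; have := no (@Ordinal 4 1 isT); have := no (@Ordinal 4 2 isT).
  by rewrite !uniq3E /=; move: vx; rewrite ord4E; lia.
by exists f, (fourth v x f); apply: fourth_uniq.
Qed.

(** The sign of the ordering a, b, c, d of the vertices of a tetrahedron, whose last element [d] is
    determined. *)
Definition odd3 (a b c : 'I_4) : bool :=
  [exists s : 'S_4, [&& odd_perm s, s ord0 == a, s (@Ordinal 4 1 isT) == b
    & s (@Ordinal 4 2 isT) == c]].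

Lemma perm3_ex a b c : uniq [:: a; b; c] -> exists s : 'S_4,
  [/\ s ord0 = a, s (@Ordinal 4 1 isT) = b & s (@Ordinal 4 2 isT) = c].
Proof.
move=> /fourth_uniq u; set d := fourth a b c in u *.
pose g (i : 'I_4) := nth a [:: a; b; c; d] i.
have g_inj : injective g.
  by move=> i k /eqP; rewrite nth_uniq // => /eqP/val_inj.
by exists (perm g_inj); rewrite !permE.
Qed.

Lemma perm_uniq4 (r : 'S_4) : uniq [:: r ord0; r (@Ordinal 4 1 isT);
  r (@Ordinal 4 2 isT); r (@Ordinal 4 3 isT)].
Proof.
rewrite -[[:: _; _; _; _]]/(map r [:: ord0; @Ordinal 4 1 isT; @Ordinal 4 2 isT; @Ordinal 4 3 isT]).
by rewrite map_inj_uniq //; apply: perm_inj.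
Qed.

Lemma odd3E (s : 'S_4) :
  odd3 (s ord0) (s (@Ordinal 4 1 isT)) (s (@Ordinal 4 2 isT)) = odd_perm s.
Proof.
apply/existsP/idP => [[s' /and4P[os /eqP s0 /eqP s1 /eqP s2]]|os]; last first.
  by exists s; rewrite os !eqxx.
suff -> : s = s' by [].
have u r := perm_uniq4 r.
apply/permP => i; have := ltn_ord i; case: i => -[|[|[|[|i]]]] //= ilt _.
- by rewrite (_ : Ordinal _ = ord0) //; apply: val_inj.
- by rewrite (_ : Ordinal _ = @Ordinal 4 1 isT) //; apply: val_inj.
- by rewrite (_ : Ordinal _ = @Ordinal 4 2 isT) //; apply: val_inj.
- rewrite (_ : Ordinal _ = @Ordinal 4 3 isT); last exact: val_inj.
  by rewrite -(fourthE (u s)) -(fourthE (u s')) s0 s1 s2.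
Qed.

Lemma odd3_perm (p : 'S_4) a b c : uniq [:: a; b; c] ->
  odd3 (p a) (p b) (p c) = odd_perm p (+) odd3 a b c.
Proof.
move=> /perm3_ex[s [<- <- <-]]; rewrite odd3E addbC -odd_permM -odd3E.
by rewrite !permM.
Qed.

Lemma odd3_swap a b c : uniq [:: a; b; c] -> odd3 b a c = ~~ odd3 a b c.
Proof.
move=> /perm3_ex[s [<- <- <-]]; rewrite odd3E.
have := odd3E (tperm ord0 (@Ordinal 4 1 isT) * s)%g.
by rewrite odd_permM odd_tperm !permM tpermL tpermR tpermD.
Qed.

Lemma odd3_last a b c d : uniq [:: a; b; c; d] -> odd3 a b d = ~~ odd3 a b c.
Proof.
move=> u; have /perm3_ex[s [sa sb sc]] : uniq [:: a; b; c] by uq.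
have sd : s (@Ordinal 4 3 isT) = d.
  rewrite -(fourthE u) -sa -sb -sc; symmetry; apply: fourthE.
  exact: perm_uniq4.
have := odd3E (tperm (@Ordinal 4 2 isT) (@Ordinal 4 3 isT) * s)%g.
rewrite odd_permM odd_tperm !permM tpermL !tpermD // -odd3E.
by rewrite sa sb sc sd.
Qed.

Section Direction.
Variables (t : nat) (T : triangulation t).

Definition corner_ok (z : 'I_t * {set 'I_4} * 'I_4) : bool :=
  (#|z.1.2| == 2) && (z.2 \notin z.1.2).
(** A tetrahedron, one of its undirected edges, and one of the two faces containing that edge, given
    by the opposite vertex. *)
Definition wedge : finType := {z | corner_ok z}.

Lemma corner_okP j v x f : uniq [:: v; x; f] -> corner_ok (j, [set v; x], f).
Proof.
rewrite uniq3E /corner_ok [_.1.2]/= [_.2]/= cards2 !inE !ord4E. lia.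
Qed.

Lemma wedge_ex (z : wedge) : exists j v x f, uniq [:: v; x; f] /\ val z = (j, [set v; x], f).
Proof.
case: z => [[[j A] f] ok]; have /andP[/= /cards2P[v [x [vx AE]]] fA] := ok.
have u : uniq [:: v; x; f] by move: vx fA; rewrite AE uniq3E !inE !ord4E; lia.
by exists j, v, x, f; rewrite -AE.
Qed.

Definition turn (z : 'I_t * {set 'I_4} * 'I_4) : 'I_t * {set 'I_4} * 'I_4 :=
  (z.1, odflt z.2 [pick g | (g \notin z.1.2) && (g != z.2)]).
Definition cross (z : 'I_t * {set 'I_4} * 'I_4) : 'I_t * {set 'I_4} * 'I_4 :=
  (nbr T z.1.1 z.2, glue T z.1.1 z.2 @: z.1.2, glue T z.1.1 z.2 z.2).

Lemma turnE j v x f y : uniq [:: v; x; f; y] -> turn (j, [set v; x], f) = (j, [set v; x], y).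
Proof.
move=> u; rewrite /turn /=; case: pickP => [g /andP[gA gf]|/(_ y)] /=.
  congr (_, _); apply/eqP; move: gA; rewrite !inE negb_or => /andP[gv gx].
  by have := uniq4_cover g u; rewrite (negbTE gv) (negbTE gx) (negbTE gf).
by rewrite !inE; move: u; rewrite uniq4E !ord4E; lia.
Qed.

Lemma crossE j v x f : cross (j, [set v; x], f) =
  (nbr T j f, [set glue T j f v; glue T j f x], glue T j f f).
Proof. by rewrite /cross /= imset_pair. Qed.

Lemma uniq_glue j f s : uniq (map (glue T j f) s) = uniq s.
Proof. by rewrite map_inj_uniq //; apply: perm_inj. Qed.

Fact turn_ok (z : wedge) : corner_ok (turn (val z)).
Proof.
have [j [v [x [f [u ->]]]]] := wedge_ex z; have u' := fourth_uniq u.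
by rewrite (turnE _ u'); apply: corner_okP; uq.
Qed.
Fact cross_ok (z : wedge) : corner_ok (cross (val z)).
Proof.
have [j [v [x [f [u ->]]]]] := wedge_ex z.
by rewrite crossE; apply: corner_okP; rewrite -(uniq_glue j f) in u.
Qed.

(** [turn] and [cross] walk around an ideal edge, through tetrahedra and faces in turn. They are
    fixed point free involutions, the second because no face is glued to itself, so
    [alternating_sign] applies. *)
Lemma wedge_sign : exists th : 'I_t * {set 'I_4} * 'I_4 -> bool,
  (forall j v x f y, uniq [:: v; x; f; y] ->
     th (j, [set v; x], y) = ~~ th (j, [set v; x], f)) /\
  (forall j v x f, uniq [:: v; x; f] ->
     th (nbr T j f, [set glue T j f v; glue T j f x], glue T j f f)
     = ~~ th (j, [set v; x], f)).
Proof.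
pose a (z : wedge) : wedge := exist corner_ok _ (turn_ok z).
pose b (z : wedge) : wedge := exist corner_ok _ (cross_ok z).
have aK : involutive a.
  move=> z; apply: val_inj => /=; have [j [v [x [f [u ->]]]]] := wedge_ex z.
  have u' := fourth_uniq u; rewrite (turnE _ u'); apply: turnE; uq.
have bK : involutive b.
  move=> z; apply: val_inj => /=; have [j [v [x [f [u ->]]]]] := wedge_ex z.
  by rewrite !crossE nbrK !glue_inv.
have ax z : a z != z.
  have [j [v [x [f [u zE]]]]] := wedge_ex z; have u' := fourth_uniq u.
  apply/eqP => /(congr1 val) /=; rewrite zE (turnE _ u') => -[/eqP].
  by move: u'; rewrite uniq4E ord4E; lia.
have bx z : b z != z.
  have [j [v [x [f [u zE]]]]] := wedge_ex z.
  apply/eqP => /(congr1 val) /=; rewrite zE crossE => -[e _ e'].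
  by have := @glue_free _ T j f; rewrite e e'; case.
have [th [tha thb]] := alternating_sign aK bK ax bx.
exists (fun z => if insub z is Some w then th w else false); split=> [j v x f y u|j v x f u].
  have ok : corner_ok (j, [set v; x], f) by apply: corner_okP; uq.
  rewrite (insubT _ ok) (_ : (j, [set v; x], y) = val (a (Sub _ ok))) ?valK ?tha //.
  by rewrite /= (turnE _ u).
have ok : corner_ok (j, [set v; x], f) by apply: corner_okP; uq.
rewrite (insubT _ ok) (_ : (_, _, _) = val (b (Sub _ ok))) ?valK ?thb //.
by rewrite /= crossE.
Qed.

(* The edges of the triangulation are not glued to themselves with the
   direction reversed: on a wedge around an edge, the sign [th] above and the
   orientation are both reversed by the rotation around the edge, while only
   the orientation depends on the direction of the edge. *)
Lemma edge_direction : exists dir : 'I_t -> 'I_4 -> 'I_4 -> bool,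
  (forall j v x, v != x -> dir j x v = ~~ dir j v x) /\
  (forall j v x f, uniq [:: v; x; f] ->
     dir (nbr T j f) (glue T j f v) (glue T j f x) = dir j v x).
Proof.
have [th [th_turn th_cross]] := wedge_sign.
pose D j v x f := th (j, [set v; x], f) (+) odd3 v x f.
have Dturn j v x f y : uniq [:: v; x; f; y] -> D j v x y = D j v x f.
  by move=> u; rewrite /D (th_turn _ _ _ _ _ u) (odd3_last u) addNb addbN negbK.
pose oth (v x : 'I_4) := odflt ord0 [pick f | uniq [:: v; x; f]].
pose dir j v x := D j v x (oth v x).
have dirE j v x f : uniq [:: v; x; f] -> dir j v x = D j v x f.
  move=> u; rewrite /dir /oth; case: pickP => [g|/(_ f)]; last by rewrite u.
  move=> ug; have {}ug : uniq [:: v; x; g] := ug.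
  have [->//|gf] := eqVneq g f; apply: Dturn.
  by rewrite [odflt _ _]/=; uq.
exists dir; split=> [j v x vx|j v x f u].
  have [f [y u]] := uniq2_complete vx.
  have u1 : uniq [:: v; x; f] by uq.
  have u2 : uniq [:: x; v; f] by uq.
  by rewrite (dirE _ _ _ _ u1) (dirE _ _ _ _ u2) /D finset.setUC odd3_swap // addbN.
have u1 := u; rewrite -(uniq_glue j f) in u1.
rewrite (dirE _ _ _ _ u) (dirE _ _ _ _ u1) /D th_cross // odd3_perm // glue_odd.
by rewrite addNb addTb addbN negbK.
Qed.
End Direction.

(** * The flags of an embedded normal surface *)

Section Flags.
Variables (t : nat) (T : triangulation t) (N : normal_coord t).
Hypothesis emb : embedded_normal T N.

Lemma nquad_atE j (a b : 'I_4) : a != b -> nquad_at N j a b = nquad N j (quad_facing a b).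
Proof.
by move=> ab; rewrite /nquad_at (big_pred1 (quad_facing a b)) // => Q; apply: facesP.
Qed.

Lemma nquad_at_sym j (a b : 'I_4) : nquad_at N j a b = nquad_at N j b a.
Proof. by rewrite /nquad_at finset.setUC. Qed.

Lemma nquad_at_compl j a b c d : uniq [:: a; b; c; d] ->
  nquad_at N j a b = nquad_at N j c d.
Proof. by move=> u; rewrite !nquad_atE ?(quad_facing_compl u) //; uq. Qed.

Lemma nquad_at_excl j a b c d : uniq [:: a; b; c; d] ->
  nquad_at N j a b = 0%N \/ nquad_at N j a c = 0%N.
Proof.
move=> u; rewrite !nquad_atE; [|uq..]; apply: emb.1; exact: quad_facing_neq u.
Qed.

Lemma narcs_glue j f v : v != f ->
  narcs N (nbr T j f) (glue T j f f) (glue T j f v) = narcs N j f v.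
Proof. exact: emb.2. Qed.

(** Arc numbers are plain naturals here, so that the moves are total functions that compute; the
    bound in [flag] is recovered from [nvalid]. *)
Definition nflag := ('I_t * 'I_4 * 'I_4 * 'I_4 * nat)%type.

Definition nval (a : flag N) : nflag := (a.1, a.2 : nat).

Lemma nval_inj : injective nval.
Proof. by move=> [z k] [z' k'] [-> /val_inj->]. Qed.

Definition nvalid (z : nflag) : bool :=
  let: (j, f, v, x, k) := z in uniq [:: f; v; x] && (k < narcs N j f v)%N.

Lemma flags_nvalid a : (a \in flags N) = nvalid (nval a).
Proof. by rewrite inE; case: a => -[[[[j f] v] x] k]. Qed.

Lemma nvalid_flag z : nvalid z -> exists a, nval a = z.
Proof.
case: z => -[[[j f] v] x] k /andP[u kn].
have kmax : (k < \max_(j < t) \max_(f < 4) \max_(v < 4) narcs N j f v)%N.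
  apply: leq_trans kn _; apply: leq_trans (leq_bigmax j).
  by apply: leq_trans (leq_bigmax f); apply: (leq_bigmax v).
by exists ((j, f, v, x), Ordinal kmax).
Qed.

Definition move0 (z : nflag) : nflag :=
  let: (j, f, v, x, k) := z in (j, f, v, fourth f v x, k).
Definition move1 (z : nflag) : nflag :=
  let: (j, f, v, x, k) := z in
  if (k < ntri N j v)%N then (j, fourth f v x, v, x, k)
  else (j, fourth f v x, x, v,
        (ntri N j x + (nquad_at N j f v - (k - ntri N j v)).-1)%N).
Definition move2 (z : nflag) : nflag :=
  let: (j, f, v, x, k) := z in
  (nbr T j f, glue T j f f, glue T j f v, glue T j f x, k).

Lemma flag0E a b : a \in flags N -> flag0 a b = (nval b == move0 (nval a)).
Proof.
rewrite flags_nvalid; case: a => -[[[j f] v] x] k /andP[u kn].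
have u' := fourth_uniq u; apply/existsP/eqP => [[y /andP[uy /eqP->]]|bE].
  by rewrite /nval /= (fourthE uy).
by exists (fourth f v x); rewrite u' /=; apply/eqP/nval_inj; rewrite bE.
Qed.

Lemma flag1E a b : a \in flags N -> flag1 a b = (nval b == move1 (nval a)).
Proof.
rewrite flags_nvalid; case: a => -[[[j f] v] x] k /andP[u kn].
have u' := fourth_uniq u; rewrite /flag1 /nval /move1 /=.
have -> (P : 'I_4 -> bool) : [exists y, uniq [:: f; v; x; y] && P y] = P (fourth f v x).
  apply/existsP/idP => [[y /andP[uy]]|Py]; first by rewrite -(fourthE uy).
  by exists (fourth f v x); rewrite u'.
case: ifP => _; last by [].
by apply/eqP/eqP => [->|bE] //; apply: nval_inj; rewrite /nval bE.
Qed.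

Lemma flag2E a b : a \in flags N -> flag2 T a b = (nval b == move2 (nval a)).
Proof.
by case: a => -[[[j f] v] x] k _; apply/eqP/eqP => [->|bE] //; apply: nval_inj.
Qed.

Lemma nvalid_move0 z : nvalid z -> nvalid (move0 z).
Proof.
case: z => -[[[j f] v] x] k /andP[u kn].
by apply/andP; split=> //; have := fourth_uniq u; uq.
Qed.

Lemma nvalid_move1 z : nvalid z -> nvalid (move1 z).
Proof.
case: z => -[[[j f] v] x] k /andP[u kn]; rewrite /move1.
have u' := fourth_uniq u; set y := fourth f v x in u' *.
case: ifP => kt; apply/andP; split; try by uq.
  by rewrite /narcs; lia.
have -> : narcs N j y x = (ntri N j x + nquad_at N j f v)%N.
  by congr addn; rewrite nquad_at_sym; apply: nquad_at_compl; uq.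
by move: kn; rewrite /narcs; lia.
Qed.

Lemma nvalid_move2 z : nvalid z -> nvalid (move2 z).
Proof.
case: z => -[[[j f] v] x] k /andP[u kn]; apply/andP; split.
  by rewrite -(uniq_glue T j f) in u.
by rewrite narcs_glue //; uq.
Qed.

Lemma move0K z : nvalid z -> move0 (move0 z) = z.
Proof.
case: z => -[[[j f] v] x] k /andP[u kn]; rewrite /move0.
have u' := fourth_uniq u; congr (_, _, _); apply: fourthE; uq.
Qed.

Lemma move1K z : nvalid z -> move1 (move1 z) = z.
Proof.
case: z => -[[[j f] v] x] k /andP[u kn]; rewrite /move1.
have u' := fourth_uniq u; set y := fourth f v x in u' *.
case: ifP => kt; first by rewrite kt; congr (_, _, _, _, _); apply: fourthE; uq.
rewrite ltnNge leq_addr /=.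
have -> : nquad_at N j y x = nquad_at N j f v.
  by rewrite nquad_at_sym; apply: nquad_at_compl; uq.
have -> : fourth y x v = f by apply: fourthE; uq.
by congr (_, _); move: kn; rewrite /narcs; lia.
Qed.

Lemma move2K z : nvalid z -> move2 (move2 z) = z.
Proof.
by case: z => -[[[j f] v] x] k _; rewrite /move2 nbrK !glue_inv.
Qed.

Lemma fourth_glue j f a b c : uniq [:: a; b; c] ->
  fourth (glue T j f a) (glue T j f b) (glue T j f c) = glue T j f (fourth a b c).
Proof.
move=> u; apply: fourthE; rewrite -[[:: _; _; _; _]]/(map (glue T j f) [:: a; b; c; _]).
by rewrite uniq_glue fourth_uniq.
Qed.

Lemma move02 z : nvalid z -> move0 (move2 z) = move2 (move0 z).
Proof.
by case: z => -[[[j f] v] x] k /andP[u kn]; rewrite /move0 /move2 fourth_glue.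
Qed.

Lemma move0_neq z : nvalid z -> move0 z != z.
Proof.
case: z => -[[[j f] v] x] k /andP[u kn]; have u' := fourth_uniq u.
by apply/eqP => -[] /eqP; move: u'; rewrite uniq4E ord4E; lia.
Qed.

Lemma move1_neq z : nvalid z -> move1 z != z.
Proof.
case: z => -[[[j f] v] x] k /andP[u kn]; have u' := fourth_uniq u.
by rewrite /move1; case: ifP => _; apply/eqP => -[] /eqP;
  move: u'; rewrite uniq4E ord4E; lia.
Qed.

Lemma move2_neq z z' : z.1.1.1 = z'.1.1.1 -> move2 z' != z.
Proof.
case: z z' => -[[[j f] v] x] k [[[[j' f'] v'] x'] k'] [-> ->]; apply/eqP => -[e e' _ _ _].
by have := @glue_free _ T j' f'; rewrite e e'; case.
Qed.

Definition sflag : finType := {a : flag N | a \in flags N}.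

Definition nsval (x : sflag) : nflag := nval (val x).

Lemma nsval_inj : injective nsval.
Proof. by move=> x y /nval_inj/val_inj. Qed.

Lemma nsval_valid x : nvalid (nsval x).
Proof. by rewrite -flags_nvalid (valP x). Qed.

Lemma sflag_ex z : nvalid z -> exists x, nsval x = z.
Proof.
move=> zv; have [a az] := nvalid_flag zv.
have av : a \in flags N by rewrite flags_nvalid az.
by exists (exist (fun a => a \in flags N) a av).
Qed.

Definition lift_move (m : nflag -> nflag) (mv : forall z, nvalid z -> nvalid (m z))
  (x : sflag) : sflag := sval (cid (sflag_ex (mv _ (nsval_valid x)))).

Lemma lift_moveE m mv x : nsval (@lift_move m mv x) = m (nsval x).
Proof. exact: (svalP (cid (sflag_ex (mv _ (nsval_valid x))))). Qed.

#[global] Opaque lift_move.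

Definition s0 := lift_move nvalid_move0.
Definition s1 := lift_move nvalid_move1.
Definition s2 := lift_move nvalid_move2.

Lemma s0K : involutive s0.
Proof. by move=> x; apply: nsval_inj; rewrite !lift_moveE move0K // nsval_valid. Qed.
Lemma s1K : involutive s1.
Proof. by move=> x; apply: nsval_inj; rewrite !lift_moveE move1K // nsval_valid. Qed.
Lemma s2K : involutive s2.
Proof. by move=> x; apply: nsval_inj; rewrite !lift_moveE move2K // nsval_valid. Qed.
Lemma s02 x : s0 (s2 x) = s2 (s0 x).
Proof. by apply: nsval_inj; rewrite !lift_moveE move02 // nsval_valid. Qed.
Lemma s0x x : s0 x != x.
Proof. by rewrite -(inj_eq nsval_inj) lift_moveE move0_neq // nsval_valid. Qed.
Lemma s1x x : s1 x != x.
Proof. by rewrite -(inj_eq nsval_inj) lift_moveE move1_neq // nsval_valid. Qed.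
Lemma s2x x : s2 x != x.
Proof. by rewrite -(inj_eq nsval_inj) lift_moveE move2_neq. Qed.
Lemma s02x x : s0 x != s2 x.
Proof.
rewrite -(inj_eq nsval_inj) !lift_moveE eq_sym move2_neq //.
by case: (nsval x) => -[[[j f] v] y] k.
Qed.

Lemma sflag0E x b : flag0 (val x) b = (b == val (s0 x)).
Proof. by rewrite flag0E ?(valP x) // -(inj_eq nval_inj) -/(nsval (s0 x)) lift_moveE. Qed.
Lemma sflag1E x b : flag1 (val x) b = (b == val (s1 x)).
Proof. by rewrite flag1E ?(valP x) // -(inj_eq nval_inj) -/(nsval (s1 x)) lift_moveE. Qed.
Lemma sflag2E x b : flag2 T (val x) b = (b == val (s2 x)).
Proof. by rewrite flag2E ?(valP x) // -(inj_eq nval_inj) -/(nsval (s2 x)) lift_moveE. Qed.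

Lemma connect_sflag (r : rel (flag N)) (a b : sflag -> sflag) :
  (forall x c, r (val x) c = (c == val (a x)) || (c == val (b x))) ->
  forall x y, connect r (val x) (val y) = connect (gen2 a b) x y.
Proof.
move=> rP x y; apply/idP/idP => /connectP[p pP yp]; last first.
  rewrite {}yp; elim: p x pP => [|z p IH] x /=; first by rewrite connect0.
  case/andP=> /orP[] /eqP <- /IH; apply: connect_trans; apply: connect1;
    by rewrite rP eqxx ?orbT.
elim: p x pP yp => [|z p IH] x /=; first by move=> _ /val_inj->.
rewrite rP => /andP[/orP[] /eqP-> /IH zP /zP]; apply: connect_trans; apply/connect1/orP;
  [left|right]; exact: eqxx.
Qed.

Lemma flag_orbitsE (r : rel (flag N)) (a b : sflag -> sflag) :
  involutive a -> involutive b ->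
  (forall x c, r (val x) c = (c == val (a x)) || (c == val (b x))) ->
  flag_orbits r = norbits a b.
Proof.
move=> aK bK rP; pose h (c : flag N) := omap (fingraph.root (gen2 a b)) (insub c : option sflag).
rewrite /flag_orbits (card_equivalence_partition (f := h)); last first.
  move=> c d cP dP; rewrite /h !insubT /= (inj_eq (@Some_inj _)) root_connect; last exact: gen2_sym.
  by rewrite -(connect_sflag rP).
rewrite /norbits -[RHS](card_imset _ (@Some_inj _)).
apply: eq_card => o; apply/imsetP/imsetP.
  case=> c cP ->; exists (fingraph.root (gen2 a b) (exist _ c cP)); first exact: imset_f.
  by rewrite /h insubT.
case=> _ /imsetP[x _ ->] ->; exists (val x); first exact: (valP x).
by rewrite /h valK.
Qed.

Lemma surface_eulerE : surface_euler T N =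
  (norbits s1 s2)%:Z - (norbits s0 s2)%:Z + (norbits s0 s1)%:Z.
Proof.
rewrite /surface_euler; congr (_%:Z - _%:Z + _%:Z); apply: flag_orbitsE;
  do ?[exact: s0K | exact: s1K | exact: s2K] => x c; rewrite /relU /=.
- by rewrite sflag1E sflag2E.
- by rewrite sflag0E sflag2E.
- by rewrite sflag0E sflag1E.
Qed.

End Flags.

(** * Counting the cells of a normal surface *)

Lemma norbits_count (X I : finType) (a b : X -> X) (c : I -> nat) (h : X -> I * nat) :
  involutive a -> involutive b ->
  (forall x, h (a x) = h x) -> (forall x, h (b x) = h x) ->
  (forall x, ((h x).2 < c (h x).1)%N) ->
  (forall i k, (k < c i)%N -> exists x, h x = (i, k)) ->
  (forall x y, h x = h y -> connect (gen2 a b) x y) ->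
  norbits a b = (\sum_i c i)%N.
Proof.
move=> aK bK ha hb hc hS hconn; have sym := gen2_sym aK bK.
pose U : finType := {i : I & 'I_(c i)}.
pose val_U (u : U) : I * nat := (tag u, tagged u : nat).
have val_U_inj : injective val_U.
  by case=> i k [i' k'] /= [/= ii]; case: _ / ii k' => k' /val_inj->.
pose g x : U := Tagged (fun i => 'I_(c i)) (Ordinal (hc x)).
have gE x : val_U (g x) = h x by rewrite /val_U /=; case: (h x).
have -> : norbits a b = #|g @: [set: X]|.
  have -> : norbits a b = #|fingraph.root (gen2 a b) @: [set: X]|.
    by apply: eq_card => r; apply/imsetP/imsetP => -[x _ ->]; exists x.
  apply: card_imset_kernel => x y _ _; rewrite root_connect // -(inj_eq val_U_inj) !gE.
  apply/idP/eqP => [|/hconn//] /connectP[p pP ->]; elim: p x pP => //= z p IH x.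
  by case/andP => /orP[] /eqP<- /IH <-.
have -> : g @: [set: X] = [set: U].
  apply/setP => -[i k]; rewrite !inE; apply/imsetP.
  have [x hx] := hS i k (ltn_ord k); exists x => //.
  by apply: val_U_inj; rewrite gE hx.
rewrite cardsT card_tagged sumnE big_map big_enum /=.
by apply: eq_bigr => i _; rewrite card_ord.
Qed.

Lemma big_quad_types (R : Type) (idx : R) (op : Monoid.com_law idx) (F : 'I_3 -> R)
    a b c d : uniq [:: a; b; c; d] ->
  \big[op/idx]_Q F Q =
  op (F (quad_facing a b)) (op (F (quad_facing a c)) (F (quad_facing a d))).
Proof.
move=> u; set q1 := quad_facing a b; set q2 := quad_facing a c; set q3 := quad_facing a d.
have n12 : q1 != q2 by apply: quad_facing_neq u.
have n13 : q1 != q3 by apply: (@quad_facing_neq _ _ _ c); uq.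
have n23 : q2 != q3 by apply: (@quad_facing_neq _ _ _ b); uq.
have Q3 (Q : 'I_3) : [|| Q == q1, Q == q2 | Q == q3].
  move: n12 n13 n23; rewrite -!(inj_eq (@ord_inj 3)); have := ltn_ord Q.
  have := ltn_ord q1; have := ltn_ord q2; have := ltn_ord q3; lia.
rewrite (bigD1 q1) //= (bigD1 q2) 1?eq_sym //= (bigD1 q3); last first.
  by rewrite (eq_sym q3 q1) n13 eq_sym n23.
rewrite big1 /=; first by rewrite Monoid.mulm1.
move=> Q /andP[/andP[/negbTE Q1 /negbTE Q2] /negbTE Q3'].
by have := Q3 Q; rewrite Q1 Q2 Q3'.
Qed.

Lemma sum_ltn n B : (n <= B)%N -> (\sum_(k < B) (k < n) = n)%N.
Proof.
move=> nB; rewrite -(big_mkord xpredT (fun k => (k < n)%N : nat)) (big_cat_nat (n := n)) //=.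
rewrite big_nat (eq_bigr (fun=> 1%N)) => [|k /andP[_ ->]] //.
rewrite -big_nat sum_nat_const_nat subn0 muln1 big_nat big1 ?addn0 // => k /andP[nk _].
by rewrite ltnNge nk.
Qed.

Lemma sum_uniq3 (f v : 'I_4) : (\sum_(x < 4) uniq [:: f; v; x] = (v != f) * 2)%N.
Proof.
rewrite !big_ord_recl big_ord0; case: f => -[|[|[|[|f]]]] //= flt;
  by case: v => -[|[|[|[|v]]]].
Qed.

Section Counting.
Variables (t : nat) (T : triangulation t) (N : normal_coord t).

(** The number of points where the surface meets the edge [x]: it is crossed by the triangles at its
    ends and by the quads that do not face it. *)
Definition edge_weight (x : cell t) : nat :=
  (\sum_(a in x.2) ntri N x.1 a + \sum_(Q | ~~ faces Q x.2) nquad N x.1 Q)%N.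

Lemma edge_weightE j f v x : uniq [:: f; v; x] ->
  edge_weight (j, [set v; x]) = (narcs N j f v + narcs N j f x)%N.
Proof.
move=> u; have u' := fourth_uniq u; set y := fourth f v x in u'.
have vx : v != x by uq.
rewrite /edge_weight /= big_setU1 ?big_set1 ?inE //=.
have -> : (\sum_(Q | ~~ faces Q [set v; x]) nquad N j Q = nquad_at N j f v + nquad_at N j f x)%N.
  rewrite !nquad_atE; [|uq..].
  have := @big_quad_types _ 0%N addn (nquad N j) v x f y ltac:(uq).
  rewrite (bigD1 (quad_facing v x)) //= => /addnI.
  rewrite (eq_bigl (fun Q => ~~ faces Q [set v; x])) => [->|Q]; last by rewrite facesP.
  rewrite (quad_facing_sym v f) (@quad_facing_compl v y f x) //; uq.
by rewrite /narcs; lia.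
Qed.

Hypothesis emb : embedded_normal T N.

Lemma edge_weight_glued (x y : cell t) : #|x.2| = 2%N -> cell_glued T x y ->
  edge_weight y = edge_weight x.
Proof.
case: x => j A /= /eqP/cards2P[v [a [va ->]]] /existsP[f /= /andP[fA /eqP->]].
have u : uniq [:: f; v; a] by move: fA va; rewrite uniq3E !inE !ord4E; lia.
rewrite imset_pair (edge_weightE _ u).
have u' := u; rewrite -(uniq_glue T j f) in u'; rewrite (edge_weightE _ u').
by rewrite !narcs_glue //; uq.
Qed.

Lemma edge_weight_class (e : ideal_edge T) x : x \in val e ->
  edge_weight x = edge_weight (class_cell e).
Proof.
move=> xe; have [w wP] := cell_function edge_weight_glued.
by rewrite (wP _ _ xe) (wP _ _ (class_cellP e)).
Qed.

Let s0 := @s0 t N.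
Let s1 := @s1 t N.
Let s2 := @s2 t T N emb.

Section Reach.
Variables (a b : sflag N -> sflag N) (x : sflag N).

Definition reach (z : nflag t) := exists2 y, nsval y = z & connect (gen2 a b) x y.

Lemma reach_refl : reach (nsval x).
Proof. by exists x; rewrite ?connect0. Qed.

Lemma reach_connect y : reach (nsval y) -> connect (gen2 a b) x y.
Proof. by case=> y' /nsval_inj->. Qed.

Lemma reach_valid z : reach z -> nvalid N z.
Proof. by case=> y <- _; apply: nsval_valid. Qed.

Lemma reachL z : reach z -> exists2 y, nsval y = z & reach (nsval (a y)).
Proof.
case=> y yz xy; exists y => //; exists (a y) => //; apply: connect_trans xy _.
by apply/connect1/orP; left; apply: eqxx.
Qed.

Lemma reachR z : reach z -> exists2 y, nsval y = z & reach (nsval (b y)).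
Proof.
case=> y yz xy; exists y => //; exists (b y) => //; apply: connect_trans xy _.
by apply/connect1/orP; right; apply: eqxx.
Qed.
End Reach.

Lemma move1_tri j f v a b k : uniq [:: f; v; a; b] -> (k < ntri N j v)%N ->
  move1 N (j, f, v, a, k) = (j, b, v, a, k).
Proof. by move=> u kt; rewrite /move1 kt (fourthE u). Qed.

Lemma move1_quad j f v a b i : uniq [:: f; v; a; b] ->
  move1 N (j, f, v, a, (ntri N j v + i)%N) =
  (j, b, a, v, (ntri N j a + (nquad_at N j f v - i).-1)%N).
Proof. by move=> u; rewrite /move1 ltnNge leq_addr addKn (fourthE u). Qed.

(** Parallel quads are numbered starting from the edge through vertex 0. Arcs in face [f] around [v]
    are counted from the edge {f, v}, hence the reversal when this is the opposite edge. *)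
Definition disc_label (z : nflag t) : ('I_t * ('I_4 + 'I_3)) * nat :=
  let: (j, f, v, x, k) := z in
  if (k < ntri N j v)%N then ((j, inl v), k)
  else ((j, inr (quad_facing f v)),
    if (f == ord0) || (v == ord0) then (k - ntri N j v)%N
    else (nquad_at N j f v - (k - ntri N j v)).-1).

Definition disc_count (d : 'I_t * ('I_4 + 'I_3)) : nat :=
  match d.2 with inl v => ntri N d.1 v | inr Q => nquad N d.1 Q end.

Lemma disc_label_move1 z : nvalid N z -> disc_label (move1 N z) = disc_label z.
Proof.
case: z => -[[[j f] v] x] k /andP[u kn]; have u' := fourth_uniq u.
set y := fourth f v x in u'; have [kt|tk] := ltnP k (ntri N j v).
  by rewrite (move1_tri u' kt) /disc_label kt.
rewrite -(subnKC tk) (move1_quad _ _ u') /disc_label !ltnNge !leq_addr /= !addKn.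
have u2 : uniq [:: y; x; f; v] by uq.
rewrite (quad_facing_compl u2) (nquad_at_compl _ _ u2).
congr (_, _).
have -> : (y == ord0) || (x == ord0) = ~~ ((f == ord0) || (v == ord0)).
  by have := uniq4_sum u'; move: u'; rewrite uniq4E !ord4E /=; lia.
move: kn; rewrite /narcs; case: (_ || _) => /=; lia.
Qed.

Lemma norbits_discs :
  norbits s0 s1 = (\sum_j \sum_v ntri N j v + \sum_j \sum_Q nquad N j Q)%N.
Proof.
rewrite (@norbits_count _ _ s0 s1 disc_count (fun x => disc_label (nsval x))).
- rewrite -big_split -(pair_bigA _ (fun j d => disc_count (j, d))) /=.
  by apply: eq_bigr => j _; rewrite big_sumType.
- exact: s0K.
- exact: s1K.
- by move=> x; rewrite lift_moveE; case: (nsval x) => -[[[j f] v] y] k.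
- by move=> x; rewrite lift_moveE disc_label_move1 // nsval_valid.
- move=> x; have := nsval_valid x; case: (nsval x) => -[[[j f] v] y] k /andP[u kn].
  rewrite /disc_label; case: ifP => //= kt; rewrite /disc_count /=.
  rewrite -nquad_atE; last by uq.
  by move: kn; rewrite /narcs; case: ifP; lia.
- move=> [j [v|Q]] k kc.
    have [f [x u]] := uniq2_complete (neq_lift v ord0).
    have /sflag_ex[y yz] : nvalid N (j, f, v, lift v ord0, k).
      apply/andP; split; first by uq.
      by rewrite /narcs; move: kc; rewrite /disc_count /=; lia.
    by exists y; rewrite yz /disc_label; move: kc; rewrite /disc_count /= => ->.
  have [f [x u]] := uniq2_complete (neq_lift ord0 Q).
  have nq : nquad_at N j ord0 (lift ord0 Q) = nquad N j Q.
    by rewrite nquad_atE ?quad_facing_lift // neq_lift.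
  have /sflag_ex[y yz] :
      nvalid N (j, ord0, lift ord0 Q, f, (ntri N j (lift ord0 Q) + k)%N).
    apply/andP; split; first by uq.
    by rewrite /narcs nq ltn_add2l.
  by exists y; rewrite yz /disc_label ltnNge leq_addr /= addKn quad_facing_lift.
move=> x y xy; apply: reach_connect.
have K0 j f v a b k : uniq [:: f; v; a; b] -> reach s0 s1 x (j, f, v, a, k) ->
    reach s0 s1 x (j, f, v, b, k).
  by move=> u /reachL[z zE]; rewrite lift_moveE zE /move0 (fourthE u).
have K1t j f v a b k : uniq [:: f; v; a; b] -> (k < ntri N j v)%N ->
    reach s0 s1 x (j, f, v, a, k) -> reach s0 s1 x (j, b, v, a, k).
  by move=> u kt /reachR[z zE]; rewrite lift_moveE zE (move1_tri u).
have K1q j f v a b i : uniq [:: f; v; a; b] ->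
    reach s0 s1 x (j, f, v, a, ntri N j v + i)%N ->
    reach s0 s1 x (j, b, a, v, ntri N j a + (nquad_at N j f v - i).-1)%N.
  by move=> u /reachR[z zE]; rewrite lift_moveE zE (move1_quad _ _ u).
have := reach_refl s0 s1 x; move: xy (nsval_valid x) (nsval_valid y).
case: (nsval x) => -[[[j f] v] a] k; case: (nsval y) => -[[[j' f'] v'] a'] k'.
move=> xy /andP[u kn] /andP[u1 kn'] Kx; have u' := fourth_uniq u.
set b := fourth f v a in u'.
move: xy; rewrite /disc_label; case: ltnP => kt; case: ltnP => kt' // [].
  move=> jj vv kk; rewrite -{}jj -{}vv -{}kk in u1 *.
  (* With [Kx], these are the six flags of a triangle. *)
  have Kb : reach s0 s1 x (j, f, v, b, k) by apply: K0 Kx.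
  have Kba : reach s0 s1 x (j, b, v, a, k) by apply: K1t Kx.
  have Kab : reach s0 s1 x (j, a, v, b, k) by apply: K1t Kb => //; uq.
  have Kbf : reach s0 s1 x (j, b, v, f, k) by apply: K0 Kba; uq.
  have Kaf : reach s0 s1 x (j, a, v, f, k) by apply: K0 Kab; uq.
  have /or4P[] := uniq4_cover f' u' => /eqP ff;
    have /or4P[] := uniq4_cover a' u' => /eqP aa; rewrite {}ff {}aa in u1 *;
    do [exact: Kx | exact: Kb | exact: Kba | exact: Kab | exact: Kbf | exact: Kaf
      | by move: u1; rewrite /= !inE !eqxx ?orbT ?andbF].
move=> jj qq ii; rewrite -{}jj in kt' kn' ii *.
have i_lt : (k - ntri N j v < nquad_at N j f v)%N by move: kn; rewrite /narcs; lia.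
move: Kx ii; rewrite -{1}(subnKC kt); move: (k - _)%N i_lt => i i_lt Kx ii.
set n := nquad_at N j f v in i_lt ii *.
have nab : nquad_at N j a b = n by rewrite /n; apply/esym/nquad_at_compl.
have nba : nquad_at N j b a = n by rewrite nquad_at_sym.
have nvf : nquad_at N j v f = n by rewrite nquad_at_sym.
(* With [Kx], these are the eight flags of a quad. [K1q] passes between the edges {f, v} and {a, b},
   which reverses the numbering; [KG] undoes the reversal. *)
have KA : reach s0 s1 x (j, f, v, b, ntri N j v + i)%N by apply: K0 Kx.
have KC : reach s0 s1 x (j, b, a, v, ntri N j a + (n - i).-1)%N by apply: K1q Kx.
have KD : reach s0 s1 x (j, b, a, f, ntri N j a + (n - i).-1)%N by apply: K0 KC; uq.
have KE : reach s0 s1 x (j, a, b, v, ntri N j b + (n - i).-1)%N by apply: K1q KA; uq.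
have KF : reach s0 s1 x (j, a, b, f, ntri N j b + (n - i).-1)%N by apply: K0 KE; uq.
have KG : reach s0 s1 x (j, v, f, a, ntri N j f + i)%N.
  have := K1q j b a f v _ ltac:(uq) KD; rewrite nba.
  by have -> : (n - (n - i).-1).-1 = i by lia.
have KH : reach s0 s1 x (j, v, f, b, ntri N j f + i)%N by apply: K0 KG; uq.
have {}kn' : (k' - ntri N j v' < nquad_at N j f' v')%N by move: kn'; rewrite /narcs; lia.
rewrite -(subnKC kt'); move: (k' - _)%N kn' ii => i' kn' ii.
have qn c d e g : uniq [:: c; d; e; g] -> quad_facing c d <> quad_facing c e.
  by move=> u2; apply/eqP; apply: quad_facing_neq u2.
have qn1 : quad_facing f v <> quad_facing f a by apply: qn u'.
have qn2 : quad_facing f v <> quad_facing f b by apply: (qn _ _ _ a); uq.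
have qn3 : quad_facing f v <> quad_facing v a.
  by rewrite quad_facing_sym; apply: (qn _ _ _ b); uq.
have qn4 : quad_facing f v <> quad_facing v b.
  by rewrite quad_facing_sym; apply: (qn _ _ _ a); uq.
have ab0 : (a == ord0) || (b == ord0) = ~~ ((f == ord0) || (v == ord0)).
  by have := uniq4_sum u'; move: u'; rewrite uniq4E !ord4E /=; lia.
have fin z k1 k2 : reach s0 s1 x (z, k1) -> k1 = k2 -> reach s0 s1 x (z, k2).
  by move=> ? <-.
have /or4P[] := uniq4_cover f' u' => /eqP ff; have /or4P[] := uniq4_cover v' u' => /eqP vv;
  have /or4P[] := uniq4_cover a' u' => /eqP aa; rewrite {}ff {}vv {}aa in u1 kn' qq ii *.
all: try by move: u1; rewrite /= !inE !eqxx ?orbT ?andbF.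
all: try by case: qn1; rewrite qq // quad_facing_sym.
all: try by case: qn2; rewrite qq // quad_facing_sym.
all: try by case: qn3; rewrite qq // quad_facing_sym.
all: try by case: qn4; rewrite qq // quad_facing_sym.
all: rewrite ?(orbC (v == ord0) (f == ord0)) ?(orbC (b == ord0) (a == ord0)) ?ab0 in ii.
all: rewrite ?nvf ?nab ?nba -/n in ii kn'.
all: do [apply: fin Kx _ | apply: fin KA _ | apply: fin KC _ | apply: fin KD _
  | apply: fin KE _ | apply: fin KF _ | apply: fin KG _ | apply: fin KH _].
all: by congr addn; move: ii kn' i_lt; case: (_ || _) => /=; clear; lia.
Qed.

(** A vertex of the surface is determined by the ideal edge that carries it and by its position
    there. Positions make sense globally thanks to a direction of the edge that is preserved by
    gluings. *)
Lemma norbits_vertices : norbits s1 s2 = (\sum_(e : ideal_edge T) edge_weight (class_cell e))%N.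
Proof.
have [dir [dirN dirG]] := edge_direction T.
pose ecell (z : nflag t) : cell t := let: (j, f, v, x, k) := z in (j, [set v; x]).
have ecell2 z : nvalid N z -> #|(ecell z).2| = 2%N.
  by case: z => -[[[j f] v] x] k /andP[u _]; rewrite cards2 (_ : v != x) //; uq.
(* Positions are counted from the start of the edge; arc [k] around the other end is at
   [edge_weight - 1 - k]. *)
pose pos (z : nflag t) : nat := let: (j, f, v, x, k) := z in
  if dir j v x then k else (edge_weight (j, [set v; x]) - k).-1.
have edge_ex (y : sflag N) : exists e : ideal_edge T, ecell (nsval y) \in val e.
  by have [e eP] := cell_class_ex T (ecell2 _ (nsval_valid y)); exists e.
have [eg egP] := fin_all_exists edge_ex.
have egE y y' : connect (cell_glued T) (ecell (nsval y)) (ecell (nsval y')) -> eg y = eg y'.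
  move=> c; have := egP y; rewrite (cell_class_closed _ c) => h.
  exact: cell_class_uniq h (egP y').
have ecell_s1 y : ecell (nsval (s1 y)) = ecell (nsval y).
  rewrite lift_moveE; case: (nsval y) => -[[[j f] v] a] k /=; case: ifP => //= _.
  by rewrite finset.setUC.
have ecell_s2 y : cell_glued T (ecell (nsval y)) (ecell (nsval (s2 y))).
  rewrite lift_moveE; have := nsval_valid y; case: (nsval y) => -[[[j f] v] a] k /andP[u _].
  exact: glued_pair.
have pos_s1 y : pos (nsval (s1 y)) = pos (nsval y).
  rewrite lift_moveE; have := nsval_valid y.
  case: (nsval y) => -[[[j f] v] a] k /andP[u kn] /=.
  case: ltnP => //= kt; have va : v != a by uq.
  rewrite dirN // (finset.setUC [set a]) (edge_weightE j u).
  (* The arc [k] belongs to a quad around [v], which excludes quads around [a] in the same face: the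
     edge carries the triangles at its two ends and the quads around [v] only. *)
  move: kn; have [] := nquad_at_excl emb j (fourth_uniq u); rewrite /narcs => ->;
    by case: (dir j v a) => /=; lia.
have pos_s2 y : pos (nsval (s2 y)) = pos (nsval y).
  rewrite lift_moveE; have := nsval_valid y.
  case: (nsval y) => -[[[j f] v] a] k /andP[u kn] /=; rewrite dirG; last by uq.
  have gl := glued_pair T j u.
  by rewrite (edge_weight_glued _ gl) // cards2 (_ : v != a) //; uq.
apply: (@norbits_count _ _ s1 s2 _ (fun y => (eg y, pos (nsval y)))).
- exact: s1K.
- exact: s2K.
- by move=> y; rewrite pos_s1; congr (_, _); apply: egE; rewrite ecell_s1 connect0.
- move=> y; rewrite pos_s2; congr (_, _); apply: egE; rewrite connect_glued_sym.
  exact/connect1/ecell_s2.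
- move=> y; suff : (pos (nsval y) < edge_weight (ecell (nsval y)))%N.
    by rewrite (edge_weight_class (egP y)).
  have := nsval_valid y; case: (nsval y) => -[[[j f] v] a] k /andP[u kn] /=.
  by move: kn; rewrite (edge_weightE j u); case: (dir j v a); lia.
- move=> e m; case ee : (class_cell e) => [j A] mw.
  have := class_cellP e; rewrite ee => eP.
  have /eqP/cards2P[v [a [va AE]]] := cell_class_card eP.
  have [f [b u]] := uniq2_complete va; have u1 : uniq [:: f; v; a] by uq.
  have u2 : uniq [:: f; a; v] by uq.
  rewrite /= in AE; rewrite {}AE in ee eP mw; rewrite (edge_weightE j u1) in mw.
  pose i := if dir j v a then m else (narcs N j f v + narcs N j f a - m).-1.
  have egy y : ecell (nsval y) = (j, [set v; a]) -> eg y = e.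
    by move=> yE; have := egP y; rewrite yE => h; apply: cell_class_uniq h eP.
  have [iv|vi] := ltnP i (narcs N j f v).
    have /sflag_ex[y yz] : nvalid N (j, f, v, a, i) by apply/andP.
    exists y; rewrite egy ?yz //; congr (_, _) => /=; rewrite (edge_weightE j u1).
    by move: mw; rewrite /i; case: (dir j v a) => /=; lia.
  have /sflag_ex[y yz] : nvalid N (j, f, a, v, (narcs N j f v + narcs N j f a - i).-1).
    by apply/andP; split=> //; move: mw vi; rewrite /i; case: (dir j v a); lia.
  exists y; rewrite egy ?yz /= ?(finset.setUC [set a]) //; congr (_, _).
  by rewrite dirN // (edge_weightE j u1); move: mw vi; rewrite /i; case: (dir j v a) => /=; lia.
move=> x y hxy; have exy : eg x = eg y := congr1 fst hxy.
have pxy : pos (nsval x) = pos (nsval y) := congr1 snd hxy.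
apply: reach_connect => {hxy}.
(* The vertex follows a gluing through either face at the edge: [s2] crosses the face of the flag,
   and [s1] first switches to the other face if necessary. *)
have step c z : reach s1 s2 x z -> cell_glued T (ecell z) c ->
    exists2 z', reach s1 s2 x z' & ecell z' = c.
  move=> Kz; have := reach_valid Kz.
  case: z Kz => -[[[j f] v] a] k Kz /andP[u kn] /existsP[g /= /andP[gA /eqP->]].
  have u' := fourth_uniq u.
  have [gf|gf] := eqVneq g f.
    have [z zE Kz'] := reachR Kz; eexists; first exact: Kz'.
    by rewrite lift_moveE zE gf /= imset_pair.
  have ge : g = fourth f v a.
    by have := uniq4_cover g u'; move: gA gf; rewrite !inE negb_or =>
      /andP[/negbTE-> /negbTE->] /negbTE-> /eqP.
  have [z zE Kz'] := reachL Kz; have [z' z'E Kz''] := reachR Kz'.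
  eexists; first exact: Kz''.
  rewrite lift_moveE z'E lift_moveE zE /= ge; case: ifP => _ /=; rewrite imset_pair //.
  by rewrite finset.setUC.
have [z Kz zE] : exists2 z, reach s1 s2 x z & ecell z = ecell (nsval y).
  have := egP y; rewrite -exy => /(cell_class_connect (egP x)) /connectP[p pP ->].
  move: pP (reach_refl s1 s2 x); elim: p (nsval x) => [|c p IH] z /=; first by exists z.
  by case/andP=> zc cp Kz; have [z' Kz' z'E] := step _ _ Kz zc; rewrite -z'E in cp *; apply: IH Kz'.
have posz : pos z = pos (nsval y).
  have [w wz xw] := Kz; rewrite -pxy -wz.
  have /connectP[p pP ->] := xw.
  elim: p x pP {exy pxy Kz xw step} => [//|w' p IH x] /andP[xw' /IH eq].
  transitivity (pos (nsval w')); first exact: eq.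
  by case/orP: xw' => /eqP<-; rewrite ?pos_s1 ?pos_s2.
(* A face, an edge in it and a position determine the flag, because the arcs around the two ends
   occupy complementary positions. *)
have same (z1 z2 : nflag t) : nvalid N z1 -> nvalid N z2 -> ecell z1 = ecell z2 ->
    pos z1 = pos z2 -> z1.1.1.1.2 = z2.1.1.1.2 -> z1 = z2.
  case: z1 => -[[[j f] v] a] k; case: z2 => -[[[j' f'] v'] a'] k'.
  move=> /andP[u kn] /andP[u1 kn'] /= [jj /eqP]; rewrite -{}jj in kn' *.
  move=> va pp ff; rewrite -{}ff in u1 kn' *; move: va.
  have va : v != a by uq.
  have va' : v' != a' by uq.
  rewrite eq_pair // => /orP[]/andP[/eqP e1 /eqP e2]; rewrite -{}e1 -{}e2 in u1 kn' pp va' *.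
    by congr (_, _); move: pp kn kn'; rewrite (edge_weightE j u); case: (dir j v a); lia.
  exfalso; move: pp kn kn'; rewrite (dirN j v a va) (finset.setUC [set a]) (edge_weightE j u).
  by case: (dir j v a) => /=; lia.
(* The two flags may still lie in different faces at the edge, which [s1] exchanges. *)
have [w wz _] := Kz; have [fz|fz] := eqVneq z.1.1.1.2 (nsval y).1.1.1.2.
  by rewrite -(same _ _ (reach_valid Kz) (nsval_valid y) zE posz fz).
have [w' w'z Kz'] := reachL Kz; rewrite -{}w'z in zE posz fz Kz.
rewrite -(same _ _ (nsval_valid (s1 w')) (nsval_valid y)) ?ecell_s1 ?pos_s1 //.
move: zE fz (nsval_valid w') (nsval_valid y); rewrite lift_moveE.
case: (nsval w') => -[[[j f] v] a] k; case: (nsval y) => -[[[j' f'] v'] a'] k' /=.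
move=> [_ AE] ff /andP[u _] /andP[u1 _].
have u' := fourth_uniq u; have {}u1 : uniq [:: f'; v'; a'] := u1.
suff -> : f' = fourth f v a by case: ifP.
have : f' \notin [set v; a] by rewrite AE !inE; uq.
by have := uniq4_cover f' u'; rewrite !inE negb_or eq_sym (negbTE ff) /= =>
  /or3P[/eqP->|/eqP->|/eqP->] //; rewrite eqxx ?andbF.
Qed.

(** An edge of the surface has four flags, and an arc in a face of one tetrahedron carries two, one
    per endpoint. *)
Lemma norbits_edges :
  (2 * norbits s0 s2)%N = (\sum_j \sum_f \sum_(v | v != f) narcs N j f v)%N.
Proof.
have := @card_edges _ s0 s2 (@s0K _ N) (@s2K _ T N emb) (@s0x _ N) (@s2x _ T N emb)
  (@s02 _ T N emb) (@s02x _ T N emb).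
move=> sfE; have {}sfE : #|sflag N| = (2 * (2 * norbits s0 s2))%N by rewrite mulnA.
apply/eqP; rewrite -(eqn_pmul2l (m := 2)) // -sfE card_sig.
pose B := (\max_(j < t) \max_(f < 4) \max_(v < 4) narcs N j f v)%N.
have -> : #|[pred a | a \in flags N]| =
  (\sum_(j < t) \sum_(f < 4) \sum_(v < 4) \sum_(x < 4) \sum_(k < B)
    (uniq [:: f; v; x] && (k < narcs N j f v)))%N.
  rewrite pair_bigA pair_bigA pair_bigA pair_bigA /= -sum1_card big_mkcond /=.
  apply: eq_bigr => -[[[[j f] v] x] k] _ /=; rewrite inE.
  by case: (_ && _).
apply/eqP; rewrite big_distrr; apply: eq_bigr => j _.
rewrite big_distrr; apply: eq_bigr => f _.
rewrite [in RHS]big_mkcond big_distrr; apply: eq_bigr => v _ /=.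
have kB x : (\sum_(k < B) (uniq [:: f; v; x] && (k < narcs N j f v)) =
    uniq [:: f; v; x] * narcs N j f v)%N.
  case: (uniq _); rewrite ?mul0n ?mul1n; last by rewrite big1.
  apply: sum_ltn; apply: leq_trans (leq_bigmax j).
  by apply: leq_trans (leq_bigmax f); apply: (leq_bigmax v).
rewrite (eq_bigr _ (fun x _ => kB x)) -big_distrl /= sum_uniq3.
by case: (v != f); rewrite ?mul0n ?muln0.
Qed.

(** Twice the alternating sum of the numbers of vertices, edges and discs, each arc being seen from
    two tetrahedra. It is linear in the normal coordinates and defined for nonembedded ones too. *)
Definition normal_euler2 : int :=
  2 * (\sum_(e : ideal_edge T) edge_weight (class_cell e))%N%:Z
  - (\sum_j \sum_f \sum_(v | v != f) narcs N j f v)%N%:Z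
  + 2 * (\sum_j \sum_v ntri N j v + \sum_j \sum_Q nquad N j Q)%N%:Z.

Lemma surface_euler2 : 2 * surface_euler T N = normal_euler2.
Proof.
rewrite (surface_eulerE emb) /normal_euler2 -norbits_vertices -norbits_edges -norbits_discs.
have gen (a b c : nat) : 2 * (a%:Z - b%:Z + c%:Z) = 2 * a%:Z - (2 * b)%N%:Z + 2 * c%:Z.
  by lia.
exact: gen.
Qed.
End Counting.

(** * Components of normal surfaces *)

Section Components.
Variables (t : nat) (T : triangulation t).

Section Connected.
Variable N : normal_coord t.
Hypothesis emb : embedded_normal T N.

Let s0 := @s0 t N.
Let s1 := @s1 t N.
Let s2 := @s2 t T N emb.

Definition gen3 : rel (sflag N) := relU (frel s0) (gen2 s1 s2).

Lemma gen3_sym : connect_sym gen3.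
Proof.
apply: sym_connect_sym => x y.
have fs c : involutive c -> (c x == y) = (c y == x).
  by move=> cK; rewrite (can2_eq cK cK) eq_sym.
congr (_ || (_ || _)); apply: fs; [exact: s0K | exact: s1K | exact: s2K].
Qed.

Lemma gen3E x z : gen3 x z = [|| z == s0 x, z == s1 x | z == s2 x].
Proof. by rewrite !(eq_sym z). Qed.

Lemma connected_const : (forall x y, connect gen3 x y) ->
  forall (Y : eqType) (f : sflag N -> Y), (forall x, f (s0 x) = f x) ->
  (forall x, f (s1 x) = f x) -> (forall x, f (s2 x) = f x) -> forall x y, f x = f y.
Proof.
move=> conn Y f f0 f1 f2 x y; have /connectP[p pP ->] := conn x y.
elim: p x pP => //= z p IH x /andP[/or3P[] /eqP<- /IH <-] //; by rewrite ?f0 ?f1 ?f2.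
Qed.

Lemma connected_surface : sflag N -> (forall x y, connect gen3 x y) ->
  surface_connected T N.
Proof.
move=> x0 conn; apply/eqP; rewrite /flag_orbits.
rewrite (card_equivalence_partition (f := fun=> tt)) => [|a b aP bP].
  rewrite (_ : _ @: _ = [set tt]) ?cards1 //; apply/setP => -[]; rewrite !inE.
  by apply/imsetP; exists (val x0); rewrite ?(valP x0).
rewrite eqxx; pose x : sflag N := exist (fun c => c \in flags N) a aP.
pose y : sflag N := exist (fun c => c \in flags N) b bP.
rewrite -[a]/(val x) -[b]/(val y); have /connectP[p pP ->] := conn x y.
elim: p x pP => [|z p IH] x; first by rewrite connect0.
move=> /andP[xz /IH]; apply: connect_trans; apply: connect1.
have e : flag0 (val x) (val z) || (flag1 (val x) (val z) || flag2 T (val x) (val z)) =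
    gen3 x z by rewrite gen3E sflag0E sflag1E (sflag2E emb) !(inj_eq val_inj).
by have {}xz := etrans e xz; exact: xz.
Qed.

Lemma orientation_surface : surface_orientable T N <-> exists o, orientation s0 s1 s2 o.
Proof.
split=> [[s sP]|[o [o0 o1 o2]]].
  have sN (x y : sflag N) : flag0 (val x) (val y) || flag1 (val x) (val y) || flag2 T (val x) (val y) ->
      s (val y) = ~~ s (val x).
    by move=> /(sP _ _ (valP x) (valP y)); case: (s _); case: (s _).
  exists (fun x => s (val x)); split=> x; apply: sN.
  - by rewrite sflag0E eqxx.
  - by rewrite sflag1E eqxx orbT.
  - by rewrite (sflag2E emb) eqxx orbT.
exists (fun a => if insub a is Some x then o x else false) => a b aP bP.
rewrite (insubT (fun c => c \in flags N) aP) (insubT (fun c => c \in flags N) bP).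
set x : sflag N := Sub a aP; set y : sflag N := Sub b bP.
rewrite -[a]/(val x) -[b]/(val y) sflag0E sflag1E (sflag2E emb) !(inj_eq val_inj).
by case/orP => [/orP[]|] /eqP->; rewrite ?o0 ?o1 ?o2; case: (o x).
Qed.

(** The rank bounds leave values at most 2 in the orientable case and at most 1 otherwise. Parity
    excludes 1 in the former, and 1-efficiency excludes spheres, projective planes, Klein bottles
    and all tori but the vertex links. *)
Lemma connected_euler : one_efficient T -> sflag N -> (forall x y, connect gen3 x y) ->
  surface_euler T N <= -1 \/ surface_euler T N = 0 /\ is_vertex_linking T N.
Proof.
move=> eff x0 conn; have sc := connected_surface x0 conn.
have cc := connected_const conn.
have [nsph nproj nklein tor] := eff N emb.
have or_or : (exists o, orientation s0 s1 s2 o) \/ (forall o, ~ orientation s0 s1 s2 o).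
  by have [|no] := pselect (exists o, orientation s0 s1 s2 o); [left | right => o oP; apply: no; exists o].
have lift_int (a b c k : nat) : (a + c <= b + k)%N -> a%:Z - b%:Z + c%:Z <= k%:Z by lia.
case: or_or => [[o oP]|no].
  have so : surface_orientable T N by apply/orientation_surface; exists o.
  have le2 : surface_euler T N <= 2.
    rewrite (surface_eulerE emb); apply: lift_int.
    by apply: (@euler_orientable _ _ _ _ (@s0K _ N) (@s1K _ N) (@s2K _ T N emb) (@s0x _ N)
      (@s1x _ N) (@s2x _ T N emb) (@s02 _ T N emb) (@s02x _ T N emb) cc o x0 oP).
  have := @euler_even _ _ _ _ (@s0K _ N) (@s1K _ N) (@s2K _ T N emb) (@s0x _ N)
      (@s2x _ T N emb) (@s02 _ T N emb) (@s02x _ T N emb) o oP.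
  have n2 : surface_euler T N <> 2 by move=> e; apply: nsph.
  have t0 : surface_euler T N = 0 -> is_vertex_linking T N by move=> e; apply: tor.
  have [n0|n0] := eqVneq (surface_euler T N) 0; first by right; split=> //; apply: t0.
  move=> ev; left; move: ev n2 n0 le2; rewrite (surface_eulerE emb).
  rewrite -/s0 -/s1 -/s2; move: (norbits s1 s2) (norbits s0 s2) (norbits s0 s1) => a b c.
  by clear; move=> ev n2 /eqP n0 le2; lia.
have so : ~ surface_orientable T N by move/orientation_surface => [o /no].
have le1 : surface_euler T N <= 1.
  rewrite (surface_eulerE emb); apply: lift_int.
  by apply: (@euler_nonorientable _ _ _ _ (@s0K _ N) (@s1K _ N) (@s2K _ T N emb) (@s0x _ N)
      (@s1x _ N) (@s2x _ T N emb) (@s02 _ T N emb) (@s02x _ T N emb) cc no).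
have n1 : surface_euler T N <> 1 by move=> e; apply: nproj.
have n0 : surface_euler T N <> 0 by move=> e; apply: nklein.
by left; move: n1 n0 le1; clear; lia.
Qed.

(** * Splitting off a connected component *)

Section Split.
Variable x0 : sflag N.

Definition in_comp (z : nflag t) : bool :=
  [exists y, connect gen3 x0 y && (nsval y == z)].

Lemma in_compE y : in_comp (nsval y) = connect gen3 x0 y.
Proof.
apply/existsP/idP => [[y' /andP[xy' /eqP/nsval_inj <-]] //|xy].
by exists y; rewrite xy eqxx.
Qed.

Lemma in_comp_step y y' : gen3 y y' -> in_comp (nsval y') = in_comp (nsval y).
Proof.
by move=> yy'; rewrite !in_compE -(same_connect_r gen3_sym (connect1 yy')).
Qed.

Lemma in_comp_move0 z : nvalid N z -> in_comp (move0 z) = in_comp z.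
Proof.
move=> /sflag_ex[y <-]; have <- : nsval (s0 y) = move0 (nsval y) by rewrite lift_moveE.
by apply: in_comp_step; rewrite gen3E; apply/or3P/Or31/eqxx.
Qed.

Lemma in_comp_move1 z : nvalid N z -> in_comp (move1 N z) = in_comp z.
Proof.
move=> /sflag_ex[y <-]; have <- : nsval (s1 y) = move1 N (nsval y) by rewrite lift_moveE.
by apply: in_comp_step; rewrite gen3E; apply/or3P/Or32/eqxx.
Qed.

Lemma in_comp_move2 z : nvalid N z -> in_comp (move2 T z) = in_comp z.
Proof.
move=> /sflag_ex[y <-]; have <- : nsval (s2 y) = move2 T (nsval y) by rewrite lift_moveE.
by apply: in_comp_step; rewrite gen3E; apply/or3P/Or33/eqxx.
Qed.

#[local] Opaque in_comp.

Definition third (f v : 'I_4) : 'I_4 := odflt ord0 [pick x | uniq [:: f; v; x]].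

Lemma third_uniq f v : v != f -> uniq [:: f; v; third f v].
Proof.
move=> vf; rewrite /third; case: pickP => [x xu|no]; first exact: xu.
have [x [y u]] := uniq2_complete vf; have {}u : uniq [:: f; v; x] by uq.
by have := no x; rewrite u.
Qed.

Definition arc_in j f v k : bool := in_comp (j, f, v, third f v, k).

Lemma arc_inE j f v x k : uniq [:: f; v; x] -> (k < narcs N j f v)%N ->
  arc_in j f v k = in_comp (j, f, v, x, k).
Proof.
move=> u kn; have vf : v != f by uq.
have u1 := third_uniq vf; rewrite /arc_in; set y := third f v in u1 *.
have [-> //|yx] := eqVneq y x.
have zv : nvalid N (j, f, v, x, k) by apply/andP.
by rewrite -(in_comp_move0 zv) /move0 (@fourthE f v x y) //; uq.
Qed.

Lemma arc_in_glue j f v k : v != f -> (k < narcs N j f v)%N ->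
  arc_in (nbr T j f) (glue T j f f) (glue T j f v) k = arc_in j f v k.
Proof.
move=> vf kn; have u := third_uniq vf.
have zv : nvalid N (j, f, v, third f v, k) by apply/andP.
rewrite (arc_inE u kn) -(in_comp_move2 zv) /move2.
apply: arc_inE; last by rewrite narcs_glue.
by rewrite -(uniq_glue T j f) in u.
Qed.

Lemma arc_in_tri j f g v k : v != f -> v != g -> (k < ntri N j v)%N ->
  arc_in j f v k = arc_in j g v k.
Proof.
move=> vf vg kt; have [->//|fg] := eqVneq f g.
have kn h : (k < narcs N j h v)%N by rewrite ltn_addr.
have u : uniq [:: f; v; g] by uq.
have u' := fourth_uniq u; set x := fourth f v g in u'.
have ux : uniq [:: f; v; x] by uq.
have ux' : uniq [:: g; v; x] by uq.
rewrite (arc_inE ux (kn f)) (arc_inE ux' (kn g)).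
have zv : nvalid N (j, f, v, x, k) by apply/andP; split=> //; uq.
have uxg : uniq [:: f; v; x; g] by uq.
by rewrite -(in_comp_move1 zv) (move1_tri uxg kt).
Qed.

Lemma arc_in_quad j f v a b i : uniq [:: f; v; a; b] -> (i < nquad_at N j f v)%N ->
  arc_in j f v (ntri N j v + i)%N =
  arc_in j b a (ntri N j a + (nquad_at N j f v - i).-1)%N.
Proof.
move=> u iq; have ba : nquad_at N j b a = nquad_at N j f v.
  by rewrite nquad_at_sym; apply/esym/nquad_at_compl.
have u1 : uniq [:: f; v; a] by uq.
have u2 : uniq [:: b; a; v] by uq.
have k1 : (ntri N j v + i < narcs N j f v)%N by rewrite ltn_add2l.
have k2 : (ntri N j a + (nquad_at N j f v - i).-1 < narcs N j b a)%N.
  by rewrite ltn_add2l ba; lia.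
rewrite (arc_inE u1 k1) (arc_inE u2 k2).
have zv : nvalid N (j, f, v, a, (ntri N j v + i)%N).
  by apply/andP; split; [uq | rewrite ltn_add2l].
by rewrite -(in_comp_move1 zv) (move1_quad _ _ _ u).
Qed.

#[local] Opaque arc_in.

Definition far (v : 'I_4) : 'I_4 := if v == ord0 then @Ordinal 4 1 isT else ord0.

Lemma farP v : v != far v.
Proof. by rewrite /far; case: (eqVneq v ord0) => [->|]. Qed.

(** The discs of [N] in the component of [x0]. Each disc is tested on one of its arcs: in the face
    [far v] for a triangle at [v], in the face opposite to vertex 0 for a quad. *)
Definition comp_coord : normal_coord t := NormalCoord
  (fun j v => (\sum_(k < ntri N j v) arc_in j (far v) v k)%N)
  (fun j Q => (\sum_(i < nquad N j Q)
     arc_in j ord0 (lift ord0 Q) (ntri N j (lift ord0 Q) + i))%N).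

Definition quads_in j f v : nat :=
  (\sum_(i < nquad_at N j f v) arc_in j f v (ntri N j v + i))%N.

(** Seen from the opposite edge, the same quads are numbered in reverse. *)
Lemma quads_in_compl j f v a b : uniq [:: f; v; a; b] -> quads_in j f v = quads_in j b a.
Proof.
move=> u; have ba : nquad_at N j b a = nquad_at N j f v.
  by rewrite nquad_at_sym; apply/esym/nquad_at_compl.
rewrite /quads_in ba (reindex_inj rev_ord_inj); apply: eq_bigr => i _.
rewrite (arc_in_quad u); last by have := ltn_ord (rev_ord i).
congr (arc_in _ _ _ (_ + _) : nat); rewrite /=; have := ltn_ord i; lia.
Qed.

Lemma quads_inE j f v : v != f -> quads_in j f v = nquad comp_coord j (quad_facing f v).
Proof.
move=> vf; have [a [b u]] : exists a b, uniq [:: f; v; a; b].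
  by apply: uniq2_complete; rewrite eq_sym.
have lift_facing w : w != ord0 -> lift ord0 (quad_facing ord0 w) = w.
  move=> w0; apply: val_inj; rewrite /= inordK; last by rewrite quad_type_lt // eq_sym.
  by rewrite /quad_type /= /bump leq0n; case: w w0 => -[|w] wl.
have base w : w != ord0 -> quads_in j ord0 w = nquad comp_coord j (quad_facing ord0 w).
  by move=> w0; rewrite /quads_in /= lift_facing // nquad_atE // eq_sym.
have [f0|f0] := eqVneq f ord0; first by rewrite f0 base // -f0.
have [v0|v0] := eqVneq v ord0.
  have u2 : uniq [:: b; a; f; v] by uq.
  by rewrite (quads_in_compl j u) (quads_in_compl j u2) v0 base // quad_facing_sym.
have [a0|a0] := eqVneq a ord0.
  have ba : b != ord0 by rewrite -a0; uq.
  have u2 : uniq [:: f; v; b; a] by uq.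
  by rewrite (quads_in_compl j u2) a0 base // -a0 (quad_facing_compl u).
have b0 : b = ord0.
  have := uniq4_cover ord0 u; rewrite !(eq_sym ord0) (negbTE f0) (negbTE v0) (negbTE a0).
  by move/eqP.
rewrite (quads_in_compl j u) b0 base //.
by rewrite -b0 (quad_facing_compl u) quad_facing_sym.
Qed.

(** Membership of a disc can be read on any of its arcs. As gluings preserve membership of arcs, the
    matching equations of the component follow. *)
Lemma narcs_comp j f v : v != f ->
  narcs comp_coord j f v = (\sum_(k < narcs N j f v) arc_in j f v k)%N.
Proof.
move=> vf; have fv : f != v by rewrite eq_sym.
have tE : ntri comp_coord j v = (\sum_(k < ntri N j v) arc_in j f v k)%N.
  apply: eq_bigr => k _; apply: (congr1 nat_of_bool).
  exact: arc_in_tri (farP v) vf (ltn_ord k).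
by rewrite /narcs (nquad_atE _ _ fv) -(quads_inE j vf) tE big_split_ord.
Qed.

Lemma sum_bool_le (n : nat) (P : nat -> bool) : (\sum_(k < n) P k <= n)%N.
Proof.
rewrite -[leqRHS]muln1 -[X in (_ <= X * 1)%N]card_ord -sum_nat_const.
by apply: leq_sum => i _; apply: leq_b1.
Qed.

Lemma narcs_comp_glue j f v : v != f ->
  narcs comp_coord (nbr T j f) (glue T j f f) (glue T j f v) = narcs comp_coord j f v.
Proof.
move=> vf; have vf' : glue T j f v != glue T j f f by rewrite (inj_eq perm_inj).
rewrite (narcs_comp _ vf') (narcs_comp _ vf) (narcs_glue emb j vf).
by apply: eq_bigr => k _; rewrite (arc_in_glue vf (ltn_ord k)).
Qed.

Lemma comp_emb : embedded_normal T comp_coord.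
Proof.
split=> [j Q Q' QQ'|j f v]; last exact: narcs_comp_glue.
by have [/= ->|/= ->] := emb.1 j Q Q' QQ'; [left | right]; rewrite big_ord0.
Qed.

Definition compl_coord : normal_coord t := NormalCoord
  (fun j v => (ntri N j v - ntri comp_coord j v)%N)
  (fun j Q => (nquad N j Q - nquad comp_coord j Q)%N).

Lemma ntri_comp j v : ntri N j v = (ntri comp_coord j v + ntri compl_coord j v)%N.
Proof. by rewrite subnKC // sum_bool_le. Qed.

Lemma nquad_comp j Q : nquad N j Q = (nquad comp_coord j Q + nquad compl_coord j Q)%N.
Proof. by rewrite subnKC // (sum_bool_le _ (fun i => arc_in _ _ _ (_ + i))). Qed.

End Split.
End Connected.

Lemma nquad_at_add (N N1 N2 : normal_coord t) j a b :
  (forall j Q, nquad N j Q = nquad N1 j Q + nquad N2 j Q)%N ->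
  nquad_at N j a b = (nquad_at N1 j a b + nquad_at N2 j a b)%N.
Proof. by move=> qD; rewrite /nquad_at -big_split; apply: eq_bigr. Qed.

Lemma narcs_add (N N1 N2 : normal_coord t) j f v :
  (forall j v, ntri N j v = ntri N1 j v + ntri N2 j v)%N ->
  (forall j Q, nquad N j Q = nquad N1 j Q + nquad N2 j Q)%N ->
  narcs N j f v = (narcs N1 j f v + narcs N2 j f v)%N.
Proof. by move=> tD qD; rewrite /narcs tD (nquad_at_add _ _ _ qD) addnACA. Qed.

Lemma normal_euler2_add (N N1 N2 : normal_coord t) :
  (forall j v, ntri N j v = ntri N1 j v + ntri N2 j v)%N ->
  (forall j Q, nquad N j Q = nquad N1 j Q + nquad N2 j Q)%N ->
  normal_euler2 T N = normal_euler2 T N1 + normal_euler2 T N2.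
Proof.
move=> tD qD; rewrite /normal_euler2.
have -> : (\sum_(e : ideal_edge T) edge_weight N (class_cell e) =
    \sum_(e : ideal_edge T) edge_weight N1 (class_cell e)
    + \sum_(e : ideal_edge T) edge_weight N2 (class_cell e))%N.
  rewrite -big_split; apply: eq_bigr => e _; rewrite /edge_weight /= addnACA.
  by congr addn; rewrite -big_split; apply: eq_bigr.
have -> : (\sum_j \sum_f \sum_(v | v != f) narcs N j f v =
    \sum_j \sum_f \sum_(v | v != f) narcs N1 j f v
    + \sum_j \sum_f \sum_(v | v != f) narcs N2 j f v)%N.
  rewrite -big_split; apply: eq_bigr => j _; rewrite -big_split; apply: eq_bigr => f _.
  by rewrite -big_split; apply: eq_bigr => v _; apply: narcs_add.
have -> : (\sum_j \sum_v ntri N j v = \sum_j \sum_v ntri N1 j v + \sum_j \sum_v ntri N2 j v)%N.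
  by rewrite -big_split; apply: eq_bigr => j _; rewrite -big_split; apply: eq_bigr.
have -> : (\sum_j \sum_Q nquad N j Q = \sum_j \sum_Q nquad N1 j Q + \sum_j \sum_Q nquad N2 j Q)%N.
  by rewrite -big_split; apply: eq_bigr => j _; rewrite -big_split; apply: eq_bigr.
by rewrite !PoszD; ring.
Qed.

Definition ndiscs (N : normal_coord t) : nat :=
  (\sum_j \sum_v ntri N j v + \sum_j \sum_Q nquad N j Q)%N.

Lemma ndiscs_gt0 (N : normal_coord t) j f v : v != f -> (0 < narcs N j f v)%N ->
  (0 < ndiscs N)%N.
Proof.
move=> vf; rewrite /narcs nquad_atE 1?eq_sym // /ndiscs => n0.
rewrite (bigD1 j) // (bigD1 v) //= [X in (_ + X)%N](bigD1 j) // (bigD1 (quad_facing f v)) //=.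
by move: n0; lia.
Qed.

(** Induction on the number of discs: a disconnected surface is the sum of the component of [x] and
    of a complement, both with fewer discs. The Euler characteristic is split by linearity of
    [normal_euler2], so the flags of the two parts are never compared with those of [N]. *)
Lemma normal_euler2_le0 (N : normal_coord t) : one_efficient T -> embedded_normal T N ->
  normal_euler2 T N <= 0 /\
  (normal_euler2 T N = 0 -> forall j Q, nquad N j Q = 0%N).
Proof.
move=> eff; have [n] := ubnP (ndiscs N); elim: n N => // n IH N Nn emb.
have [[x0]|noX] := pselect (inhabited (sflag N)); last first.
  have t0 j v : ntri N j v = 0%N.
    apply/eqP; rewrite -leqn0 leqNgt; apply/negP => t0.
    have /sflag_ex[x _] : nvalid N (j, far v, v, third (far v) v, 0%N).
      apply/andP; split; first by apply/third_uniq/farP.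
      by rewrite ltn_addr.
    by apply: noX.
  have q0 j Q : nquad N j Q = 0%N.
    apply/eqP; rewrite -leqn0 leqNgt; apply/negP => q0.
    have lQ : lift ord0 Q != ord0 by rewrite eq_sym neq_lift.
    have /sflag_ex[x _] : nvalid N (j, ord0, lift ord0 Q, third ord0 (lift ord0 Q), 0%N).
      apply/andP; split; first by apply/third_uniq.
      by rewrite ltn_addl // nquad_atE 1?eq_sym // quad_facing_lift.
    by apply: noX.
  split=> //; rewrite /normal_euler2.
  have w0 x : edge_weight N x = 0%N.
    by rewrite /edge_weight !big1 // => *; rewrite ?t0 ?q0.
  have n0 j f v : narcs N j f v = 0%N.
    by rewrite /narcs t0 /nquad_at big1 // => *; rewrite q0.
  rewrite !big1 // => *; rewrite ?w0 // big1 // => *; rewrite ?t0 ?q0 //.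
  by rewrite big1 // => *; rewrite n0.
have [conn|/existsNP[x /existsNP[y xy]]] := pselect (forall x y, connect (gen3 emb) x y).
  have [lt0|[e0 [v [_ q0]]]] := connected_euler eff x0 conn.
    by rewrite -(surface_euler2 emb); split; move: lt0; lia.
  by rewrite -(surface_euler2 emb) e0 mulr0; split.
have tD := ntri_comp emb x; have qD := nquad_comp emb x.
set N1 := comp_coord emb x in tD qD *; set N2 := compl_coord emb x in tD qD *.
have emb1 : embedded_normal T N1 := comp_emb emb x.
have nD := narcs_add _ _ _ tD qD.
have emb2 : embedded_normal T N2.
  split=> [j Q Q' QQ'|j f v vf].
    by have [q0|q0] := emb.1 j Q Q' QQ'; [left | right]; move: (qD j Q) (qD j Q'); lia.
  by have := narcs_glue emb j vf; rewrite !nD (narcs_glue emb1 j vf) => /addnI.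
have nN1 j f v : v != f -> narcs N1 j f v = (\sum_(k < narcs N j f v) arc_in emb x j f v k)%N.
  exact: narcs_comp.
have arc_z z j f v a k : nsval z = (j, f, v, a, k) ->
    [/\ v != f, (k < narcs N j f v)%N & arc_in emb x j f v k = connect (gen3 emb) x z].
  move=> zE; have := nsval_valid z; rewrite zE => /andP[u kn]; split=> //; first by uq.
  by rewrite (arc_inE emb x u kn) -zE in_compE.
have N1_gt0 : (0 < ndiscs N1)%N.
  case xE : (nsval x) => [[[[j f] v] a] k]; have [vf kn ak] := arc_z _ _ _ _ _ _ xE.
  apply: (@ndiscs_gt0 _ j f v vf); rewrite (nN1 _ _ _ vf) (bigD1 (Ordinal kn)) //= ak.
  by rewrite connect0.
have N2_gt0 : (0 < ndiscs N2)%N.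
  case yE : (nsval y) => [[[[j f] v] a] k]; have [vf kn ak] := arc_z _ _ _ _ _ _ yE.
  apply: (@ndiscs_gt0 _ j f v vf).
  suff : (narcs N1 j f v < narcs N j f v)%N by rewrite nD; lia.
  rewrite (nN1 _ _ _ vf) -[ltnRHS]muln1 -[X in (_ < X * 1)%N]card_ord -sum_nat_const.
  rewrite (bigD1 (Ordinal kn)) //= [ltnRHS](bigD1 (Ordinal kn)) //= ak (negbTE (introN idP xy)).
  by rewrite add0n ltnS; apply: leq_sum => i _; apply: leq_b1.
have dD : ndiscs N = (ndiscs N1 + ndiscs N2)%N.
  rewrite /ndiscs addnACA; congr (_ + _)%N.
    by rewrite -big_split; apply: eq_bigr => j _; rewrite -big_split; apply: eq_bigr.
  by rewrite -big_split; apply: eq_bigr => j _; rewrite -big_split; apply: eq_bigr.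
have n1 : (ndiscs N1 < n)%N by lia.
have n2 : (ndiscs N2 < n)%N by lia.
have [le1 z1] := IH N1 n1 emb1; have [le2 z2] := IH N2 n2 emb2.
rewrite (normal_euler2_add tD qD); split; first by lia.
by move=> e j Q; rewrite qD z1 ?z2 //; lia.
Qed.
End Components.

(** * The formal Euler characteristic *)

Lemma big_vertices (R : Type) (idx : R) (op : Monoid.com_law idx) (F : 'I_4 -> R)
    a b c d : uniq [:: a; b; c; d] ->
  \big[op/idx]_v F v = op (F a) (op (F b) (op (F c) (F d))).
Proof.
move=> u; rewrite (bigD1 a) // (bigD1 b) /=; last by uq.
rewrite (bigD1 c) /=; last by apply/andP; split; uq.
rewrite (bigD1 d) /=; last by do 2?[apply/andP; split]; uq.
rewrite big1 ?Monoid.mulm1 // => v /andP[/andP[/andP[/negbTE va /negbTE vb] /negbTE vc] /negbTE vd].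
by have := uniq4_cover v u; rewrite va vb vc vd.
Qed.

Lemma big_other_vertices (R : Type) (idx : R) (op : Monoid.com_law idx) (F : 'I_4 -> R)
    a b c d : uniq [:: a; b; c; d] ->
  \big[op/idx]_(v | v != a) F v = op (F b) (op (F c) (F d)).
Proof.
move=> u; rewrite (bigD1 b) /=; last by uq.
rewrite (bigD1 c) /=; last by apply/andP; split; uq.
rewrite (bigD1 d) /=; last by do 2?[apply/andP; split]; uq.
rewrite big1 ?Monoid.mulm1 // => v /andP[/andP[/andP[/negbTE va /negbTE vb] /negbTE vc] /negbTE vd].
by have := uniq4_cover v u; rewrite va vb vc vd.
Qed.

Lemma faces_quad_facing (a b c d : 'I_4) A : uniq [:: a; b; c; d] ->
  faces (quad_facing a b) A = (A == [set a; b]) || (A == [set c; d]).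
Proof.
move=> u; have ab : a != b by uq.
have := facesP (quad_facing a b) ab; rewrite eqxx /faces -(setC_pair u).
case/orP=> /eqP->; first by [].
by rewrite finset.setCK orbC.
Qed.

Section FormalEuler.
Variables (t : nat) (T : triangulation t).
Implicit Types (x : ideal_edge T -> int) (y : 'I_t -> int).

Definition edge_value x (j : 'I_t) (a b : 'I_4) : int := cell_value x (j, [set a; b]).

Lemma edge_value_sym x j a b : edge_value x j a b = edge_value x j b a.
Proof. by rewrite /edge_value finset.setUC. Qed.

Lemma edge_value_glue x j f a b : uniq [:: f; a; b] ->
  edge_value x (nbr T j f) (glue T j f a) (glue T j f b) = edge_value x j a b.
Proof. by move=> u; apply/cell_value_glued/glued_pair. Qed.

Lemma edge_valueE x j a b : edge_value x j a b = cell_value x (j, [set a; b]).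
Proof. by []. Qed.

Lemma E_spanE x j a b c d : uniq [:: a; b; c; d] ->
  E_span x j (quad_facing a b) = edge_value x j a b + edge_value x j c d.
Proof.
move=> u; set Q := quad_facing a b.
transitivity (\sum_(A : {set 'I_4} | faces Q A) cell_value x (j, A)).
  rewrite /E_span summxE /cell_value.
  under [RHS]eq_bigr do rewrite big_mkcond /=.
  rewrite exchange_big /=; apply: eq_bigr => e _; rewrite !mxE.
  rewrite -sum1_card (big_morph Posz PoszD (erefl _)) big_distrr /=.
  rewrite big_mkcond [RHS]big_mkcond /=; apply: eq_bigr => A _; rewrite inE.
  by case: (_ \in _); case: (faces Q A); rewrite ?mulr1.
have abcd : [set a; b] != [set c; d] by rewrite eq_pair; uq.
rewrite (bigD1 [set a; b]) /=; last by rewrite (faces_quad_facing _ u) eqxx.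
congr (_ + _).
rewrite (big_pred1 [set c; d]) // => A; rewrite (faces_quad_facing A u).
by have [->|_] := eqVneq A [set a; b]; rewrite /= ?(negbTE abcd) ?andbT.
Qed.

#[global] Opaque edge_value.

Lemma T_spanE y j Q : T_span y j Q = y j.
Proof.
rewrite /T_span summxE (bigD1 j) //= !mxE eqxx mulr1 big1 ?addr0 // => i ij.
by rewrite !mxE eq_sym (negbTE ij) mulr0.
Qed.

(** The intended value of [formal_euler] at [w + E_span x + T_span y]; the choice made by [xget] is
    harmless once this is shown to depend only on the vector. *)
Definition euler x y : int := - 2 * (\sum_e x e) - \sum_j y j.

Lemma sum_edge_weight (N : normal_coord t) (x : ideal_edge T -> int) :
  (forall e, (edge_weight N (class_cell e))%:Z = x e) ->
  (\sum_(e : ideal_edge T) edge_weight N (class_cell e))%N%:Z = \sum_e x e.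
Proof. by move=> wx; rewrite (big_morph Posz PoszD (erefl _)); apply: eq_bigr. Qed.

(** * Consequences of the vertex links being tori *)

Section Torus.
Hypothesis bdry : torus_boundary T.

Lemma narcs_link (v : ideal_vertex T) j f a :
  narcs (vertex_link v) j f a = ((j, [set a]) \in val v).
Proof. by rewrite /narcs /nquad_at big1 // addn0. Qed.

Lemma vertex_class_glued (v : ideal_vertex T) j f a : a != f ->
  ((nbr T j f, [set glue T j f a]) \in val v) = ((j, [set a]) \in val v).
Proof.
by move=> af; apply/esym/(cell_class_glued v); apply: glued_single; rewrite eq_sym.
Qed.

Lemma vertex_link_emb (v : ideal_vertex T) : embedded_normal T (vertex_link v).
Proof.
split=> [j Q Q' _|j f a af]; first by left.
by rewrite !narcs_link vertex_class_glued.
Qed.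

(** In a triangulated torus 2E = 3F, so V - E + F = 0 becomes 2V = F. The vertices of the link are
    its intersections with ideal edges, its faces the corners of tetrahedra in the class. *)
Lemma link_euler (v : ideal_vertex T) :
  (2 * (\sum_(e : ideal_edge T) edge_weight (vertex_link v) (class_cell e)) =
   \sum_j \sum_a ((j, [set a]) \in val v))%N.
Proof.
have [_ [_ e0]] := bdry v.
have := surface_euler2 (vertex_link_emb v); rewrite e0 mulr0 /normal_euler2.
have -> : (\sum_j \sum_f \sum_(a | a != f) narcs (vertex_link v) j f a =
    3 * \sum_j \sum_(a : 'I_4) ((j, [set a]) \in val v))%N.
  rewrite big_distrr; apply: eq_bigr => j _; rewrite (exchange_big_dep xpredT) //= big_distrr.
  apply: eq_bigr => a _; under eq_bigr do rewrite narcs_link.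
  rewrite sum_nat_const; congr muln.
  transitivity #|predC1 a|; last by rewrite cardC1 card_ord.
  by apply: eq_card => b; rewrite !inE eq_sym.
have q0 : (\sum_j \sum_Q nquad (vertex_link v) j Q)%N = 0%N by rewrite big1 // => j _; rewrite big1.
rewrite q0 addn0; have gen (a b : nat) : 0 = 2 * a%:Z - (3 * b)%N%:Z + 2 * b%:Z -> (2 * a = b)%N.
  by lia.
exact: gen.
Qed.

(** [p] is a combination of the indicators of the ideal vertices, and the identity is the
    corresponding combination of [link_euler]. *)
Lemma vertex_sum (p : 'I_t -> 'I_4 -> int) :
  (forall j f a, a != f -> p (nbr T j f) (glue T j f a) = p j a) ->
  2 * (\sum_(e : ideal_edge T) \sum_(a in (class_cell e).2) p (class_cell e).1 a) =
  \sum_j \sum_a p j a.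
Proof.
move=> pP.
pose phi (x : cell t) : int := \sum_(a in x.2) p x.1 a.
have [P PP] : exists P : ideal_vertex T -> int,
    forall (C : ideal_vertex T) (z : cell t), z \in val C -> phi z = P C.
  apply: cell_function => -[j A] _ /= /eqP/cards1P[a ->] /existsP[f /= /andP[fa /eqP->]].
  rewrite imset_set1 /phi /= !big_set1 pP //.
  by move: fa; rewrite inE eq_sym.
have pE j a : p j a = \sum_(C : ideal_vertex T) P C * ((j, [set a]) \in val C)%:Z.
  have [C aC] := cell_class_ex T (x := (j, [set a])) (cards1 a).
  have := PP C _ aC; rewrite /phi /= big_set1 => ->.
  rewrite (bigD1 C) //= aC mulr1 big1 ?addr0 // => C' C'C.
  case aC' : (_ \in _); last by rewrite mulr0.
  by rewrite (cell_class_uniq aC' aC) eqxx in C'C.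
have -> : \sum_j \sum_a p j a =
    \sum_(C : ideal_vertex T) P C * (\sum_j \sum_a ((j, [set a]) \in val C))%N%:Z.
  under [RHS]eq_bigr do rewrite (big_morph Posz PoszD (erefl _)) big_distrr /=.
  rewrite [RHS]exchange_big; apply: eq_bigr => j _ /=.
  under [RHS]eq_bigr do rewrite (big_morph Posz PoszD (erefl _)) big_distrr /=.
  by rewrite [RHS]exchange_big; apply: eq_bigr => a _.
have -> : \sum_(e : ideal_edge T) \sum_(a in (class_cell e).2) p (class_cell e).1 a =
    \sum_(C : ideal_vertex T) P C *
      (\sum_(e : ideal_edge T) edge_weight (vertex_link C) (class_cell e))%N%:Z.
  under [RHS]eq_bigr do rewrite (big_morph Posz PoszD (erefl _)) big_distrr /=.
  rewrite [RHS]exchange_big; apply: eq_bigr => e _ /=.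
  rewrite (eq_bigr _ (fun a _ => pE (class_cell e).1 a)) exchange_big /=.
  apply: eq_bigr => C _; rewrite -big_distrr /=; congr (_ * _).
  rewrite /edge_weight /= [X in (_ + X)%N]big1 // addn0.
  by rewrite (big_morph Posz PoszD (erefl _)).
rewrite big_distrr; apply: eq_bigr => C _ /=.
by rewrite mulrCA -link_euler PoszM.
Qed.

(** [vertex_sum] for p = 1: every edge has two ends and every tetrahedron four vertices. *)
Lemma card_ideal_edges : #|{: ideal_edge T}| = t.
Proof.
have := @vertex_sum (fun _ _ => 1) (fun _ _ _ _ => erefl).
have e2 (e : ideal_edge T) : \sum_(a in (class_cell e).2) (1 : int) = 2.
  by rewrite sumr_const (cell_class_card (class_cellP e)).
have j4 (j : 'I_t) : \sum_(a : 'I_4) (1 : int) = 4 by rewrite sumr_const card_ord.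
rewrite (eq_bigr _ (fun e _ => e2 e)) (eq_bigr _ (fun j _ => j4 j)).
rewrite !sumr_const card_ord -(mulr_natr 2) -(mulr_natr 4) !natz.
by move: #|_| => n; lia.
Qed.

Definition star_value x j v : int := \sum_(a | a != v) edge_value x j v a.

Lemma star_valueE x j v a b c : uniq [:: v; a; b; c] ->
  star_value x j v = edge_value x j v a + edge_value x j v b + edge_value x j v c.
Proof. by move=> u; rewrite /star_value (big_other_vertices _ _ u) /= addrA. Qed.

Lemma pair_edge_value (p : 'I_t -> 'I_4 -> int) x :
  (forall j v a, v != a -> p j v + p j a = 2 * edge_value x j v a) ->
  \sum_(e : ideal_edge T) \sum_(a in (class_cell e).2) p (class_cell e).1 a =
  2 * \sum_e x e.
Proof.
move=> px; rewrite big_distrr; apply: eq_bigr => e _ /=.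
have := class_cellP e; have := cell_class_card (class_cellP e).
case: (class_cell e) => j A /= /eqP/cards2P[v [a [va ->]]] je.
by rewrite big_setU1 ?inE //= big_set1 px // edge_valueE (cell_valueE x je).
Qed.

Lemma sum_star_value x j (y : int) : (forall Q, E_span x j Q = y) ->
  \sum_v star_value x j v = 6 * y.
Proof.
move=> xy; pose o1 := @Ordinal 4 1 isT; pose o2 := @Ordinal 4 2 isT; pose o3 := @Ordinal 4 3 isT.
have u : uniq [:: ord0; o1; o2; o3] by [].
rewrite (big_vertices _ _ u) (star_valueE _ _ u) (@star_valueE _ _ o1 ord0 o2 o3) //.
rewrite (@star_valueE _ _ o2 ord0 o1 o3) // (@star_valueE _ _ o3 ord0 o1 o2) //=.
have e1 := E_spanE x j u; have e2 := @E_spanE x j ord0 o2 o1 o3 isT.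
have e3 := @E_spanE x j ord0 o3 o1 o2 isT; rewrite !xy in e1 e2 e3.
have s := edge_value_sym x j.
move: (s o1 ord0) (s o2 ord0) (s o3 ord0) (s o2 o1) (s o3 o1) (s o3 o2) e1 e2 e3.
clear; lia.
Qed.

(* If the sum of x over opposite edges is constant on each tetrahedron, 2 x is
   the sum of a function p on the ideal vertices over the ends of the edges: a
   combination of vertex links, which are tori. *)
Lemma euler_wd x y : E_span x + T_span y = 0 -> euler x y = 0.
Proof.
move=> /matrixP xy0.
have xy j Q : E_span x j Q = - y j.
  by have := xy0 j Q; rewrite !mxE T_spanE => /eqP; rewrite addr_eq0 => /eqP.
(* Opposite edges add up to - y j, so p j v = x(va) + x(vb) - x(ab) for any face vab at [v]; hence
   [p] is invariant under gluings. *)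
pose p j v := star_value x j v + y j.
have opp j a b c d : uniq [:: a; b; c; d] -> edge_value x j a b + edge_value x j c d = - y j.
  by move=> u; rewrite -(E_spanE x j u) xy.
have pE j v a b f : uniq [:: v; a; b; f] ->
    p j v = edge_value x j v a + edge_value x j v b - edge_value x j a b.
  move=> u; rewrite /p (star_valueE x j u).
  by have := opp j v f a b ltac:(uq); lia.
have p_glue j f v : v != f -> p (nbr T j f) (glue T j f v) = p j v.
  move=> vf; have [a [b u]] := uniq2_complete vf.
  have u1 : uniq [:: v; a; b; f] by uq.
  have g1 := @edge_value_glue x j f v a ltac:(uq).
  have g2 := @edge_value_glue x j f v b ltac:(uq).
  have g3 := @edge_value_glue x j f a b ltac:(uq).
  have u2 := u1; rewrite -(uniq_glue T j f) in u2.
  by rewrite (pE _ _ _ _ _ u1) (pE _ _ _ _ _ u2) g1 g2 g3.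
have p_pair j v a : v != a -> p j v + p j a = 2 * edge_value x j v a.
  move=> va; have [b [f u]] := uniq2_complete va.
  have u2 : uniq [:: a; v; b; f] by uq.
  rewrite (pE _ _ _ _ _ u) (pE _ _ _ _ _ u2) (edge_value_sym x j a v); ring.
have := vertex_sum p_glue; rewrite (pair_edge_value p_pair).
have -> : \sum_j \sum_v p j v = - 2 * \sum_j y j.
  rewrite big_distrr; apply: eq_bigr => j _; rewrite big_split /= (sum_star_value (xy j)).
  by rewrite sumr_const card_ord -mulr_natr natz; lia.
by rewrite /euler; lia.
Qed.

(** [F] gives the quads of an embedded normal surface with [K - star_value x j v - y j] triangles at
    each corner. The number of arcs then depends only on the values of [x] on the edges of the face,
    which yields the matching equations. The term [K] stands for copies of all vertex links; it
    makes the triangle coordinates nonnegative and does not affect the Euler characteristic. *)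
Lemma euler_embedded x y (F : quad_vector t) : one_efficient T ->
  F = E_span x + T_span y -> (forall j Q, 0 <= F j Q) ->
  (forall j Q Q', Q != Q' -> F j Q = 0 \/ F j Q' = 0) ->
  euler x y <= 0 /\ (euler x y = 0 -> F = 0).
Proof.
move=> eff FE F0 Femb.
have Fxy j a b c d : uniq [:: a; b; c; d] ->
    F j (quad_facing a b) = edge_value x j a b + edge_value x j c d + y j.
  by move=> u; rewrite FE !mxE T_spanE (E_spanE x j u).
pose K : int := \sum_j \sum_v `|star_value x j v + y j|.
have K_ge j v : 0 <= K - star_value x j v - y j.
  suff : star_value x j v + y j <= K by lia.
  rewrite /K (bigD1 j) //= (bigD1 v) //=; apply: le_trans (ler_norm _) _.
  by rewrite -addrA lerDl addr_ge0 ?sumr_ge0 // => *; rewrite ?sumr_ge0.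
pose N := NormalCoord (fun j v => `|(K - star_value x j v - y j)%R|%N) (fun j Q => `|F j Q|%N).
have tE j v : (ntri N j v)%:Z = K - star_value x j v - y j by rewrite /= gez0_abs.
have qE j Q : (nquad N j Q)%:Z = F j Q by rewrite /= gez0_abs.
have nE j f v a b : uniq [:: f; v; a; b] ->
    (narcs N j f v)%:Z = K - edge_value x j v a - edge_value x j v b + edge_value x j a b.
  move=> u; have fv : f != v by uq.
  have u2 : uniq [:: v; f; a; b] by uq.
  rewrite /narcs PoszD tE (nquad_atE N j fv) qE (Fxy j _ _ _ _ u) (star_valueE x j u2).
  by rewrite (edge_value_sym x j f v); ring.
have emb : embedded_normal T N.
  split=> [j Q Q' QQ'|j f v vf].
    by have [F1|F1] := Femb j Q Q' QQ'; [left | right]; rewrite /= F1.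
  have [a [b u]] : exists a b, uniq [:: f; v; a; b] by apply: uniq2_complete; rewrite eq_sym.
  have g1 := @edge_value_glue x j f v a ltac:(uq).
  have g2 := @edge_value_glue x j f v b ltac:(uq).
  have g3 := @edge_value_glue x j f a b ltac:(uq).
  have u2 := u; rewrite -(uniq_glue T j f) in u2.
  by apply/eqP; rewrite -eqz_nat (nE _ _ _ _ _ u) (nE _ _ _ _ _ u2) g1 g2 g3.
clearbody N; have [] := normal_euler2_le0 eff emb.
(* The surface meets the edge [e] in 2 K - 2 x e points; the contributions of [K] cancel because
   there are as many ideal edges as tetrahedra. *)
have -> : normal_euler2 T N = 2 * euler x y.
  rewrite /normal_euler2 (sum_edge_weight (x := fun e => 2 * K - 2 * x e)); last first.
    move=> e; have := class_cellP e; have := cell_class_card (class_cellP e).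
    case: (class_cell e) => j A /= /eqP/cards2P[v [a [va ->]]] je.
    have [f [b u]] := uniq2_complete va.
    have u1 : uniq [:: f; v; a] by uq.
    rewrite (edge_weightE N j u1) PoszD (nE j f v a b) ?(nE j f a v b); [|uq..].
    have <- : edge_value x j v a = x e by rewrite edge_valueE (cell_valueE x je).
    by rewrite (edge_value_sym x j a v); ring.
  have sumZ (I : finType) (P : pred I) (G : I -> nat) :
      (\sum_(i | P i) G i)%N%:Z = \sum_(i | P i) (G i)%:Z.
    exact: (big_morph Posz PoszD (erefl _)).
  have per_j j : 2 * ((\sum_v ntri N j v)%N%:Z + (\sum_Q nquad N j Q)%N%:Z)
      - (\sum_f \sum_(v | v != f) narcs N j f v)%N%:Z = - 4 * K - 2 * y j.
    pose o1 := @Ordinal 4 1 isT; pose o2 := @Ordinal 4 2 isT; pose o3 := @Ordinal 4 3 isT.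
    have u0 : uniq [:: ord0; o1; o2; o3] by [].
    have u1 : uniq [:: o1; ord0; o2; o3] by [].
    have u2 : uniq [:: o2; ord0; o1; o3] by [].
    have u3 : uniq [:: o3; ord0; o1; o2] by [].
    have := nE j; move: (narcs N j) => m mE.
    rewrite (big_quad_types _ _ u0) !(big_vertices _ _ u0) (big_other_vertices _ _ u0).
    rewrite (big_other_vertices _ _ u1) (big_other_vertices _ _ u2) (big_other_vertices _ _ u3).
    rewrite /= !PoszD !tE !qE.
    rewrite (Fxy j _ _ _ _ u0) (Fxy j ord0 o2 o1 o3 isT) (Fxy j ord0 o3 o1 o2 isT).
    rewrite (star_valueE _ _ u0) (star_valueE _ _ u1) (star_valueE _ _ u2) (star_valueE _ _ u3).
    rewrite (mE ord0 o1 o2 o3 isT) (mE ord0 o2 o1 o3 isT) (mE ord0 o3 o1 o2 isT).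
    rewrite (mE o1 ord0 o2 o3 isT) (mE o1 o2 ord0 o3 isT) (mE o1 o3 ord0 o2 isT).
    rewrite (mE o2 ord0 o1 o3 isT) (mE o2 o1 ord0 o3 isT) (mE o2 o3 ord0 o1 isT).
    rewrite (mE o3 ord0 o1 o2 isT) (mE o3 o1 ord0 o2 isT) (mE o3 o2 ord0 o1 isT).
    have s := edge_value_sym x j.
    move: (s o1 ord0) (s o2 ord0) (s o3 ord0) (s o2 o1) (s o3 o1) (s o3 o2).
    clear; lia.
  have all_j : 2 * (\sum_j \sum_v ntri N j v + \sum_j \sum_Q nquad N j Q)%N%:Z
      - (\sum_j \sum_f \sum_(v | v != f) narcs N j f v)%N%:Z =
      - 4 * K * t%:Z - 2 * \sum_j y j.
    rewrite PoszD !sumZ -big_split /= big_distrr -sumrB /=.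
    rewrite (eq_bigr _ (fun j _ => per_j j)) sumrB sumr_const card_ord -[_ *+ t]mulr_natr [t%:R]natz.
    by rewrite -big_distrr.
  rewrite sumrB sumr_const card_ideal_edges -(mulr_natr (2 * K)) [t%:R]natz -big_distrr /=.
  have fin (m n sx sy k : int) : 2 * m - n = - 4 * K * k - 2 * sy ->
      2 * (2 * K * k - 2 * sx) - n + 2 * m = 2 * (- 2 * sx - sy) by lia.
  exact: fin all_j.
move=> le0 eq0; split; first by lia.
move=> e0; apply/matrixP => j Q; rewrite mxE -qE eq0 //; lia.
Qed.
End Torus.
End FormalEuler.

(** * Dickson's lemma and convergence *)

(** Induction on the list of compared coordinates. Given a finite set [H] for the shorter list, a
    vector whose coordinate [i] is at least those of [H] dominates an element of [H]; the others
    fall into finitely many slices f i = c, each handled by the induction hypothesis. *)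
Lemma dickson (I : finType) (l : seq I) (P : {ffun I -> nat} -> Prop) :
  exists H : seq {ffun I -> nat}, (forall h, h \in H -> P h) /\
    forall f, P f -> exists2 h, h \in H & forall i, i \in l -> (h i <= f i)%N.
Proof.
elim: l P => [|i l IH] P.
  have [[f Pf]|no] := pselect (exists f, P f); last first.
    by exists [::]; split=> // f Pf; case: no; exists f.
  exists [:: f]; split=> [h|g _]; first by rewrite inE => /eqP->.
  by exists f; rewrite ?inE.
have [H [HP Hle]] := IH P.
have [Hc HcP] := choice (fun c => IH (fun f => P f /\ f i = c)).
pose B := (\max_(h <- H) h i)%N.
exists (H ++ flatten [seq Hc c | c <- iota 0 B]); split=> [h|f Pf].
  rewrite mem_cat => /orP[/HP //|/flattenP[_ /mapP[c _ ->]]].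
  by case: (HcP c) => + _ => /[apply] -[].
have [h hH hf] := Hle f Pf.
have [hi|fi] := leqP (h i) (f i).
  by exists h => [|k]; rewrite ?mem_cat ?hH // inE => /orP[/eqP-> //|/hf].
have [h' h'H h'f] := (HcP (f i)).2 f (conj Pf erefl).
exists h' => [|k].
  rewrite mem_cat; apply/orP; right; apply/flattenP; exists (Hc (f i)) => //.
  apply: map_f; rewrite mem_iota add0n; apply: leq_trans fi _.
  exact: (@leq_bigmax_seq _ H xpredT (fun g : {ffun I -> nat} => g i) h hH isT).
by rewrite inE => /orP[/eqP->|/h'f //]; rewrite ((HcP (f i)).1 h' h'H).2.
Qed.

Section Convergence.
Variables (t : nat) (T : triangulation t).
Hypotheses (bdry : torus_boundary T) (eff : one_efficient T).

Lemma E_spanD (x x' : ideal_edge T -> int) :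
  E_span (fun e => x e + x' e) = E_span x + E_span x'.
Proof. by rewrite /E_span -big_split; apply: eq_bigr => e _; rewrite scalerDl. Qed.

Lemma E_spanZ k (x : ideal_edge T -> int) : E_span (fun e => k * x e) = k *: E_span x.
Proof. by rewrite /E_span scaler_sumr; apply: eq_bigr => e _; rewrite scalerA. Qed.

Lemma T_spanD (y y' : 'I_t -> int) : T_span (fun j => y j + y' j) = T_span y + T_span y'.
Proof. by apply/matrixP => j Q; rewrite mxE !T_spanE. Qed.

Lemma T_spanZ k (y : 'I_t -> int) : T_span (fun j => k * y j) = k *: T_span y.
Proof. by apply/matrixP => j Q; rewrite mxE !T_spanE. Qed.

(** Well-definedness extended by linearity. The factor [k] is 1 for [formal_eulerE] and 2 for spinal
    surfaces, where explicit coefficients exist for the doubled quad vector. *)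
Lemma euler_sub (x x' : ideal_edge T -> int) (y y' : 'I_t -> int) k :
  k *: (E_span x + T_span y) = E_span x' + T_span y' -> k * euler x y = euler x' y'.
Proof.
move=> eq; have := @euler_wd _ T bdry (fun e => k * x e - x' e) (fun j => k * y j - y' j).
have -> : (fun e => k * x e - x' e) = (fun e => k * x e + (-1) * x' e).
  by apply/funext => e; rewrite mulN1r.
have -> : (fun j => k * y j - y' j) = (fun j => k * y j + (-1) * y' j).
  by apply/funext => e; rewrite mulN1r.
rewrite E_spanD T_spanD !E_spanZ !T_spanZ addrACA -!scalerDr eq scaleN1r subrr => /(_ erefl).
rewrite /euler !big_split /= -!mulr_sumr => e0.
have fin (A B C D : int) : -2 * (k * A + -1 * C) - (k * B + -1 * D) = 0 ->
    k * (-2 * A - B) = -2 * C - D by lia.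
exact: fin e0.
Qed.

Lemma formal_eulerE w (x : ideal_edge T -> int) (y : 'I_t -> int) :
  formal_euler T w (w + E_span x + T_span y) = euler x y.
Proof.
apply: xget_unique => [|k [x' [y' [eq ->]]]]; first by exists x, y.
have := @euler_sub x x' y y' 1; rewrite mul1r => -> //.
by rewrite scale1r; apply: (addrI w); rewrite !addrA.
Qed.

Lemma cosetD w (S F : quad_vector t) : coset T w S -> coset T 0 F ->
  coset T w (S + F) /\
  formal_euler T w (S + F) = formal_euler T w S + formal_euler T 0 F.
Proof.
move=> [x [y ->]] [x' [y' ->]].
have -> : w + E_span x + T_span y + (0 + E_span x' + T_span y') =
    w + E_span (fun e => x e + x' e) + T_span (fun j => y j + y' j).
  by rewrite E_spanD T_spanD add0r !addrA (addrAC (w + _)).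
split; first by exists (fun e => x e + x' e), (fun j => y j + y' j).
rewrite !formal_eulerE /euler !big_split /=.
have fin (A B C D : int) : -2 * (A + C) - (B + D) = (-2 * A - B) + (-2 * C - D) by lia.
exact: fin.
Qed.

Lemma cosetB w (S S' : quad_vector t) : coset T w S -> coset T w S' -> coset T 0 (S - S').
Proof.
move=> [x [y ->]] [x' [y' ->]].
exists (fun e => x e + (-1) * x' e), (fun j => y j + (-1) * y' j).
rewrite E_spanD T_spanD E_spanZ T_spanZ !scaleN1r add0r; apply/matrixP => j Q.
by rewrite !mxE; ring.
Qed.

Definition nonneg (S : quad_vector t) := forall j Q, 0 <= S j Q.

Definition tet_product (S S' : quad_vector t) (j : 'I_t) : int :=
  S j 0 * S' j 1 + S j 1 * S' j 2 + S j 2 * S' j 0.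

(** The sum of ab + bc + ca over the tetrahedra, which is the quadratic part of the degree bound
    from [qlbound_J_laurent]. *)
Definition double_arcs (S : quad_vector t) : int := \sum_j tet_product S S j.

Lemma double_arcs_ge0 S : nonneg S -> 0 <= double_arcs S.
Proof. by move=> S0; apply: sumr_ge0 => j _; rewrite !addr_ge0 ?mulr_ge0. Qed.

Lemma double_arcsD S F : nonneg S -> nonneg F ->
  double_arcs S + double_arcs F <= double_arcs (S + F).
Proof.
move=> S0 F0; rewrite /double_arcs -big_split; apply: ler_sum => j _.
rewrite /tet_product !mxE.
have m Q Q' : 0 <= S j Q * F j Q' by rewrite mulr_ge0.
by move: (m 0 1) (m 1 2) (m 2 0) (m 1 0) (m 2 1) (m 0 2) => /=; lia.
Qed.

Lemma double_arcsZ (n : nat) S : double_arcs (n%:Z *: S) = n%:Z ^+ 2 * double_arcs S.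
Proof.
rewrite /double_arcs big_distrr; apply: eq_bigr => j _.
by rewrite /tet_product !mxE /=; ring.
Qed.

Lemma quad_type_cases (Q : 'I_3) : [\/ Q = 0, Q = 1 | Q = 2].
Proof.
by case: Q => -[|[|[|]]] // q; [constructor 1 | constructor 2 | constructor 3]; apply: val_inj.
Qed.

Lemma double_arcs0 S : nonneg S -> double_arcs S = 0 ->
  forall j (Q Q' : 'I_3), Q != Q' -> S j Q = 0 \/ S j Q' = 0.
Proof.
move=> S0 /eqP; rewrite psumr_eq0 => [/allP D0 j|j _]; last by rewrite !addr_ge0 ?mulr_ge0.
have /eqP := D0 j (mem_index_enum _); rewrite /tet_product.
have z Q Q' : S j Q * S j Q' = 0 -> S j Q = 0 \/ S j Q' = 0.
  by move/eqP; rewrite mulf_eq0 => /orP[] /eqP; [left | right].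
have m Q Q' : 0 <= S j Q * S j Q' by rewrite mulr_ge0.
move: (m 0 1) (m 1 2) (m 2 0) => m01 m12 m20 sum0.
have z01 : S j 0 * S j 1 = 0 by lia.
have z12 : S j 1 * S j 2 = 0 by lia.
have z20 : S j 2 * S j 0 = 0 by lia.
move=> Q Q'; case: (quad_type_cases Q) => ->; case: (quad_type_cases Q') => -> // _; apply: z => //;
  by rewrite mulrC.
Qed.

(** If [double_arcs F] is 0, then [F] is embedded and 1-efficiency makes its Euler characteristic at
    most -1; otherwise the quadratic term has a coefficient at least 1 and dominates. *)
Lemma generator_bound (F : quad_vector t) : coset T 0 F -> nonneg F -> F != 0 ->
  exists c : int, 0 <= c /\ forall n : nat,
    n%:Z - c <= n%:Z ^+ 2 * double_arcs F - n%:Z * formal_euler T 0 F.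
Proof.
move=> [x [y FE]] F0 Fn0; set chi := formal_euler T 0 F.
(* This constant suffices because n^2 - n chi - n = n (n - (chi + 1)) >= - (chi + 1)^2. *)
exists ((chi + 1) ^+ 2); split=> [|n]; first exact: sqr_ge0.
have [d0|d0] := eqVneq (double_arcs F) 0.
  have chiE : chi = euler x y by rewrite /chi FE formal_eulerE.
  rewrite add0r in FE.
  have [le0 eq0] := euler_embedded bdry eff FE F0 (double_arcs0 F0 d0).
  have chi_neg : chi <= -1.
    suff : chi <> 0 by rewrite chiE; move: le0; lia.
    by rewrite chiE => /eq0 F00; rewrite F00 eqxx in Fn0.
  rewrite d0 mulr0 sub0r; have := sqr_ge0 (chi + 1).
  have : 0 <= n%:Z * (- chi - 1) by rewrite mulr_ge0 //; lia.
  by lia.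
have d1 : 1 <= double_arcs F by have := double_arcs_ge0 F0; move/eqP: d0; lia.
have h1 : n%:Z ^+ 2 * 1 <= n%:Z ^+ 2 * double_arcs F by apply: ler_wpM2l => //; apply: sqr_ge0.
have := sqr_ge0 (n%:Z - (chi + 1)); have := sqr_ge0 n%:Z; have := sqr_ge0 (chi + 1).
by move: h1; rewrite !expr2; lia.
Qed.

Definition to_ffun (S : quad_vector t) : {ffun 'I_t * 'I_3 -> nat} :=
  [ffun p => `|S p.1 p.2|%N].
Definition of_ffun (f : {ffun 'I_t * 'I_3 -> nat}) : quad_vector t :=
  \matrix_(j, Q) (f (j, Q))%:Z.

Lemma of_ffun_nonneg f : nonneg (of_ffun f).
Proof. by move=> j Q; rewrite mxE. Qed.

Lemma to_ffunK S : nonneg S -> of_ffun (to_ffun S) = S.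
Proof. by move=> S0; apply/matrixP => j Q; rewrite mxE ffunE gez0_abs. Qed.

Lemma minimal_vectors (P : quad_vector t -> Prop) :
  exists H : seq (quad_vector t), (forall h, h \in H -> P h /\ nonneg h) /\
    forall S, nonneg S -> P S -> exists2 h, h \in H & nonneg (S - h).
Proof.
have [H [HP Hle]] := dickson (enum [set: 'I_t * 'I_3]) (fun f => P (of_ffun f)).
exists (map of_ffun H); split=> [_ /mapP[f fH ->]|S S0 PS].
  by split; [apply: HP | apply: of_ffun_nonneg].
have [|f fH fS] := Hle (to_ffun S); first by rewrite to_ffunK.
exists (of_ffun f); first exact: map_f.
move=> j Q; rewrite !mxE; have := fS (j, Q) ltac:(by rewrite mem_enum inE).
by rewrite ffunE /=; move: (S j Q) (f (j, Q)) (S0 j Q) => a b; lia.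
Qed.

Lemma cosetZ (n : int) (F : quad_vector t) : coset T 0 F ->
  coset T 0 (n *: F) /\ formal_euler T 0 (n *: F) = n * formal_euler T 0 F.
Proof.
move=> [x [y ->]].
have -> : n *: (0 + E_span x + T_span y) =
    0 + E_span (fun e => n * x e) + T_span (fun j => n * y j).
  by rewrite E_spanZ T_spanZ !add0r scalerDr.
split; first by exists (fun e => n * x e), (fun j => n * y j).
rewrite !formal_eulerE /euler -!mulr_sumr.
have fin (A B : int) : -2 * (n * A) - n * B = n * (-2 * A - B) by lia.
exact: fin.
Qed.

Definition norm1 (S : quad_vector t) : int := \sum_j \sum_Q S j Q.

Lemma norm1_ge0 S : nonneg S -> 0 <= norm1 S.
Proof. by move=> S0; apply: sumr_ge0 => j _; apply: sumr_ge0. Qed.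

Lemma norm1_gt0 S : nonneg S -> S != 0 -> 0 < norm1 S.
Proof.
move=> S0; apply: contra_neqT; rewrite -leNgt => le0; apply/matrixP => j Q; rewrite mxE.
have /eqP : norm1 S = 0 by apply/eqP; rewrite eq_le le0 norm1_ge0.
rewrite psumr_eq0 => [/allP/(_ j (mem_index_enum _))|i _]; last exact: sumr_ge0.
by rewrite psumr_eq0 // => /allP/(_ Q (mem_index_enum _))/eqP.
Qed.

Lemma norm1B S S' : norm1 (S - S') = norm1 S - norm1 S'.
Proof.
rewrite /norm1 -sumrB; apply: eq_bigr => j _; rewrite -sumrB.
by apply: eq_bigr => Q _; rewrite !mxE.
Qed.

(** A Hilbert basis: the minimal nonzero vectors, finite in number by Dickson's lemma, generate the
    monoid, since subtracting one stays in EE + TT and lowers [norm1]. *)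
Lemma generators : exists r (h : 'I_r -> quad_vector t),
  (forall k, [/\ coset T 0 (h k), nonneg (h k) & h k != 0]) /\
  forall S, nonneg S -> coset T 0 S ->
    exists n : 'I_r -> nat, S = \sum_k (n k)%:Z *: h k.
Proof.
have [H [HP Hle]] := minimal_vectors (fun S => coset T 0 S /\ S != 0).
pose h k := tnth (in_tuple H) k.
have hH k : h k \in H by apply: mem_tnth.
exists (size H), h; split=> [k|S S0 cS].
  by have [[? ?] ?] := HP _ (hH k).
have [m] := ubnP `|norm1 S|%N; elim: m S S0 cS => // m IH S S0 cS Sm.
have [->|Sn0] := eqVneq S 0; first by exists (fun=> 0%N); rewrite big1 // => k _; rewrite scale0r.
have [g gH S'0] := Hle S S0 (conj cS Sn0); have [[cg gn0] g0] := HP g gH.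
have [||n Sn] := IH (S - g) S'0.
- exact: cosetB cS cg.
- by have := norm1_gt0 g0 gn0; have := norm1_ge0 S'0; move: Sm; rewrite norm1B; lia.
have [k gk] : exists k, h k = g.
  by have /tnthP[k ->] : g \in in_tuple H by []; exists k.
exists (fun i => n i + (i == k))%N.
under eq_bigr do rewrite PoszD scalerDl.
rewrite big_split /= -Sn (bigD1 k) //= eqxx scale1r big1 => [|i /negbTE->].
  by rewrite addr0 gk subrK.
by rewrite scale0r.
Qed.

(** Every such vector is one of finitely many minimal ones plus a combination of generators.
    [double_arcs] is superadditive on nonnegative vectors and [formal_euler] is additive, so
    [generator_bound] bounds the coefficients. *)
Lemma finite_euler_bound w (N : int) :
  finite_set [set S | [/\ coset T w S, nonneg S
    & double_arcs S - formal_euler T w S <= N]]%classic.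
Proof.
have [r [h [hP hgen]]] := generators.
have [H [HP Hle]] := minimal_vectors (coset T w).
have cex k : exists c : int, 0 <= c /\ forall n : nat, n%:Z - c <=
    n%:Z ^+ 2 * double_arcs (h k) - n%:Z * formal_euler T 0 (h k).
  by have [c1 c2 c3] := hP k; apply: generator_bound.
have [c cP] := choice cex.
pose M : int := \sum_(m <- H) `|formal_euler T w m|.
(* A bound for every coefficient [n k], from N >= double_arcs S - chi(S) >= sum_k (n k - c k) -
   M. *)
pose B : nat := `|(N + \sum_k c k + M)%R|%N.
pose comb (m : quad_vector t) (n : 'I_r -> nat) (s : seq 'I_r) :=
  m + \sum_(k <- s) (n k)%:Z *: h k.
have combP m n s : m \in H -> [/\ coset T w (comb m n s), nonneg (comb m n s),
    formal_euler T w (comb m n s) =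
      formal_euler T w m + \sum_(k <- s) (n k)%:Z * formal_euler T 0 (h k)
    & \sum_(k <- s) (n k)%:Z ^+ 2 * double_arcs (h k) <= double_arcs (comb m n s)].
  move=> mH; have [cm m0] := HP m mH; elim: s => [|k s [c1 n1 f1 d1]].
    by rewrite /comb !big_nil !addr0; split=> //; apply: double_arcs_ge0.
  have [ck k0 _] := hP k; have [ck' fk] := cosetZ (n k)%:Z ck.
  have nk0 : nonneg ((n k)%:Z *: h k) by move=> j Q; rewrite mxE mulr_ge0.
  have [c2 f2] := cosetD c1 ck'.
  have combE : comb m n (k :: s) = comb m n s + (n k)%:Z *: h k.
    by rewrite /comb big_cons addrCA addrC.
  rewrite combE !big_cons; split=> //.
  - by move=> j Q; rewrite mxE addr_ge0 ?n1 ?nk0.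
  - by rewrite f2 f1 fk addrCA addrC.
  - apply: le_trans (double_arcsD n1 nk0); rewrite double_arcsZ addrC.
    by rewrite lerD2r.
pose G (p : 'I_(size H) * {ffun 'I_r -> 'I_B.+1}) : quad_vector t :=
  comb (tnth (in_tuple H) p.1) (fun k => p.2 k : nat) (index_enum _).
apply: (@sub_finite_set _ _ (G @` setT)%classic); last exact/finite_image/finite_finset.
move=> S [cS S0 SN]; have [m mH Sm0] := Hle S S0 cS; have [cm m0] := HP m mH.
have [n nE] := hgen _ Sm0 (cosetB cS cm).
have SE : S = comb m n (index_enum _) by rewrite /comb -nE addrC subrK.
have [_ _ fS dS] := combP m n (index_enum _) mH.
have sum_le : \sum_k (n k)%:Z <= N + \sum_k c k + M.
  have : \sum_k ((n k)%:Z - c k) <=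
      \sum_k ((n k)%:Z ^+ 2 * double_arcs (h k) - (n k)%:Z * formal_euler T 0 (h k)).
    by apply: ler_sum => k _; apply: (cP k).2.
  rewrite !sumrB; have : formal_euler T w m <= M.
    rewrite /M (big_rem m) //=; apply: le_trans (ler_norm _) _.
    by rewrite lerDl sumr_ge0.
  move: SN; rewrite SE fS; move: dS; lra.
have nB k : (n k < B.+1)%N.
  have : (n k)%:Z <= \sum_k (n k)%:Z by rewrite (bigD1 k) //= lerDl sumr_ge0.
  by move: sum_le; rewrite /B; lia.
have [i mi] : exists i, tnth (in_tuple H) i = m.
  by have /tnthP[i ->] : m \in in_tuple H by []; exists i.
exists (i, [ffun k => Ordinal (nB k)]) => //=; rewrite SE /G /= mi /comb; congr (_ + _).
by apply: eq_bigr => k _; rewrite ffunE.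
Qed.

End Convergence.

(** * Closed spinal surfaces *)

Lemma sum_set_list (F : {set 'I_4} -> nat) (P : pred {set 'I_4}) (s : seq {set 'I_4}) :
  uniq s -> (forall A, P A = (A \in s)) -> (\sum_(A | P A) F A = \sum_(A <- s) F A)%N.
Proof. by move=> us Ps; rewrite (big_uniq _ us) /=; apply: eq_bigl. Qed.

Section SixEdges.
Variables a b c d : 'I_4.
Hypothesis u : uniq [:: a; b; c; d].

Let E := [:: [set a; b]; [set c; d]; [set a; c]; [set b; d]; [set a; d]; [set b; c]].

Lemma six_edges_uniq : uniq E.
Proof.
have [ab ba] : a != b /\ b != a by split; uq.
have [ac ca] : a != c /\ c != a by split; uq.
have [ad da] : a != d /\ d != a by split; uq.
have [bc cb] : b != c /\ c != b by split; uq.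
have [bd db] : b != d /\ d != b by split; uq.
have [cd dc] : c != d /\ d != c by split; uq.
rewrite /E /= !inE !eq_pair //.
by rewrite ?(negbTE ab) ?(negbTE ba) ?(negbTE ac) ?(negbTE ca) ?(negbTE ad) ?(negbTE da)
  ?(negbTE bc) ?(negbTE cb) ?(negbTE bd) ?(negbTE db) ?(negbTE cd) ?(negbTE dc) ?andbF.
Qed.

Lemma six_edgesE (A : {set 'I_4}) : (#|A| == 2) = (A \in E).
Proof.
apply/idP/idP => [/cards2P[v [w [vw ->]]]|].
  have /or4P[] := uniq4_cover v u => /eqP vE; have /or4P[] := uniq4_cover w u => /eqP wE;
    rewrite {}vE {}wE in vw *; rewrite ?eqxx // in vw;
    rewrite /E !inE ?eqxx ?orbT //; rewrite finset.setUC ?eqxx ?orbT //.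
rewrite /E !inE => /or4P[/eqP->|/eqP->|/eqP->|/or3P[/eqP->|/eqP->|/eqP->]];
  rewrite cards2; apply/eqP; congr _.+1; apply/eqP; rewrite eqb1; uq.
Qed.

End SixEdges.

Section Spinal.
Variables (t : nat) (T : triangulation t).
Hypothesis bdry : torus_boundary T.

Implicit Types u : coloring T.

Definition pair_color u j (a b : 'I_4) : nat := color u j [set a; b].

Lemma pair_color_sym u j a b : pair_color u j a b = pair_color u j b a.
Proof. by rewrite /pair_color finset.setUC. Qed.

Lemma pair_colorE u j a b :
  (pair_color u j a b)%:Z = edge_value (fun e => (u e)%:Z) j a b.
Proof.
by rewrite edge_valueE /pair_color /color (big_morph Posz PoszD (erefl _)).
Qed.

Lemma color_class u (e : ideal_edge T) j a b : (j, [set a; b]) \in val e ->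
  pair_color u j a b = u e.
Proof.
move=> je; apply/eqP; rewrite -eqz_nat pair_colorE edge_valueE.
by rewrite (cell_valueE (fun e => (u e)%:Z) je).
Qed.

Lemma edge_colored u (e : ideal_edge T) : exists j a b f z,
  [/\ uniq [:: f; a; b; z], (j, [set a; b]) \in val e & pair_color u j a b = u e].
Proof.
have := class_cellP e; have := cell_class_card (class_cellP e).
case: (class_cell e) => j A /= /eqP/cards2P[a [b [ab ->]]] je.
have [f [z uu]] := uniq2_complete ab.
have u' : uniq [:: f; a; b; z] by uq.
by exists j, a, b, f, z; split; [exact: u' | exact: je | apply: color_class].
Qed.

Lemma double_half_sum u j a b c d : spinal u -> uniq [:: a; b; c; d] ->
  (2 * half_sum u j (quad_facing a b) = pair_color u j a c + pair_color u j b d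
    + pair_color u j a d + pair_color u j b c)%N.
Proof.
move=> su uu; rewrite /half_sum.
rewrite (sum_set_list _ (s := [:: [set a; c]; [set b; d]; [set a; d]; [set b; c]])).
- rewrite !big_cons big_nil -!/(pair_color _ _ _ _) addn0 !addnA.
  (* The faces acd and bcd have even sums and share the edge cd, so the sum of the four remaining
     colors is even and the half is exact. *)
  have [/and4P[o1 _ _ _]] : admissible (pair_color u j a c) (pair_color u j c d) (pair_color u j a d).
    by apply: (su j b a c d); uq.
  have [/and4P[o2 _ _ _]] : admissible (pair_color u j b c) (pair_color u j c d) (pair_color u j b d).
    by apply: (su j a b c d); uq.
  by move: o1 o2; clear; lia.
- by have := six_edges_uniq uu; rewrite cons_uniq => /andP[_]; rewrite cons_uniq => /andP[].
- move=> A; rewrite (six_edgesE uu) (faces_quad_facing A uu) !inE negb_or.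
  have := six_edges_uniq uu; rewrite /= !inE !negb_or.
  have [->|_] := eqVneq A [set a; b].
    by move=> /andP[/and5P[/negbTE-> /negbTE-> /negbTE-> /negbTE-> /negbTE->]].
  have [->|_] := eqVneq A [set c; d] => /=.
    by case/and3P=> _ /and4P[/negbTE-> /negbTE-> /negbTE-> /negbTE->].
  by move=> _; rewrite andbT.
Qed.

Lemma double_face_half_sum u j f a b c : spinal u -> uniq [:: f; a; b; c] ->
  (2 * face_half_sum u j f =
    pair_color u j a b + pair_color u j b c + pair_color u j a c)%N.
Proof.
move=> su uu; rewrite /face_half_sum.
rewrite (sum_set_list _ (s := [:: [set a; b]; [set b; c]; [set a; c]])).
- rewrite !big_cons big_nil -!/(pair_color _ _ _ _) addn0 !addnA.
  have [/and4P[o1 _ _ _]] : admissible (pair_color u j a b) (pair_color u j b c) (pair_color u j a c).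
    exact: (su j f a b c uu).
  by move: o1; clear; lia.
- have ab : a != b by uq.
  have bc : b != c by uq.
  have ac : a != c by uq.
  have [ba ca cb] : [/\ b != a, c != a & c != b] by split; uq.
  rewrite /= !inE !eq_pair //.
  by rewrite ?(negbTE ab) ?(negbTE ba) ?(negbTE ac) ?(negbTE ca) ?(negbTE bc) ?(negbTE cb) ?andbF.
- move=> A; rewrite (six_edgesE uu) !inE.
  have ff x : uniq [:: f; x] = (f != x) by rewrite /= inE andbT.
  apply/idP/idP => [/andP[/or4P[/eqP->|/eqP->|/eqP->|/or3P[/eqP->|/eqP->|/eqP->]]]|].
  + by rewrite !inE eqxx.
  + by rewrite eqxx orbT.
  + by rewrite !inE eqxx.
  + by rewrite eqxx !orbT.
  + by rewrite !inE eqxx.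
  + by rewrite eqxx.
  + by case/or3P => /eqP->; rewrite !inE eqxx ?orbT /=; uq.
Qed.

Lemma min_half_sumP u j : (forall Q, (min_half_sum u j <= half_sum u j Q)%N) /\
  exists Q, half_sum u j Q = min_half_sum u j.
Proof.
rewrite /min_half_sum; split=> [Q|].
  by case: (quad_type_cases Q) => ->; rewrite !geq_min leqnn ?orbT.
have [h01|h01] := leqP (half_sum u j 0) (minn (half_sum u j 1) (half_sum u j 2)).
  by exists 0.
have [h12|h12] := leqP (half_sum u j 1) (half_sum u j 2); first by exists 1.
by exists 2.
Qed.

Definition normal_form (S : quad_vector t) : Prop :=
  forall j : 'I_t, (forall Q, 0 <= S j Q) /\ (exists Q, S j Q = 0).

Lemma normal_form_eq (S S' : quad_vector t) : normal_form S -> normal_form S' ->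
  (forall j Q Q', S j Q - S' j Q = S j Q' - S' j Q') -> S = S'.
Proof.
move=> nS nS' SS'; apply/matrixP => j Q.
have [S0 [Q1 z1]] := nS j; have [S0' [Q2 z2]] := nS' j.
by have := SS' j Q1 Q2; have := SS' j Q Q1; have := S0 Q2; have := S0' Q1; rewrite z1 z2; lia.
Qed.

Lemma spinal_normal_form u : normal_form (spinal_quads u).
Proof.
move=> j; have [le [Q0 e]] := min_half_sumP u j; split=> [Q|]; last first.
  by exists Q0; rewrite mxE e subrr.
by rewrite mxE subr_ge0; apply: le.
Qed.

Lemma total_edgesE u j a b c d : uniq [:: a; b; c; d] ->
  \sum_Q E_span (fun e => (u e)%:Z) j Q =
  (pair_color u j a b + pair_color u j c d + pair_color u j a c + pair_color u j b d
  + pair_color u j a d + pair_color u j b c)%N%:Z.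
Proof.
move=> u1; rewrite (big_quad_types _ _ u1) /= (E_spanE _ j u1).
have u2 : uniq [:: a; c; b; d] by uq.
have u3 : uniq [:: a; d; b; c] by uq.
rewrite (E_spanE _ j u2) (E_spanE _ j u3) -!pair_colorE; clear; lia.
Qed.

Lemma half_sumE u j Q : spinal u ->
  2 * (half_sum u j Q)%:Z =
  \sum_Q' E_span (fun e => (u e)%:Z) j Q' - E_span (fun e => (u e)%:Z) j Q.
Proof.
move=> su; have ab : ord0 != lift ord0 Q by [].
have [c [d uu]] := uniq2_complete ab.
have := double_half_sum j su uu; rewrite quad_facing_lift => h.
have := E_spanE (fun e => (u e)%:Z) j uu; rewrite quad_facing_lift => ->.
rewrite (total_edgesE _ _ uu) -!pair_colorE.
by move: h; clear; lia.
Qed.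

(** A half sum is half of the total color of the tetrahedron minus the colors of the two edges
    faced; hence the color of an edge enters with coefficient -1 in the doubled vector. *)
Lemma spinal_quadsE u : spinal u -> 2 *: spinal_quads u =
  E_span (fun e => - (u e)%:Z) +
  T_span (fun j => \sum_Q E_span (fun e => (u e)%:Z) j Q - 2 * (min_half_sum u j)%:Z).
Proof.
move=> su; apply/matrixP => j Q; rewrite !mxE T_spanE mulrBr (half_sumE j Q su).
have -> : (fun e => - (u e)%:Z) = (fun e => (-1) * (u e)%:Z) :> (ideal_edge T -> int).
  by apply: funext => e; rewrite mulN1r.
by rewrite E_spanZ mxE; ring.
Qed.

Lemma face_half_sums u j : spinal u ->
  (\sum_f face_half_sum u j f)%N%:Z = \sum_Q E_span (fun e => (u e)%:Z) j Q.
Proof.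
move=> su; pose o1 := @Ordinal 4 1 isT; pose o2 := @Ordinal 4 2 isT; pose o3 := @Ordinal 4 3 isT.
have u0 : uniq [:: ord0; o1; o2; o3] by [].
have u1 : uniq [:: o1; ord0; o2; o3] by [].
have u2 : uniq [:: o2; ord0; o1; o3] by [].
have u3 : uniq [:: o3; ord0; o1; o2] by [].
rewrite (total_edgesE _ _ u0) (big_vertices _ _ u0) /=.
have := double_face_half_sum j su u0; have := double_face_half_sum j su u1.
have := double_face_half_sum j su u2; have := double_face_half_sum j su u3.
by clear; lia.
Qed.

(** The hypothesis provides some coefficients for the quad vector, [spinal_quadsE] explicit ones for
    its double; [euler_sub] with factor 2 compares them. *)
Lemma spinal_eulerE u : spinal u -> coset T 0 (spinal_quads u) ->
  spinal_euler u = formal_euler T 0 (spinal_quads u).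
Proof.
move=> su [x [y qE]].
rewrite [in RHS]qE formal_eulerE // /spinal_euler.
have qE' : spinal_quads u = E_span x + T_span y by rewrite qE add0r.
have := @euler_sub _ T bdry x (fun e => - (u e)%:Z) y
  (fun j => \sum_Q E_span (fun e => (u e)%:Z) j Q - 2 * (min_half_sum u j)%:Z) 2.
rewrite -qE' => /(_ (spinal_quadsE su)); rewrite [X in _ = X]/euler.
rewrite sumrN sumrB -mulr_sumr -!(big_morph Posz PoszD (erefl _)).
have -> : \sum_j \sum_Q E_span (fun e => (u e)%:Z) j Q =
  (\sum_(j < t) \sum_(f < 4) face_half_sum u j f)%N%:Z.
  by rewrite (big_morph Posz PoszD (erefl _)); apply: eq_bigr => j _; rewrite face_half_sums.
(* The hypothesis also forces [F] to be even, which makes its half exact. *)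
have fin (E : int) (U F M : nat) :
  2 * E = - 2 * - U%:Z - (F%:Z - 2 * M%:Z) -> U%:Z - F./2%:Z + M%:Z = E by lia.
exact: fin.
Qed.

End Spinal.

(** * Peeling off boundary tori *)

Section Peeling.
Variables (t : nat) (T : triangulation t).

Implicit Types (u : coloring T) (C : ideal_vertex T).

(** The number of ends of an edge at a cusp is the number of points where the vertex link meets
    it. *)
Definition link_color C : coloring T := [ffun e => edge_weight (vertex_link C) (class_cell e)].

Lemma link_colorE C (e : ideal_edge T) j A : (j, A) \in val e ->
  link_color C e = (\sum_(a in A) ((j, [set a]) \in val C))%N.
Proof.
move=> jA; rewrite ffunE -(edge_weight_class (vertex_link_emb C) jA) /edge_weight /=.
by rewrite [X in (_ + X)%N]big1 ?addn0.
Qed.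

Lemma link_color_torus C : is_boundary_torus C (link_color C).
Proof.
move=> e j A jA; rewrite (link_colorE C jA) -sum1_card big_mkcond [RHS]big_mkcond /=.
by apply: eq_bigr => a _; rewrite inE; case: (a \in A); case: (_ \in val C).
Qed.

Lemma pair_class j a b : a != b -> exists e : ideal_edge T, (j, [set a; b]) \in val e.
Proof. by move=> ab; apply: (cell_class_ex T (x := (j, [set a; b]))); rewrite cards2 ab. Qed.

Lemma torus_color C (b : coloring T) j x y : is_boundary_torus C b -> x != y ->
  pair_color b j x y = (((j, [set x]) \in val C) + ((j, [set y]) \in val C))%N.
Proof.
move=> Cb xy; have [e je] := pair_class j xy.
rewrite (color_class b je) (Cb e j _ je) -(link_color_torus C je) (link_colorE C je).
by rewrite big_setU1 ?big_set1 ?inE.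
Qed.

Lemma pair_colorD u u' (b : coloring T) j x y : x != y -> (forall e, u e = (u' e + b e)%N) ->
  pair_color u j x y = (pair_color u' j x y + pair_color b j x y)%N.
Proof.
by move=> xy ub; have [e je] := pair_class j xy; rewrite !(color_class _ je).
Qed.

Lemma spinal_face u j f x y z : spinal u -> uniq [:: f; x; y; z] ->
  [/\ ~~ odd (pair_color u j x y + pair_color u j y z + pair_color u j x z),
      (pair_color u j x y <= pair_color u j y z + pair_color u j x z)%N,
      (pair_color u j y z <= pair_color u j x y + pair_color u j x z)%N
    & (pair_color u j x z <= pair_color u j x y + pair_color u j y z)%N].
Proof. by move=> su uu; have /and4P[] := su j f x y z uu. Qed.

(** The excess xy + xz - yz at a corner x of a face is twice the number of arcs around it.
    Subtracting the boundary torus lowers it by 2 exactly at the corners in [C], so admissibility is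
    preserved when these excesses are at least 2. *)
Lemma peel u C : spinal u ->
  (forall j f x y z, uniq [:: f; x; y; z] -> (j, [set x]) \in val C ->
     (pair_color u j y z + 2 <= pair_color u j x y + pair_color u j x z)%N) ->
  ~ unpeelable u.
Proof.
move=> su uC; apply; have bT := link_color_torus C; set b := link_color C in bT.
have le_b e : (b e <= u e)%N.
  have [j [x [y [f [z [uu je <-]]]]]] := edge_colored u e.
  have xy : x != y by uq.
  rewrite -(color_class b je) (torus_color _ bT xy).
  have uy : uniq [:: f; y; x; z] by uq.
  have [_ h1 h2 h3] := spinal_face j su uu.
  move: (uC j f x y z uu) (uC j f y x z uy); rewrite (pair_color_sym u j y x).
  by move: h1 h2 h3; case: (_ \in _); case: (_ \in _) => h1 h2 h3 h4 h5; lia.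
pose u' : coloring T := [ffun e => (u e - b e)%N].
have ub e : u e = (u' e + b e)%N by rewrite ffunE subnK.
exists C, b, u'; split=> // j f x y z uu.
have [h0 h1 h2 h3] := spinal_face j su uu.
have [xy yz xz] : [/\ x != y, y != z & x != z] by split; uq.
have ux := uC j f x y z uu.
have uy : uniq [:: f; y; x; z] by uq.
have {}uy := uC j f y x z uy.
have uz : uniq [:: f; z; x; y] by uq.
have {}uz := uC j f z x y uz.
rewrite (pair_color_sym u j y x) in uy.
rewrite (pair_color_sym u j z x) (pair_color_sym u j z y) in uz.
rewrite /admissible -!/(pair_color _ _ _ _).
move: h0 h1 h2 h3 ux uy uz; rewrite !(pair_colorD j _ ub) // !(torus_color j bT) //.
by case: (_ \in _); case: (_ \in _); case: (_ \in _) => h0 h1 h2 h3 ux uy uz; lia.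
Qed.

Section Unique.
Variables u u' : coloring T.
Hypotheses (su : spinal u) (su' : spinal u').
Hypothesis eqS : spinal_quads u = spinal_quads u'.

Let D j a b : int := (pair_color u j a b)%:Z - (pair_color u' j a b)%:Z.

Let y j : int := \sum_Q E_span (fun e => (u e)%:Z) j Q - \sum_Q E_span (fun e => (u' e)%:Z) j Q
  - 2 * ((min_half_sum u j)%:Z - (min_half_sum u' j)%:Z).

Let D_opposite j a b c d : uniq [:: a; b; c; d] -> D j a b + D j c d = y j.
Proof.
move=> uu; have := congr1 (fun S : quad_vector t => S j (quad_facing a b)) eqS; rewrite !mxE.
have := half_sumE j (quad_facing a b) su; have := half_sumE j (quad_facing a b) su'.
rewrite !(E_spanE _ j uu) -!pair_colorE /D /y.
by set A := \sum_Q _; set B := \sum_Q _; clearbody A B; clear; lia.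
Qed.

Let P j v : int := \sum_(a | a != v) D j v a - y j.

Let PE j v a b c : uniq [:: v; a; b; c] -> P j v = D j v a + D j v b - D j a b.
Proof.
move=> uu; have uu' : uniq [:: v; c; a; b] by uq.
by rewrite /P -(D_opposite j uu') (big_other_vertices _ _ uu) /=; ring.
Qed.

Let P_glue j f a : a != f -> P (nbr T j f) (glue T j f a) = P j a.
Proof.
rewrite eq_sym => fa; have [b [c uu]] := uniq2_complete fa.
have uu1 : uniq [:: a; b; c; f] by uq.
have fab : uniq [:: f; a; b] by uq.
have fac : uniq [:: f; a; c] by uq.
have fbc : uniq [:: f; b; c] by uq.
have uu2 : uniq [:: glue T j f a; glue T j f b; glue T j f c; glue T j f f].
  by have := map_inj_uniq (@perm_inj _ (glue T j f)) [:: a; b; c; f]; rewrite uu1.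
rewrite (PE _ uu1) (PE _ uu2) /D !pair_colorE.
by rewrite !(edge_value_glue _ j fab) !(edge_value_glue _ j fac) !(edge_value_glue _ j fbc).
Qed.

(** The left side is the value [P] at the ideal vertex of [v] of the difference of the excesses of
    [u] and [u']. Excesses are even and nonnegative, so P > 0 would make the excess of [u] at least
    2 at every corner of that ideal vertex, and a torus could be peeled off. *)
Lemma unpeelable_excess j v a b c : unpeelable u -> uniq [:: v; a; b; c] ->
  D j v a + D j v b - D j a b <= 0.
Proof.
move=> unp uu; rewrite -(PE j uu) leNgt; apply/negP => P0.
pose phi (z : cell t) := \sum_(x in z.2) P z.1 x.
have [w wP] : exists w : ideal_vertex T -> int,
    forall (C : ideal_vertex T) (z : cell t), z \in val C -> phi z = w C.
  apply: cell_function => -[i A] _ /= /eqP/cards1P[x ->] /existsP[f /= /andP[fx /eqP->]].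
  rewrite imset_set1 /phi /= !big_set1 P_glue //.
  by move: fx; rewrite inE eq_sym.
have [C vC] := cell_class_ex T (x := (j, [set v])) (cards1 v).
apply: (peel (C := C) su) unp => i f x x1 x2 ux xC.
have ux' : uniq [:: x; x1; x2; f] by uq.
have Pxv : P i x = P j v.
  by have := wP _ _ xC; have := wP _ _ vC; rewrite /phi !big_set1 => -> ->.
have := PE i ux'; rewrite Pxv /D.
have [h0 _ h1 _] := spinal_face i su ux; have [h0' _ h1' _] := spinal_face i su' ux.
by move: P0 h0 h1 h0' h1'; clear; lia.
Qed.

End Unique.

Lemma spinal_quads_inj u u' : spinal u -> spinal u' -> unpeelable u -> unpeelable u' ->
  spinal_quads u = spinal_quads u' -> u = u'.
Proof.
move=> su su' pu pu' eqS; apply/ffunP => e.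
have [j [a [b [f [z [uu je <-]]]]]] := edge_colored u e.
rewrite -(color_class u' je).
have uu1 : uniq [:: a; b; f; z] by uq.
have uu2 : uniq [:: b; a; f; z] by uq.
have uu3 : uniq [:: a; f; b; z] by uq.
(* Adding the inequalities at the two ends of the edge ab leaves twice the difference of its colors;
   exchanging the surfaces gives the opposite bound. *)
have := unpeelable_excess su su' eqS j pu uu1; have := unpeelable_excess su su' eqS j pu uu2.
have := unpeelable_excess su' su (esym eqS) j pu' uu1.
have := unpeelable_excess su' su (esym eqS) j pu' uu2.
rewrite !(pair_color_sym _ j b a).
by clear; lia.
Qed.

Lemma spinal_quads_difference u j Q Q' : spinal u ->
  2 * (spinal_quads u j Q - spinal_quads u j Q') =
  E_span (fun e => (u e)%:Z) j Q' - E_span (fun e => (u e)%:Z) j Q.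
Proof.
move=> su; rewrite !mxE; have := half_sumE j Q su; have := half_sumE j Q' su.
by set A := \sum_Q _; clearbody A; clear; lia.
Qed.

(** The colors of a boundary torus have the same sum on the three pairs of opposite edges of a
    tetrahedron, so they do not change the differences of quad coordinates, and these determine a
    normal form. *)
Lemma spinal_quads_peel C (b u u' : coloring T) : is_boundary_torus C b ->
  spinal u -> spinal u' -> (forall e, u e = (u' e + b e)%N) -> spinal_quads u = spinal_quads u'.
Proof.
move=> bT su su' ub; apply: normal_form_eq; [exact: spinal_normal_form..|].
move=> j Q Q'; have := spinal_quads_difference j Q Q' su.
have := spinal_quads_difference j Q Q' su'.
have -> : (fun e => (u e)%:Z) = (fun e => (u' e)%:Z + (b e)%:Z).
  by apply: funext => e; rewrite ub PoszD.
rewrite E_spanD !mxE.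
have bc Q1 Q2 : E_span (fun e => (b e)%:Z) j Q1 = E_span (fun e => (b e)%:Z) j Q2.
  have bQ Q0 : E_span (fun e => (b e)%:Z) j Q0 = \sum_a ((j, [set a]) \in val C)%:Z.
    have ab : ord0 != lift ord0 Q0 by [].
    have [c [d uu]] := uniq2_complete ab.
    have cd : c != d by uq.
    have := E_spanE (fun e => (b e)%:Z) j uu; rewrite quad_facing_lift => ->.
    rewrite -!pair_colorE !(torus_color j bT) // (big_vertices _ _ uu) /= !PoszD.
    by rewrite !addrA.
  by rewrite !bQ.
rewrite (bc Q' Q).
by set A := E_span _ _ _; set B := E_span _ _ _; set D := E_span _ _ _; clearbody A B D; clear; lia.
Qed.

Lemma spinal_quads_surj S : normal_form S -> coset T 0 S ->
  exists u, [/\ spinal u, unpeelable u & spinal_quads u = S].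
Proof.
move=> nS [x [y SE]].
have [u su uS] : exists2 u : coloring T, spinal u & spinal_quads u = S.
  (* By [spinal_quadsE], colors should be -2 times the coefficients in EE. Adding 2 K to all of them
     amounts to [K] copies of every boundary torus, as an edge has two ends; K >= 3 |x e| yields the
     triangle inequalities, and parity holds since the colors are even. *)
  pose K : int := 3 * \sum_(e : ideal_edge T) `|x e|.
  pose u : coloring T := [ffun e => absz (2 * (K - x e))].
  have xK e : 3 * `|x e| <= K.
    rewrite ler_pM2l //; rewrite (bigD1 e) //= lerDl; exact: sumr_ge0.
  have uE e : (u e)%:Z = 2 * (K - x e) by rewrite ffunE; have := xK e; lia.
  have su : spinal u.
    move=> j f a b c uu; have [ab bc ac] : [/\ a != b, b != c & a != c] by split; uq.
    have [e1 h1] := pair_class j ab; have [e2 h2] := pair_class j bc.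
    have [e3 h3] := pair_class j ac.
    rewrite /admissible -!/(pair_color _ _ _ _) (color_class u h1) (color_class u h2).
    rewrite (color_class u h3).
    have := uE e1; have := uE e2; have := uE e3; have := xK e1; have := xK e2; have := xK e3.
    by clear; lia.
  exists u => //; apply: normal_form_eq => //; first exact: spinal_normal_form.
  move=> j Q Q'; have := spinal_quads_difference j Q Q' su.
  have -> : (fun e => (u e)%:Z) = (fun e => 2 * K + (-2) * x e).
    by apply: funext => e; rewrite uE; ring.
  rewrite E_spanD (E_spanZ (-2) x) SE !mxE !T_spanE.
  have kc Q1 : E_span (fun _ : ideal_edge T => 2 * K) j Q1 = 2 * K + 2 * K.
    have ab : ord0 != lift ord0 Q1 by [].
    have [c [d uu]] := uniq2_complete ab; have cd : c != d by uq.
    have := E_spanE (fun _ : ideal_edge T => 2 * K) j uu; rewrite quad_facing_lift => ->.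
    have [e1 h1] := pair_class j ab; have [e2 h2] := pair_class j cd.
    by rewrite !edge_valueE (cell_valueE _ h1) (cell_valueE _ h2).
  rewrite !kc; set A := E_span _ _ _; set B := E_span _ _ _; clearbody A B.
  by clear; lia.
(* Peeling keeps the quads and lowers the total color, so it ends at an unpeelable surface. *)
have [n un] : exists n, (\sum_e u e < n)%N by exists (\sum_e u e).+1.
elim: n u su uS un => // n IH u su uS un.
have [pu|/contrapT[C [b [u' [bT su' ub]]]]] := pselect (unpeelable u); first by exists u.
apply: (IH u' su'); first by rewrite -(spinal_quads_peel bT su su' ub).
rewrite -ltnS; apply: leq_trans un; rewrite ltnS.
have -> : (\sum_e u e = \sum_e u' e + \sum_e b e)%N.
  by rewrite -big_split; apply: eq_bigr => e _; apply: ub.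
rewrite -addn1 leq_add2l.
(* An edge at a corner belonging to the ideal vertex has positive color in the boundary torus, so
   the decrease is strict. *)
have [[j A] aC] := cell_class_rep C.
have /eqP/cards1P[a /= AE] := cell_class_card aC; rewrite AE in aC.
have [f ua] : exists f, a != f.
  by have [a0|a0] := eqVneq a ord0; [exists (lift ord0 ord0); rewrite a0 | exists ord0].
have [e je] := pair_class j ua.
rewrite (bigD1 e) //= -(color_class b je) (torus_color j bT ua) aC.
by clear; lia.
Qed.

End Peeling.

(** * Comparison of the two state sums *)

Section Weights.
Variable t : nat.
Implicit Type S : quad_vector t.

Definition J_product S : laurent := \prod_j J_laurent (S j 0) (S j 1) (S j 2).

Lemma weight_FKB chi S : weight J_FKB chi S = val (mon ((-1) ^ (- chi)) (- chi) * J_product S).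
Proof.
rewrite laurent_valM laurent_val_prod; congr qmul.
by apply: eq_bigr => j _; rewrite val_J_laurent.
Qed.

Lemma weight_J_Delta chi S : weight J_Delta chi S = weight J_FKB chi S.
Proof. by congr qmul; apply: eq_bigr => j _; rewrite J_FKB_Delta. Qed.

Lemma J_product_shift S y :
  J_product (S + T_span y) = mon ((-1) ^ (- \sum_j y j)) (- \sum_j y j) * J_product S.
Proof.
have -> : mon ((-1) ^ (- \sum_j y j)) (- \sum_j y j) = \prod_j mon ((-1) ^ (- y j)) (- y j).
  apply: (big_ind2 (fun k f => mon ((-1) ^ (- k)) (- k) = f)) => //.
  by move=> k f l h <- <-; rewrite monM -signD -opprD.
rewrite -big_split; apply: eq_bigr => j _.
by rewrite !mxE !T_spanE J_laurent_shift.
Qed.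

(** The monomial produced by shifting the arguments of J cancels the one coming from the value -1 of
    the Euler characteristic on each [T_vec]. *)
Lemma weight_shift chi S y :
  weight J_FKB (chi - \sum_j y j) (S + T_span y) = weight J_FKB chi S.
Proof.
rewrite !weight_FKB J_product_shift mulrA monM -signD.
by have -> : - (chi - \sum_j y j) + - \sum_j y j = - chi by ring.
Qed.

Lemma qlbound_weight chi S : normal_form S ->
  qlbound (double_arcs S - chi) (weight J_FKB chi S).
Proof.
move=> nS; rewrite weight_FKB addrC; apply: qlboundM; first exact: qlbound_qmon.
apply: (big_ind2 (fun k (f : laurent) => qlbound k (val f))) => [|k f l h|j _].
- by rewrite -mon1; apply: qlbound_qmon.
- exact: qlboundM.
have [S0 [Q SQ]] := nS j; apply: qlbound_J_laurent => //.
have [q|q|q] := quad_type_cases Q.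
- by left; rewrite -q.
- by right; left; rewrite -q.
- by right; right; rewrite -q.
Qed.

Lemma normal_form_ex S : exists y, normal_form (S + T_span y).
Proof.
exists (fun j => - Num.min (S j 0) (Num.min (S j 1) (S j 2))) => j.
split=> [Q|].
  by rewrite mxE T_spanE subr_ge0 !ge_min; case: (quad_type_cases Q) => ->; rewrite lexx ?orbT.
have : [\/ S j 0 = Num.min (S j 0) (Num.min (S j 1) (S j 2)),
    S j 1 = Num.min (S j 0) (Num.min (S j 1) (S j 2)) |
    S j 2 = Num.min (S j 0) (Num.min (S j 1) (S j 2))].
  by case: (leP (S j 1) (S j 2)) => _; case: leP => _; by [constructor 1|constructor 2|constructor 3].
by case=> e; [exists 0 | exists 1 | exists 2]; rewrite mxE T_spanE -e subrr.
Qed.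

Lemma normal_form_class S S' : normal_form S -> normal_form S' ->
  class_mod_T S = class_mod_T S' -> S = S'.
Proof.
move=> nS nS' eqC; have : class_mod_T S' S.
  by rewrite -eqC; exists (fun=> 0); apply/matrixP => j Q; rewrite mxE T_spanE addr0.
move=> [y SE]; apply: normal_form_eq => // j Q Q'.
by rewrite SE !mxE !T_spanE; ring.
Qed.

Lemma class_mod_T_shift S y : class_mod_T (S + T_span y) = class_mod_T S.
Proof.
apply/seteqP; split=> S' [z ->].
  by exists (fun j => y j + z j); rewrite T_spanD addrA.
exists (fun j => z j + (-1) * y j); rewrite T_spanD T_spanZ scaleN1r.
by rewrite addrACA subrr addr0 addrC.
Qed.

End Weights.

Section Comparison.
Variables (t : nat) (T : triangulation t) (c : multicurve t).
Hypotheses (bdry : torus_boundary T) (eff : one_efficient T).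

Let w := w_vec c.

Lemma formal_euler_shift (S : quad_vector t) y : coset T w S ->
  coset T w (S + T_span y) /\
  formal_euler T w (S + T_span y) = formal_euler T w S - \sum_j y j.
Proof.
move=> wS; have E0 : E_span (fun _ : ideal_edge T => 0) = 0 :> quad_vector t.
  by rewrite /E_span big1 // => e _; rewrite scale0r.
have yE : T_span y = 0 + E_span (fun _ : ideal_edge T => 0) + T_span y by rewrite E0 !add0r.
have [|wSy ->] := cosetD bdry wS (F := T_span y); first by exists (fun=> 0), y.
split=> //; rewrite [X in formal_euler T 0 X]yE formal_eulerE // /euler.
by rewrite big1 // mulr0 sub0r.
Qed.

Lemma index_termE (S : quad_vector t) : coset T w S ->
  index_term T c (class_mod_T S) = weight J_FKB (formal_euler T w S) S.
Proof.
move=> wS; rewrite /index_term.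
have : class_mod_T S (xget 0 (class_mod_T S)).
  apply: xgetPex; exists S, (fun=> 0).
  by apply/matrixP => j Q; rewrite mxE T_spanE addr0.
move=> [y ->]; have [_ ->] := formal_euler_shift y wS.
by rewrite weight_J_Delta weight_shift.
Qed.

(** Both sums of the FKB invariant are sums over normal forms, indexed by colorings through
    [spinal_quads] when the class is 0 and by the vectors themselves otherwise; the index set is
    kept abstract to treat them together. *)
Lemma sum_normal_forms (I : choiceType) (A : set I) (q : I -> quad_vector t) (F : I -> qseries) :
  (forall i, A i -> [/\ coset T w (q i), normal_form (q i)
     & F i = weight J_FKB (formal_euler T w (q i)) (q i)]) ->
  (forall i i', A i -> A i' -> q i = q i' -> i = i') ->
  (forall S, coset T w S -> normal_form S -> exists2 i, A i & q i = S) ->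
  qsummable A F /\ index3D_converges T c /\ qsum A F = index3D T c.
Proof.
move=> Aq q_inj q_surj; pose h i := class_mod_T (q i).
have hF i : A i -> index_term T c (h i) = F i.
  by move=> /Aq[wq _ ->]; apply: index_termE.
have h_bij : set_bij A (index_classes T c) h.
  split=> [i /Aq[wq _ _]|i i' Ai Ai' hi|C [S wS <-]].
  - by exists (q i).
  - move: Ai Ai'; rewrite !inE => Ai Ai'; apply: q_inj => //.
    by have [_ n _] := Aq _ Ai; have [_ n' _] := Aq _ Ai'; apply: normal_form_class.
  - have [y ny] := normal_form_ex S; have [wSy _] := formal_euler_shift y wS.
    have [i Ai qi] := q_surj _ wSy ny.
    by exists i => //; rewrite /h qi class_mod_T_shift.
have AF : qsummable A F.
  move=> N; set X := [set i | _]%classic.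
  have X_A i : X i -> A i by case.
  have /eq_finite_set <- : (q @` X #= X)%card.
    by apply: inj_card_eq => i i'; rewrite !inE => /X_A Ai /X_A Ai'; apply: q_inj.
  apply: sub_finite_set (finite_euler_bound bdry eff w N) => _ [i [Ai [k [kN Fk]]] <-].
  have [wq nq FE] := Aq _ Ai; split=> //; first by move=> j Q; have [] := nq j.
  rewrite leNgt; apply: contra_neqN Fk => lt; rewrite FE.
  by apply: (qlbound_weight nq); apply: le_lt_trans kN lt.
split=> //; split.
  move=> N; apply: sub_finite_set (finite_image h (AF N)) => C [CC [k [kN Ck]]].
  have [_ _ /(_ _ CC)[i Ai hi]] := h_bij.
  by exists i => //; split=> //; exists k; rewrite -hF ?hi.
apply: funext => k; rewrite /index3D /qsum (reindex_fsbig h A _ _ h_bij).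
by apply: eq_fsbigr => i; rewrite inE => /hF->.
Qed.

End Comparison.

Lemma w_vec0 t (c : multicurve t) : arcs c = finset.set0 -> w_vec c = 0.
Proof.
move=> c0; apply/matrixP => j Q; rewrite !mxE big1 // => v _; rewrite big1 // => a _.
by rewrite /corner_sign c0 big_pred0 // => x; rewrite inE.
Qed.

Theorem theorem1p1 (t : nat) (T : triangulation t)
    (nonempty : (0 < t)%N)
    (bdry : torus_boundary T)
    (eff : one_efficient T)
    (g : chain t) (g_cycle : is_cycle T g)
    (c : multicurve t) (c_rep : represents T c g) :
  FKB_converges T g c /\ index3D_converges T c /\ FKB T g c = index3D T c.
Proof.
rewrite /FKB_converges /FKB; case: asboolP => [g0|_].
  (* The zero class is represented by the empty multicurve, so w = 0 and both sums run over EE +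
     TT. *)
  have [_ _ _ /(_ g0)/w_vec0 w0] := c_rep.
  apply: (sum_normal_forms bdry eff (q := @spinal_quads t T)); rewrite ?w0.
  - move=> u [su _ wu]; split=> //; first exact: spinal_normal_form.
    by rewrite /closed_term spinal_eulerE.
  - by move=> u u' [su pu _] [su' pu' _]; apply: spinal_quads_inj.
  - move=> S wS nS; have [u [su pu uS]] := spinal_quads_surj nS wS.
    by exists u => //; split=> //; rewrite uS.
by apply: (sum_normal_forms bdry eff (q := id)) => [S [wS nS]|//|S wS nS]; [split | exists S].
Qed.
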